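(* There is an absolute constant $C>0$ such that the following holds for every $n$. Let $H\subseteq K_n$ be a graph with at least one edge such that either $H$ is a tree, or the average degree of $H$ satisfies $\frac{2e(H)}{v(H)}\ge\log\Delta(H)$. Then $$p_{\mathbb E}^{*}(H)\le C\,p_{\mathbb E}(H)\qquad\text{and}\qquad p_{\mathrm c}(H)\le C\,p_{\mathbb E}(H)\log(2e(H)).$$
   Context: All graphs are finite and simple; $v(G)$ and $e(G)$ are the numbers of vertices and edges of $G$, and $\Delta(G)$ is its maximum degree. A graph is nonempty if it has at least one edge; isolated vertices are omitted. Containment is as a (not necessarily induced) subgraph. Logarithms are natural. A copy of $I$ in $G$ is a subgraph of $G$ isomorphic to $I$, and $N_I(G)$ is the number of such copies. $G_{n,p}$ is the random graph on $[n]$ in which each edge of $K_n$ is present independently with probability $p$. Threshold: $p_{\mathrm c}(H):=\inf\{p\in[0,1]:\mathbb P(G_{n,p}\text{ contains a copy of }H)\ge 1/2\}$. Graphic expectation threshold: $p_{\mathbb E}(H):=\inf\{p\in[0,1]: N_I(K_n)p^{e(I)}\ge 1/2\text{ for every nonempty } I\subseteq H\}$. Fractional expectation threshold: a fractional cover of the copies of $H$ in $K_n$ assigns weights $w_A\ge0$ to the sets $A\subseteq E(K_n)$ such that $\sum_{A\subseteq E(S)}w_A\ge1$ for every copy $S$ of $H$ in $K_n$; its cost at $p$ is $\sum_A w_Ap^{|A|}$. Then $p_{\mathbb E}^{*}(H)$ is the supremum of the $p\in[0,1]$ for which some fractional cover has cost at most $1/2$ at $p$. *)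

(* Defs.v *)
From mathcomp Require Import all_boot all_order all_algebra.

Set Implicit Arguments.
Unset Strict Implicit.
Unset Printing Implicit Defensive.

Import Order.TTheory GRing.Theory Num.Theory.

(* Since isolated vertices are omitted, a graph on the vertex type V is
   represented by its edge set, a set of 2-element subsets of V.  Its vertex
   set is then [cover G], so v(G) = #|cover G| and e(G) = #|G|. *)
Section Graphs.
Local Open Scope set_scope.
Variable V : finType.
Implicit Types G I S : {set {set V}}.

Definition complete_graph : {set {set V}} := [set e : {set V} | #|e| == 2].

Definition adj G : rel V := fun x y => [set x; y] \in G.

Definition degree G (x : V) : nat := #|[set e in G | x \in e]|.

Definition max_degree G : nat := \max_(x in cover G) degree G x.

Definition connected_graph G : Prop :=
  {in cover G &, forall x y, connect (adj G) x y}.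

(* [ucycle (adj G) [:: x; y]] also holds for a mere edge xy, whence the bound
   on the size. *)
Definition acyclic_graph G : Prop :=
  forall c : seq V, ucycle (adj G) c -> size c < 3.

Definition is_tree G : Prop := connected_graph G /\ acyclic_graph G.

Definition isomorphic I S : bool :=
  [exists f : {ffun V -> V},
    [&& dinjectiveb f (mem (cover I)),
        f @: cover I == cover S &
        [forall x in cover I, forall y in cover I,
           adj I x y == adj S (f x) (f y)]]].

Definition copies I G : {set {set {set V}}} :=
  [set S : {set {set V}} | (S \subset G) && isomorphic I S].

Definition num_copies I G : nat := #|copies I G|.

Definition contains_copy G I : bool := [exists S, S \in copies I G].

End Graphs.

Definition Kn (n : nat) : {set {set 'I_n}} := complete_graph 'I_n.

From mathcomp Require Import classical_sets reals exp.

Section Thresholds.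
Local Open Scope ring_scope.
Variables (R : realType) (n : nat).
Implicit Types (H : {set {set 'I_n}}) (p : R).

Definition prob_gnp p (E : pred {set {set 'I_n}}) : R :=
  \sum_(G : {set {set 'I_n}} | (G \subset Kn n) && E G)
    \prod_(e in Kn n) (if e \in G then p else 1 - p).

Definition p_c H : R :=
  inf [set p : R | 0 <= p <= 1 /\
        prob_gnp p (fun G => contains_copy G H) >= 1 / 2]%classic.

Definition p_E H : R :=
  inf [set p : R | 0 <= p <= 1 /\
        forall I : {set {set 'I_n}}, I \subset H -> I != finset.set0 ->
          (num_copies I (Kn n))%:R * p ^+ #|I| >= 1 / 2]%classic.

Definition fractional_cover H (w : {set {set 'I_n}} -> R) : Prop :=
  (forall A : {set {set 'I_n}}, A \subset Kn n -> 0 <= w A) /\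
  (forall S : {set {set 'I_n}}, S \in copies H (Kn n) ->
     \sum_(A : {set {set 'I_n}} | A \subset S) w A >= 1).

Definition cover_cost (w : {set {set 'I_n}} -> R) p : R :=
  \sum_(A : {set {set 'I_n}} | A \subset Kn n) w A * p ^+ #|A|.

Definition p_E_star H : R :=
  sup [set p : R | 0 <= p <= 1 /\
        exists w : {set {set 'I_n}} -> R,
          fractional_cover H w /\ cover_cost w p <= 1 / 2]%classic.

End Thresholds.

(* Main.v *)
From HB Require Import structures.
Require Import Defs.
From mathcomp Require Import all_boot all_order all_algebra.
From mathcomp Require Import fingroup perm.
From mathcomp Require Import reals sequences exp.
From mathcomp Require Import ring lra zify.

Set Implicit Arguments.
Unset Strict Implicit.
Unset Printing Implicit Defensive.

Import Order.TTheory GRing.Theory Num.Theory.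
Local Open Scope ring_scope.

(** Write q for the expectation threshold of H, so that every nonempty J <= H has
    at least 1 / (2 q^e(J)) copies in K_n. Everything follows from the claim that
    the uniform random copy of H is O(q)-spread: each edge set A lies in it with
    probability at most (C q)^|A|. Averaging a fractional cover over this measure
    bounds p_E^*, and the Park-Pham fragment argument, run with binomial random
    sets and the threshold halved at each round, bounds p_c.

    The spread is a bound on the number of embeddings into H of a connected I <= H.
    A family of m edge-disjoint copies of J in H is a subgraph with at most
    binomial(N_J(K_n), m) copies, whence m <= 8 N_J(K_n) q^e(J).

    If H is dense, either Delta^v(I) is exponential in e(I) and a maximal family of
    edge-disjoint copies of I suffices, or I is much sparser than H and the trivial
    bound q >= n^(-v(H)/e(H)) / 2 does.

    If H is a tree, root it. The rescaled embedding counts at a vertex y are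
    dominated by a generating function U(y) summing over subtrees J hanging from y
    the weight prod_x d_J(x)! / (C b)^e(J), with b of order n q. By induction on the
    depth U(y) is at most 2, or at most the weight prod_x d_J(x)! / b^e(J) of a
    single such J. A tree J has at most n^(e(J)+1) 4^e(J) / prod_x d_J(x)! copies in
    K_n, since plane trees with e(J) edges number at most 4^e(J); together with the
    packing bound this gives sum_y U(y) = O(n). *)

(** * Thresholds of spread families *)

(** Exposing a connected graph vertex by vertex costs a factor [Delta] per vertex. The density
    hypothesis makes this affordable, but a tree may have one vertex of huge degree and many of
    small degree. The factorials are the remedy: a vertex of [J] with [d] children contributes [d!]
    to the number of ways to lay an ordered pattern onto [J] and [1 / d!] to the number of copies of
    [J] in [K_n]. A subtree that admits many embeddings therefore has few copies in [K_n], and by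
    packing it can hang from few vertices only.

    Packing speaks of a single shape, whereas the embedding count sums over all subtrees below a
    vertex. Hence the sum has to be replaced by one of its terms, and this is the main difficulty.
    There is room for it because only losses exponential in the number of edges are at stake: the
    sum carries weight [1 / (288 * b)] per edge, the single term [1 / b].

    The other losses (passing from powers of [n] to falling factorials, bounding the number of
    shapes, choosing the top vertex) are exponential in [e(I)] too and disappear in the constant. *)

Lemma finset_insert_ind (T : finType) (P : {set T} -> Prop) :
  P set0 -> (forall x (X : {set T}), x \notin X -> P X -> P (x |: X)) -> forall X, P X.
Proof.
move=> P0 PU X; have [m] := ubnP #|X|; elim: m X => // m IH X ltXm.
have [->|[x xX]] := set_0Vmem X; first exact: P0.
rewrite -(setD1K xX); apply: PU; first by rewrite !inE eqxx.
by apply: IH; rewrite (cardsD1 x X) xX in ltXm.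
Qed.

Section RandomSubsets.
Variables (R : realFieldType) (T : finType).
Implicit Types (p a b : R) (X W S : {set T}) (f : {set T} -> R) (U F : {set {set T}}).

(** The law of the binomial random subset of [X]. For [X = Kn n] it is the product appearing in
    [prob_gnp], so all probabilities stay finite sums. *)
Definition weight p X W : R := \prod_(e in X) (if e \in W then p else 1 - p).

Definition expect p X f : R := \sum_(W : {set T} | W \subset X) weight p X W * f W.

Lemma weight_ge0 p X W : 0 <= p <= 1 -> 0 <= weight p X W.
Proof.
by move=> /andP[p0 p1]; apply: prodr_ge0 => e _; case: ifP; rewrite ?subr_ge0.
Qed.

Lemma eq_expect p X f g :
  (forall W, W \subset X -> f W = g W) -> expect p X f = expect p X g.
Proof. by move=> fg; apply: eq_bigr => W /fg ->. Qed.

Lemma expect_le p X f g : 0 <= p <= 1 ->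
  (forall W, W \subset X -> f W <= g W) -> expect p X f <= expect p X g.
Proof. by move=> p01 fg; apply: ler_sum => W /fg; apply/ler_wpM2l/weight_ge0. Qed.

Lemma expectD p X f g :
  expect p X (fun W => f W + g W) = expect p X f + expect p X g.
Proof. by rewrite -big_split; apply: eq_bigr => W _; rewrite mulrDr. Qed.

Lemma expectZ p X a f : expect p X (fun W => a * f W) = a * expect p X f.
Proof. by rewrite mulr_sumr; apply: eq_bigr => W _; rewrite mulrCA. Qed.

Lemma expect_set0 p f : expect p set0 f = f set0.
Proof.
rewrite /expect (big_pred1 set0) => [|W]; last by rewrite /= subset0.
by rewrite /weight big_set0 mul1r.
Qed.

Lemma expect_setU1 p x X f : x \notin X ->
  expect p (x |: X) f = p * expect p X (fun W => f (x |: W)) + (1 - p) * expect p X f.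
Proof.
move=> xX; rewrite /expect (bigID (fun W : {set T} => x \in W)) /=; congr (_ + _).
  rewrite mulr_sumr (reindex_onto (fun W => x |: W) (fun W => W :\ x)) /=; last first.
    by move=> W /andP[_ xW]; rewrite setD1K.
  apply: eq_big => [W|W /andP[/andP[WX _] /eqP eW]].
    rewrite setU11 andbT; apply/andP/idP => [[WX /eqP <-]|WX].
      by rewrite -(setU1K xX) setSD.
    rewrite setU1K ?eqxx ?setUS //.
    by apply: contra xX => xW; rewrite (subsetP WX).
  rewrite mulrA; congr (_ * _); rewrite /weight big_setU1 //= setU11.
  congr (_ * _); apply: eq_bigr => e eX.
  by rewrite !inE; case: eqVneq eX xX => // -> ->.
rewrite mulr_sumr; apply: eq_big => [W|W /andP[WX xW]].
  apply/andP/idP => [[WX xW]|WX].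
    by rewrite -(setU1K xX) subsetD1 WX xW.
  split; first by rewrite (subset_trans WX) ?subsetU1.
  by apply: contra xX => xW; rewrite (subsetP WX).
by rewrite mulrA /weight big_setU1 //= (negPf xW).
Qed.

(** Adding [S] to the random set turns a factor [1 - p] into [p] for each element of [S], and
    [(1 - p) * p <= p]. Avoiding the quotient [p / (1 - p)] admits [p = 1]. *)
Lemma weight_setU p X W S : 0 <= p <= 1 -> [disjoint W & S] -> S \subset X ->
  weight p X W * p ^+ #|S| <= weight p X (W :|: S).
Proof.
move=> /andP[p0 p1] dWS SX; rewrite /weight [leLHS]mulrC.
have -> : p ^+ #|S| = \prod_(e in X) (if e \in S then p else 1).
  rewrite -big_mkcondr -prodr_const; apply: eq_bigl => e.
  by rewrite andbC; case: (boolP (e \in S)) => // /(subsetP SX) ->.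
rewrite -big_split /=; apply: ler_prod => e _; rewrite inE.
case: ifP => eS; case: ifP => eW /=.
- by have := disjointFr dWS eW; rewrite eS.
- by rewrite mulr_ge0 ?subr_ge0 //= ler_piMr // lerBlDr lerDl.
- by rewrite mul1r p0 lexx.
- by rewrite mul1r subr_ge0 p1 lexx.
Qed.

Lemma expect_cst p X a : expect p X (fun=> a) = a.
Proof.
elim/finset_insert_ind: X => [|x X xX IH]; first by rewrite expect_set0.
by rewrite expect_setU1 // IH; ring.
Qed.

(** An element is missed by two independent random sets with probability [(1 - a) * (1 - b)]. This
    allows the random set to be exposed in rounds. *)
Lemma expect_union a b X f :
  expect a X (fun W => expect b X (fun V => f (W :|: V))) = expect (a + b - a * b) X f.
Proof.
elim/finset_insert_ind: X f => [|x X xX IH] f; first by rewrite !expect_set0 setU0.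
rewrite !expect_setU1 // -!IH.
under eq_expect do rewrite expect_setU1 //.
under [X in _ + _ * X]eq_expect do rewrite expect_setU1 //.
under eq_expect => W _.
  under eq_expect => V _ do rewrite setUACA setUid.
  under [X in _ + _ * X]eq_expect => V _ do rewrite -setUA.
  over.
under [X in _ + _ * X]eq_expect => W _.
  under eq_expect => V _ do rewrite setUCA.
  over.
rewrite !expectD !expectZ; ring.
Qed.

Definition covering U F :=
  [forall S in F, exists A in U, A \subset S].

Definition cost p U : R := \sum_(A in U) p ^+ #|A|.

(** The minimum fragment of Park and Pham: the least that an edge of [F] inside [W :|: S] can leave
    outside [W]. The minimum needs a witness, which is [S] itself when [S \in F]. *)
Definition fragment F W S : {set T} :=
  [arg min_(S' < S | (S' \in F) && (S' \subset W :|: S)) #|S' :\: W|] :\: W.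

Lemma fragmentP F W S : S \in F -> exists S', [/\ S' \in F, S' \subset W :|: S,
  fragment F W S = S' :\: W &
  forall S'', S'' \in F -> S'' \subset W :|: S -> (#|fragment F W S| <= #|S'' :\: W|)%N].
Proof.
move=> SF; rewrite /fragment.
case: arg_minnP => [|S' /andP[S'F S'W] min]; first by rewrite SF subsetUr.
by exists S'; split=> // S'' S''F S''W; apply: min; rewrite S''F.
Qed.

Lemma fragment_sub F W S : S \in F -> fragment F W S \subset S.
Proof.
by move=> /(fragmentP W)[S' [_ S'W -> _]]; rewrite subDset.
Qed.

Lemma fragment_disjoint F W S : [disjoint W & fragment F W S].
Proof.
by rewrite -setI_eq0; apply/eqP/setP => x; rewrite !inE; case: (x \in W).
Qed.

Definition large_fragments F j W : {set {set T}} :=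
  [set fragment F W S | S in F & (2 ^ j <= #|fragment F W S|)%N].

Definition small_fragments F j W : {set {set T}} :=
  [set fragment F W S | S in F & (#|fragment F W S| < 2 ^ j)%N].

(* A fragment T of (W, S) is contained in every edge of F inside W :|: T, by
   minimality: this is what makes the number of large fragments small on average. *)
Lemma fragment_sub_edge F W S S0 : S \in F -> S0 \in F ->
  S0 \subset W :|: fragment F W S -> fragment F W S \subset S0.
Proof.
move=> SF S0F S0W; have [S' [_ _ _ min]] := fragmentP W SF.
have sS0 : S0 :\: W \subset fragment F W S by rewrite subDset.
suff /eqP <- : S0 :\: W == fragment F W S by apply: subsetDl.
rewrite eqEcard sS0 min // (subset_trans S0W) // setUS //; exact: fragment_sub.
Qed.

(** Double counting over [Z = W :|: A], with [A] the fragment. Given [Z], the fragment lies inside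
    one edge chosen from [Z] alone, so it takes at most [2 ^ (2 ^ j.+1) = 4 ^ (2 ^ j)] values. Each
    is paid for by [16 ^- (2 ^ j)], the gain from sampling at [16 * p] but charging [p]. *)
Lemma expect_cost_large p j X F : 0 <= p -> 16 * p <= 1 ->
  (forall S, S \in F -> S \subset X /\ (#|S| < 2 ^ j.+1)%N) ->
  expect (16 * p) X (fun W => cost p (large_fragments F j W)) <= (1 / 4) ^+ (2 ^ j).
Proof.
move=> p0 p1 FX; set a := 16 * p.
have a01 : 0 <= a <= 1 by rewrite p1 mulr_ge0.
(* An edge of [F] inside [Z], chosen without reference to [W]. The default [set0] does no harm:
   every [Z] of the form [W :|: A] contains an edge. *)
pose hat (Z : {set T}) : {set T} := odflt set0 [pick S in F | S \subset Z].
have hat_card Z : (#|hat Z| <= 2 ^ j.+1)%N.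
  by rewrite /hat; case: pickP => [S /andP[/FX[_ /ltnW]]|] //=; rewrite cards0.
pose g (Z : {set T}) := weight a X Z * 16 ^- (2 ^ j).
have g0 Z : 0 <= g Z by rewrite mulr_ge0 ?weight_ge0 // invr_ge0 exprn_ge0.
have step1 (W : {set T}) : W \subset X -> weight a X W * cost p (large_fragments F j W) <=
    \sum_(A in large_fragments F j W) g (W :|: A).
  move=> WX; rewrite mulr_sumr; apply: ler_sum => A /imsetP[S].
  rewrite inE => /andP[SF large] ->.
  have AX : fragment F W S \subset X.
    by rewrite (subset_trans (fragment_sub _ SF)) // (FX _ SF).1.
  have := weight_setU a01 (fragment_disjoint F W S) AX.
  rewrite exprMn.
  rewrite mulrCA => le1; rewrite /g.
  rewrite ler_pdivlMr ?exprn_gt0 // mulrC; apply: le_trans le1.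
  rewrite ler_wpM2r ?mulr_ge0 ?weight_ge0 ?exprn_ge0 //.
  by rewrite ler_weXn2l // ler1n.
apply: le_trans (_ : \sum_(W : {set T} | W \subset X) \sum_(A in large_fragments F j W) g (W :|: A) <= _).
  exact: ler_sum.
rewrite (exchange_big_dep predT) //=.
apply: le_trans (_ : \sum_(A : {set T}) \sum_(Z : {set T} | (Z \subset X) && (A \subset hat Z)) g Z <= _).
  apply: ler_sum => A _.
  (* For fixed [A] the set [W] is recovered as [Z :\: A], because a fragment avoids [W]. *)
  rewrite (reindex_onto (fun Z => Z :\: A) (fun W => W :|: A)) /=; last first.
    move=> W /andP[_ /imsetP[S _ eA]]; rewrite setDUl setDv setU0.
    by apply/setDidPl; rewrite eA fragment_disjoint.
  rewrite big_mkcond [leRHS]big_mkcond /=; apply: ler_sum => Z _.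
  case: ifP => [|_]; last by case: ifP.
  move=> /andP[/andP[ZX /imsetP[S]]]; rewrite inE => /andP[SF _] eA /eqP eZ.
  rewrite eZ; suff -> : (Z \subset X) && (A \subset hat Z) by [].
  have AX : A \subset X.
    by rewrite eA (subset_trans (fragment_sub _ SF)) // (FX _ SF).1.
  rewrite -{1}eZ subUset ZX AX /=.
  rewrite /hat; case: pickP => [S0 /andP[S0F S0Z]|noS] /=.
    by rewrite eA fragment_sub_edge // -eA eZ.
  have [S' [S'F _ eS' _]] := fragmentP (Z :\: A) SF.
  rewrite -eA in eS'; have /negP[] := negbT (noS S'); rewrite S'F /=.
  by rewrite -eZ -subDset -eS'.
rewrite (exchange_big_dep (fun Z : {set T} => Z \subset X)) /=; last by move=> ? ? _ /andP[].
apply: le_trans (_ : \sum_(Z : {set T} | Z \subset X) weight a X Z * (1 / 4) ^+ (2 ^ j) <= _).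
  apply: ler_sum => Z ZX.
  rewrite (eq_bigl (fun A : {set T} => A \in powerset (hat Z))); last first.
    by move=> A; rewrite powersetE ZX.
  rewrite sumr_const card_powerset -[g Z *+ _]mulr_natr /g -mulrA ler_wpM2l ?weight_ge0 //.
  rewrite mulrC ler_pdivrMr ?exprn_gt0 // -exprMn.
  have -> : 1 / 4 * 16 = (4 : R) by field.
  rewrite -natrX ler_nat.
  rewrite (leq_trans (leq_pexp2l _ (hat_card Z))) //.
  by rewrite expnS expnM.
have := expect_cst a X ((1 / 4) ^+ (2 ^ j)); rewrite /expect => ->; exact: lexx.
Qed.

(** Induction on the number of rounds. After a first random set [W], any cover of the small
    fragments together with the large fragments covers [F]. So the small fragments, whose size bound
    is halved, still cost at least [c] minus the cost of the large ones. The bound [c] is quantified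
    inside the induction because it becomes dependent on [W]. *)
Theorem park_pham p k X F c : 0 <= p -> 16 * p <= 1 ->
  (forall S, S \in F -> S \subset X /\ (#|S| < 2 ^ k)%N) ->
  (forall U, covering U F -> c <= cost p U) ->
  c <= expect (1 - (1 - 16 * p) ^+ k) X (fun W => [exists S in F, S \subset W]%:R)
       + \sum_(i < k) (1 / 4) ^+ i.+1.
Proof.
move=> p0 p1; have a01 : 0 <= 16 * p <= 1 by rewrite p1 mulr_ge0.
elim: k F c => [|k IH] F c FX Uc.
  rewrite big_ord0 addr0 expr0 subrr.
  (* All edges have size less than [2 ^ 0], so are empty. Either [F] has none and the empty cover
     gives [c <= 0], or [[set set0]] covers at cost 1 and success is certain. *)
  have [F0|[S SF]] := set_0Vmem F.
    apply: le_trans (_ : 0 <= _); last first.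
      rewrite sumr_ge0 // => W _; apply: mulr_ge0; last exact: ler0n.
      by rewrite weight_ge0 // lexx ler01.
    rewrite (le_trans (Uc set0 _)) ?/cost ?big_set0 //.
    by rewrite F0; apply/forall_inP => S; rewrite inE.
  have S0 : S = set0.
    by apply/eqP; rewrite -cards_eq0; have := (FX _ SF).2; rewrite expn0 ltnS leqn0.
  rewrite (eq_expect _ (g := fun=> 1)) ?expect_cst.
    rewrite (le_trans (Uc [set set0] _)) ?/cost ?big_set1 ?cards0 ?expr0 //.
    by apply/forall_inP => S' _; apply/exists_inP; exists set0; rewrite ?inE ?sub0set.
  move=> W _; suff -> : [exists S in F, S \subset W] by [].
  by apply/exists_inP; exists S => //; rewrite S0 sub0set.
rewrite exprSr mulrBr mulr1.
set q := (1 - 16 * p) ^+ k.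
have -> : 1 - (q - q * (16 * p)) = 16 * p + (1 - q) - 16 * p * (1 - q) by ring.
rewrite -expect_union big_ord_recr /= addrA.
have pt (W : {set T}) : W \subset X -> c - cost p (large_fragments F k W) <=
   expect (1 - q) X (fun V => [exists S in F, S \subset W :|: V]%:R) + \sum_(i < k) (1 / 4) ^+ i.+1.
  move=> WX.
  apply: le_trans (IH (small_fragments F k W) _ _ _) _.
  - move=> A /imsetP[S]; rewrite inE => /andP[SF small] -> {A}; split=> //.
    by rewrite (subset_trans (fragment_sub _ SF)) // (FX _ SF).1.
  - move=> U /forall_inP covU; rewrite lerBlDl.
    apply: le_trans (Uc (large_fragments F k W :|: U) _) _.
      apply/forall_inP => S SF; have sub := fragment_sub W SF.
      have [small|large] := ltnP #|fragment F W S| (2 ^ k).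
        have /covU/exists_inP[A AU AS] : fragment F W S \in small_fragments F k W.
          by apply/imsetP; exists S; rewrite // inE SF.
        by apply/exists_inP; exists A; rewrite ?inE ?AU ?orbT // (subset_trans AS).
      apply/exists_inP; exists (fragment F W S); rewrite // inE.
      by apply/orP; left; apply/imsetP; exists S; rewrite // inE SF.
    rewrite /cost !(big_mkcond (fun A => A \in _)) -big_split /=.
    apply: ler_sum => A _; rewrite inE.
    by do 2 case: (A \in _); rewrite /= ?addr0 ?add0r ?lerDl ?exprn_ge0.
  rewrite lerD2r; apply: expect_le => [|V _].
    rewrite /q subr_ge0 lerBlDr lerDl exprn_ge0 ?exprn_ile1 ?subr_ge0 //.
    by rewrite lerBlDr lerDl mulr_ge0.
  (* A small fragment inside [V] is [S' :\: W] for an edge [S'] of [F], which then lies in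
     [W :|: V]. *)
  rewrite ler_nat; case: exists_inP => // -[_ /imsetP[S + ->] SV].
  rewrite inE => /andP[/(fragmentP W)[S' [S'F _ eS' _]] _].
  case: exists_inP => // -[]; exists S' => //; move: SV; rewrite eS'.
  by rewrite subDset.
have := expect_cost_large p0 p1 FX => large.
have le4 : (1 / 4 : R) ^+ (2 ^ k) <= (1 / 4) ^+ k.+1.
  by rewrite ler_wiXn2l ?divr_ge0 // ?ler_pdivrMr ?mul1r ?ler1n // ltn_expl.
have := expect_le a01 pt; rewrite !expectD !expect_cst.
under eq_expect do rewrite -mulN1r.
rewrite expectZ; lra.
Qed.
End RandomSubsets.

(** * Images and copies of graphs *)

Section GraphImages.
Variable V : finType.
Implicit Types (G H I J S : {set {set V}}) (f g : V -> V) (X : {set V}).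
Local Notation K := (complete_graph V).

Definition gim f G : {set {set V}} := [set f @: e | e : {set V} in G].

Lemma gim_comp f g G : gim f (gim g G) = gim (f \o g) G.
Proof. by rewrite /gim -imset_comp; apply: eq_imset => e /=; rewrite imset_comp. Qed.

Lemma gim_sub f G H : G \subset H -> gim f G \subset gim f H.
Proof. exact: imsetS. Qed.

Lemma eq_in_gim f g G : {in cover G, f =1 g} -> gim f G = gim g G.
Proof.
move=> fg; apply: eq_in_imset => e eG; apply: eq_in_imset => x xe.
by apply: fg; apply/bigcupP; exists e.
Qed.

Lemma gim_id G : gim id G = G.
Proof. by rewrite /gim (eq_imset _ (g := id)) ?imset_id // => e; rewrite imset_id. Qed.

Lemma mem_cover G e x : e \in G -> x \in e -> x \in cover G.
Proof. by move=> eG xe; apply/bigcupP; exists e. Qed.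

Lemma cover_sub G H : G \subset H -> cover G \subset cover H.
Proof.
move=> GH; apply/subsetP => x /bigcupP[e eG xe].
exact: mem_cover (subsetP GH _ eG) xe.
Qed.

Lemma cover_setU G H : cover (G :|: H) = cover G :|: cover H.
Proof. by rewrite /cover bigcup_setU. Qed.

Lemma cover_gim f G : cover (gim f G) = f @: cover G.
Proof.
apply/setP => x; apply/bigcupP/imsetP => [[_ /imsetP[e eG ->] /imsetP[y ye ->]]|[y /bigcupP[e eG ye] ->]].
  by exists y => //; apply: mem_cover eG ye.
by exists (f @: e); rewrite ?imset_f.
Qed.

Lemma edge_set2 G e : G \subset K -> e \in G -> exists x y, [/\ x != y, e = [set x; y] & adj G x y].
Proof.
move=> GK eG; have := subsetP GK _ eG; rewrite inE => /cards2P[x [y [xy eE]]].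
by exists x, y; split; rewrite // /adj -eE.
Qed.

Lemma adj_sym G : symmetric (adj G).
Proof. by move=> x y; rewrite /adj setUC. Qed.

Lemma adj_cover G x y : adj G x y -> (x \in cover G) /\ (y \in cover G).
Proof. by move=> xy; split; apply: mem_cover xy _; rewrite !inE eqxx ?orbT. Qed.

Lemma adj_neq G x y : G \subset K -> adj G x y -> x != y.
Proof.
move=> GK xy; have := subsetP GK _ xy.
by rewrite inE cards2; case: (x != y).
Qed.

Lemma gim_inj_on f X (A B : {set V}) : {in X &, injective f} ->
  A \subset X -> B \subset X -> f @: A = f @: B -> A = B.
Proof.
move=> finj AX BX eAB; apply/setP => x; apply/idP/idP => xA.
  have /imsetP[y yB e] : f x \in f @: B by rewrite -eAB imset_f.
  by rewrite (finj x y _ _ e) ?(subsetP AX x xA) ?(subsetP BX y yB).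
have /imsetP[y yB e] : f x \in f @: A by rewrite eAB imset_f.
by rewrite (finj x y _ _ e) ?(subsetP BX x xA) ?(subsetP AX y yB).
Qed.

Lemma edge_sub_cover G e : e \in G -> e \subset cover G.
Proof. exact: bigcup_sup. Qed.

Lemma gim_inj f G H I : {in cover G &, injective f} -> H \subset G -> I \subset G ->
  gim f H = gim f I -> H = I.
Proof.
move=> finj HG IG; rewrite /gim => eHI.
have inj2 : {in G &, injective (fun e : {set V} => f @: e)}.
  move=> A B AG BG; apply: (gim_inj_on finj); exact: edge_sub_cover.
apply/setP => e; apply/idP/idP => eH.
  have /imsetP[e' e'I E] : f @: e \in gim f I by rewrite /gim -eHI imset_f.
  by rewrite (inj2 e e' _ _ E) ?(subsetP HG e eH) ?(subsetP IG e' e'I).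
have /imsetP[e' e'I E] : f @: e \in gim f H by rewrite /gim eHI imset_f.
by rewrite (inj2 e e' _ _ E) ?(subsetP IG e eH) ?(subsetP HG e' e'I).
Qed.

Lemma card_gim f G : {in cover G &, injective f} -> #|gim f G| = #|G|.
Proof.
move=> finj; rewrite card_in_imset // => A B AG BG.
by apply: (gim_inj_on finj); exact: edge_sub_cover.
Qed.

Lemma gim_complete f G : G \subset K -> {in cover G &, injective f} -> gim f G \subset K.
Proof.
move=> GK finj; apply/subsetP => _ /imsetP[e eG ->]; rewrite inE card_in_imset.
  by have := subsetP GK _ eG; rewrite inE.
by apply: sub_in2 finj; apply/subsetP; exact: edge_sub_cover.
Qed.

(** The definition compares adjacency on pairs of vertices. For sets of 2-element edges this says
    that [S] is the image of [I], the form used from here on. *)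
Lemma isomorphicP I S : I \subset K -> S \subset K ->
  reflect (exists2 f, {in cover I &, injective f} & S = gim f I) (isomorphic I S).
Proof.
move=> IK SK; apply: (iffP existsP) => [[f /and3P[/dinjectiveP finj /eqP fI /forall_inP fadj]]|[f finj ->]].
  exists f => //; apply/setP => e; apply/idP/imsetP => [eS|[e' e'I ->]].
    have [a [b [ab eE abS]]] := edge_set2 SK eS.
    have [aS bS] := adj_cover abS; move: aS bS; rewrite -fI => /imsetP[x xI ax] /imsetP[y yI yb].
    exists [set x; y]; last by rewrite imsetU1 imset_set1 -ax -yb.
    by have /forall_inP /(_ y yI) /eqP := fadj x xI; rewrite -ax -yb abS.
  have [x [y [_ eE xy]]] := edge_set2 IK e'I; have [xI yI] := adj_cover xy.
  have /forall_inP /(_ y yI) /eqP := fadj x xI; rewrite xy eE imsetU1 imset_set1.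
  by move/esym.
exists (finfun f); apply/and3P; split.
- by apply/dinjectiveP => x y xI yI; rewrite !ffunE; apply: finj.
- by rewrite cover_gim; apply/eqP/eq_imset => x; rewrite ffunE.
apply/forall_inP => x xI; apply/forall_inP => y yI; rewrite !ffunE.
apply/eqP; apply/idP/idP => [xy|/imsetP[e' e'I]].
  by apply/imsetP; exists [set x; y] => //; rewrite imsetU1 imset_set1.
rewrite -(imset_set1 f y) -imsetU1 => /(gim_inj_on finj).
move=> E; rewrite /adj E ?(edge_sub_cover e'I) //.
by apply/subsetP => z; rewrite !inE => /orP[] /eqP ->.
Qed.

Lemma copiesP I H S : I \subset K -> H \subset K ->
  reflect (exists2 f, {in cover I &, injective f} & S = gim f I /\ S \subset H) (S \in copies I H).
Proof.
move=> IK HK; rewrite inE; apply: (iffP andP) => [[SH]|[f finj [-> SH]]].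
  by case/(isomorphicP IK (subset_trans SH HK)) => f finj SE; exists f.
by split=> //; apply/isomorphicP => //; [exact: gim_complete|exists f].
Qed.

Lemma num_copies_le I : I \subset K -> (num_copies I K <= #|V| ^ #|cover I|)%N.
Proof.
move=> IK; have [I0|[a aI]] := set_0Vmem (cover I).
  rewrite I0 cards0 expn0; apply: leq_trans (_ : #|[set gim id I]| <= _)%N; last by rewrite cards1.
  apply: subset_leq_card; apply/subsetP => S /(copiesP _ IK (subxx _))[f _ [-> _]].
  by rewrite inE; apply/eqP/eq_in_gim => x; rewrite I0 inE.
apply: leq_trans (_ : #|[set gim (f : {ffun V -> V}) I | f in pffun_on a (mem (cover I)) (mem V)]| <= _)%N.
  apply: subset_leq_card; apply/subsetP => S /(copiesP _ IK (subxx _))[f _ [-> _]].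
  apply/imsetP; exists [ffun x => if x \in cover I then f x else a].
    apply/pffun_onP; split=> [|y]; last by [].
    by apply/supportP => x xI; rewrite ffunE (negPf xI).
  by apply: eq_in_gim => x xI; rewrite ffunE xI.
by rewrite (leq_trans (leq_imset_card _ _)) // card_pffun_on.
Qed.

End GraphImages.

(** The product of [m + 1, ..., 2 m] has factors at least [m] and equals ['C(m + m, m)] times the
    factorial of [m], where the binomial is at most [4 ^ m]. *)
Lemma expnn_le_fact m : (m ^ m <= 4 ^ m * m`!)%N.
Proof.
have bin4 : ('C(m + m, m) <= 4 ^ m)%N.
  have -> : (4 ^ m = (1 + 1) ^ (m + m))%N by rewrite (addnn m) -mul2n expnM.
  rewrite expnDn.
  rewrite (bigD1 (inord m)) //= inordK ?ltnS ?leq_addl //.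
  by rewrite !exp1n !muln1 leq_addr.
apply: leq_trans (leq_mul bin4 (leqnn m`!)); rewrite bin_ffact ffact_prod.
rewrite -[X in (m ^ X)%N]card_ord -prod_nat_const; apply: leq_prod => i _.
by have := ltn_ord i; lia.
Qed.

Lemma ffact_le_expn m k : (m ^_ k <= m ^ k)%N.
Proof.
rewrite ffact_prod -[X in (m ^ X)%N]card_ord -prod_nat_const.
by apply: leq_prod => i _; exact: leq_subr.
Qed.

(** The inequality [n * (v - i) <= v * (n - i)], multiplied over [i < v], reduces the claim to
    [n = v], which is [expnn_le_fact]. *)
Lemma expn_le_ffact n v : (v <= n)%N -> (n ^ v <= 4 ^ v * n ^_ v)%N.
Proof.
have key : (v <= n -> n ^ v * v`! <= v ^ v * n ^_ v)%N.
  move=> vn; rewrite ffact_prod -[v`!]ffactnn ffact_prod.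
  rewrite -[X in (n ^ X)%N]card_ord -[X in (_ <= v ^ X * _)%N]card_ord.
  rewrite -!prod_nat_const -!big_split /=; apply: leq_prod => i _.
  by rewrite !mulnBr leq_sub // ?(mulnC v n) // leq_mul.
move=> vn; have := key vn; have := expnn_le_fact v => H1 H2.
rewrite -(leq_pmul2r (fact_gt0 v)); apply: (leq_trans H2).
by rewrite mulnAC leq_mul.
Qed.

(** * Packings of edge-disjoint copies in [H] *)

Section Packing.
Variables (R : realFieldType) (V : finType) (q : R) (H : {set {set V}}).
Local Notation K := (complete_graph V).
Hypothesis HK : H \subset K.
Hypothesis q0 : 0 <= q.
Hypothesis hq : forall J : {set {set V}}, J \subset H -> J != set0 ->
  1 / 2 <= (num_copies J K)%:R * q ^+ #|J|.
Implicit Types (I J : {set {set V}}).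

(** A copy of the union is determined by the set of images of the members of [FF], which are [#|FF|]
    distinct copies of [J]. *)
Lemma num_copies_cover J (FF : {set {set {set V}}}) :
  J \subset K -> J != set0 -> FF \subset copies J H -> trivIset FF ->
  (num_copies (cover FF) K <= 'C(num_copies J K, #|FF|))%N.
Proof.
move=> JK J0 FFc tFF.
have FH S : S \in FF -> S \subset H by move=> /(subsetP FFc); rewrite inE => /andP[].
have UH : cover FF \subset H by apply/bigcupsP => S /FH.
have UK := subset_trans UH HK.
rewrite -(cards_draws (copies J K)).
apply: leq_trans (leq_imset_card (@cover {set V}) _); apply: subset_leq_card.
apply/subsetP => S /(copiesP _ UK (subxx _))[f finj [-> _]].
apply/imsetP; exists [set gim f S' | S' in FF]; last first.
  apply/setP => e; apply/imsetP/bigcupP => [[e' /bigcupP[S' S'F e'S'] ->]|[_ /imsetP[S' S'F ->] /imsetP[e' e'S' ->]]].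
    by exists (gim f S'); rewrite ?imset_f.
  by exists e' => //; apply/bigcupP; exists S'.
rewrite inE card_in_imset ?eqxx ?andbT; last first.
  move=> A B AF BF; apply: (gim_inj finj); exact: bigcup_sup.
apply/subsetP => _ /imsetP[S' S'F ->].
have SU : S' \subset cover FF by exact: bigcup_sup.
have /(copiesP _ JK HK)[g ginj [S'E _]] := subsetP FFc _ S'F.
apply/(copiesP _ JK (subxx _)); exists (f \o g).
  move=> x y xJ yJ /= /finj fxy; apply: ginj => //; apply: fxy.
    by apply: (subsetP (cover_sub SU)); rewrite S'E cover_gim imset_f.
  by apply: (subsetP (cover_sub SU)); rewrite S'E cover_gim imset_f.
rewrite S'E gim_comp; split=> //; rewrite -gim_comp -S'E.
apply: gim_complete; first by rewrite (subset_trans SU).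
by apply: sub_in2 finj; apply/subsetP/cover_sub.
Qed.

(* Edge-disjoint copies of J in H form a subgraph with at most binomially many
   copies in the complete graph, so they cannot be numerous. *)
Lemma packing J (FF : {set {set {set V}}}) :
  J \subset K -> J != set0 -> FF \subset copies J H -> trivIset FF ->
  #|FF|%:R <= 8 * (num_copies J K)%:R * q ^+ #|J|.
Proof.
move=> JK J0 FFc tFF; set N := num_copies J K; set m := #|FF|.
have Nq0 : 0 <= N%:R * q ^+ #|J| by rewrite mulr_ge0 ?exprn_ge0.
have [m0|m0] := posnP m; first by rewrite m0 -mulrA mulr_ge0.
have UH : cover FF \subset H.
  by apply/bigcupsP => S /(subsetP FFc); rewrite inE => /andP[].
have cU : #|cover FF| = (m * #|J|)%N.
  rewrite -(eqP tFF) -sum_nat_const; apply: eq_bigr => S /(subsetP FFc) /(copiesP _ JK HK)[f finj [-> _]].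
  exact: card_gim.
have U0 : cover FF != set0 by rewrite -card_gt0 cU muln_gt0 m0 card_gt0.
(* The hypothesis for the union reads [1 / 2 <= N ^ m * q ^ (m * e(J)) / m!]. With
   [m ^ m <= 4 ^ m * m!] this gives [m ^ m <= 2 * (4 * N * q ^ e(J)) ^ m], and [2 <= 2 ^ m] accounts
   for the constant 8. *)
have := hq UH U0; rewrite cU mulnC exprM => h1.
have h2 : (num_copies (cover FF) K)%:R * m`!%:R <= N%:R ^+ m :> R.
  rewrite -natrM -natrX ler_nat (leq_trans _ (ffact_le_expn _ _)) // -bin_ffact.
  by rewrite leq_mul2r num_copies_cover ?orbT.
have h3 : m%:R ^+ m <= 4 ^+ m * m`!%:R :> R.
  by rewrite -!natrX -natrM ler_nat expnn_le_fact.
have h4 : m`!%:R <= 2 * (N%:R * q ^+ #|J|) ^+ m.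
  rewrite exprMn; have fact0 : 0 < m`!%:R :> R by rewrite ltr0n fact_gt0.
  have : 1 / 2 * m`!%:R <= N%:R ^+ m * (q ^+ #|J|) ^+ m.
    apply: le_trans (_ : (num_copies (cover FF) K)%:R * m`!%:R * (q ^+ #|J|) ^+ m <= _).
      by rewrite [leRHS]mulrAC ler_wpM2r // ltW.
    by rewrite ler_wpM2r ?exprn_ge0.
  by rewrite mul1r ler_pdivrMl.
rewrite -(@ler_pXn2r _ m) ?nnegrE ?mulr_ge0 ?exprn_ge0 // -mulrA exprMn.
apply: le_trans h3 _; apply: le_trans (_ : 4 ^+ m * (2 * (N%:R * q ^+ #|J|) ^+ m) <= _).
  by rewrite ler_wpM2l ?exprn_ge0.
rewrite mulrA ler_wpM2r ?exprn_ge0 //.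
have -> : 8 = 4 * 2 :> R by ring.
by rewrite exprMn ler_wpM2l ?exprn_ge0 // ler_eXnr ?ler1n.
Qed.

End Packing.

(** * Embeddings as restrictions of permutations *)

Section Embeddings.
Variable V : finType.
Implicit Types (G H I J S : {set {set V}}) (X : {set V}).
Local Notation K := (complete_graph V).

(** The identity outside [X] is a canonical filling: maps agreeing on [X] get equal restrictions, so
    embeddings can be counted as elements of a finite type. *)
Definition restr X (f : V -> V) : {ffun V -> V} :=
  [ffun v => if v \in X then f v else v].

Lemma restrE X f x : x \in X -> restr X f x = f x.
Proof. by move=> xX; rewrite ffunE xX. Qed.

Lemma restr_restr X X' f : X \subset X' -> restr X (restr X' f) = restr X f.
Proof.
by move=> XX'; apply/ffunP => v; rewrite !ffunE; case: ifP => // /(subsetP XX') ->.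
Qed.

Lemma eq_restr X f g : {in X, f =1 g} <-> restr X f = restr X g.
Proof.
split=> [fg|/ffunP fg x xX].
  by apply/ffunP => v; rewrite !ffunE; case: ifP => // /fg.
by have := fg x; rewrite !ffunE xX.
Qed.

(** Every injection on [cover I] extends to a permutation, so all embeddings occur. This
    presentation ties them to the uniform random copy [gim s H]. *)
Definition embs I H : {set {ffun V -> V}} :=
  [set restr (cover I) s | s : {perm V} in [set s : {perm V} | gim s I \subset H]].

Lemma embsP I H g : g \in embs I H ->
  [/\ {in cover I &, injective g}, gim g I \subset H & restr (cover I) g = g].
Proof.
move=> /imsetP[s]; rewrite inE => sI ->; split.
- by move=> x y xI yI; rewrite !restrE // => /perm_inj.
- by rewrite (eq_in_gim (g := s)) // => x xI; rewrite restrE.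
- exact: restr_restr.
Qed.

Lemma emb_copy I H g : I \subset K -> H \subset K -> g \in embs I H -> gim g I \in copies I H.
Proof. by move=> IK HK /embsP[ginj gH _]; apply/(copiesP _ IK HK); exists g. Qed.

Lemma emb_adj I H g x y : g \in embs I H -> adj I x y -> adj H (g x) (g y).
Proof.
move=> /embsP[_ gH _] xy; apply: (subsetP gH).
by apply/imsetP; exists [set x; y]; rewrite // imsetU1 imset_set1.
Qed.

Lemma card_perm_embs I H :
  (#|[set s : {perm V} | gim s I \subset H]| <= #|embs I H| * (#|V| - #|cover I|)`!)%N.
Proof.
set P := [set s | _]; pose r (s : {perm V}) := restr (cover I) s.
rewrite -sum1_card (partition_big r (mem (embs I H))) /=; last first.
  by move=> s sP; apply/imsetP; exists s.
rewrite -sum_nat_const; apply: leq_sum => _ /imsetP[s0 s0P ->].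
(* Right multiplication by the inverse of [s0] maps the fibre of [s0] into the permutations that fix
   [cover I] pointwise. *)
rewrite sum1dep_card -(cardsC (cover I)) addKn -card_perm -(card_imset _ (mulIg s0^-1)%g).
apply: subset_leq_card; apply/subsetP => _ /imsetP[s + ->].
rewrite inE => /andP[_ /eqP /eq_restr ss0]; apply/subsetP => x; rewrite !inE.
by apply: contra => xI; rewrite permM ss0 // permK.
Qed.

Lemma embs_setU I1 I2 H : (#|embs (I1 :|: I2) H| <= #|embs I1 H| * #|embs I2 H|)%N.
Proof.
rewrite -cardsX.
pose r (g : {ffun V -> V}) := (restr (cover I1) g, restr (cover I2) g).
rewrite -(card_in_imset (f := r)); last first.
  move=> g h /embsP[_ _ gE] /embsP[_ _ hE] [/eq_restr e1 /eq_restr e2].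
  rewrite -gE -hE; apply/eq_restr => x; rewrite cover_setU inE => /orP[].
    exact: e1.
  exact: e2.
apply: subset_leq_card; apply/subsetP => _ /imsetP[_ /imsetP[s + ->] ->].
rewrite inE => sI; rewrite inE /=; apply/andP; split.
  rewrite restr_restr ?cover_setU ?subsetUl //; apply/imsetP; exists s => //.
  by rewrite inE (subset_trans _ sI) ?gim_sub ?subsetUl.
rewrite restr_restr ?cover_setU ?subsetUr //; apply/imsetP; exists s => //.
by rewrite inE (subset_trans _ sI) ?gim_sub ?subsetUr.
Qed.

Lemma embs_set0 H : (#|embs set0 H| <= 1)%N.
Proof.
apply/card_le1_eqP => g h /embsP[_ _ <-] /embsP[_ _ <-]; apply/eq_restr => x.
by rewrite /cover big_set0 inE.
Qed.

Lemma component_split I : I \subset K -> I != set0 -> exists I1 I2,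
  [/\ I = I1 :|: I2, [disjoint I1 & I2], I1 != set0, connected_graph I1 &
      [disjoint cover I1 & cover I2]].
Proof.
move=> IK /set0Pn[e0 e0I]; have [a [b [_ e0E ab]]] := edge_set2 IK e0I.
pose C := [set x | connect (adj I) a x].
pose I1 := [set e in I | e \subset C]; pose I2 := I :\: I1.
have CadjP x y : x \in C -> adj I x y -> y \in C.
  by rewrite !inE => ax xy; apply: connect_trans ax (connect1 xy).
have I1I : I1 \subset I by apply/subsetP => e; rewrite inE => /andP[].
have cI1 x : x \in cover I1 -> x \in C.
  by move=> /bigcupP[e]; rewrite inE => /andP[_ /subsetP eC] /eC.
have edgeC x y : x \in C -> adj I x y -> adj I1 x y.
  move=> xC xy; rewrite /adj in_set; apply/andP; split=> //.
  by apply/subsetP => z; rewrite in_set2 => /orP[] /eqP -> //; exact: CadjP xC xy.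
have aC : a \in C by rewrite inE connect0.
exists I1, I2; split.
- by rewrite -[LHS](setID I I1) (setIidPr I1I).
- by rewrite -setI_eq0 /I2 setIDA setIC setDIl setDv setI0 ?set0I.
- by apply/set0Pn; exists e0; rewrite e0E; apply: edgeC.
- move=> x y /cI1 xC /cI1 yC.
  have /connectP[p xp ->] : connect (adj I) x y.
    move: xC yC; rewrite !inE => ax; apply: connect_trans.
    by rewrite (sym_connect_sym (@adj_sym _ I)).
  elim: p x xC xp => //= z p IHp x xC /andP[xz zp].
  apply: connect_trans (connect1 (edgeC _ _ xC xz)) _.
  by apply: IHp zp; exact: CadjP xC xz.
- rewrite -setI_eq0; apply/eqP/setP => x; rewrite !inE; apply/negP => /andP[/cI1 xC].
  move=> /bigcupP[e]; rewrite inE => /andP[eI1 eI] xe.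
  have [u [v [_ eE uv]]] := edge_set2 IK eI.
  have [w xw eE'] : exists2 w, adj I x w & e = [set x; w].
    move: xe; rewrite eE !inE => /orP[] /eqP ->; first by exists v.
    by exists u; [rewrite adj_sym | rewrite setUC].
  by move/negP: eI1; rewrite eE'; apply; exact: edgeC.
Qed.

Section ConnectedEmbeddings.
Variables (I H : {set {set V}}).
Hypotheses (IK : I \subset K) (HK : H \subset K) (Icon : connected_graph I).

Lemma connected_cut X a : a \in X -> X \proper cover I -> a \in cover I ->
  exists c d, [/\ c \in X, d \in cover I, d \notin X & adj I c d].
Proof.
move=> aX /properP[XI [d dI dX]] aI.
have [/existsP[c /existsP[d' /and3P[cX d'X cd]]]|none] :=
    boolP [exists c, exists d, [&& c \in X, d \notin X & adj I c d]].
  by exists c, d'; split=> //; case: (adj_cover cd).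
have clX : closed (adj I) (mem X).
  apply: intro_closed => [|x y xy xX]; first exact: sym_connect_sym (@adj_sym _ I).
  apply: contraNT none => yX; apply/existsP; exists x; apply/existsP; exists y.
  by rewrite xX yX.
by have := closed_connect clX (Icon aI dI); rewrite /= aX (negPf dX).
Qed.

Lemma card_neighbours_le x : (#|[set y | adj H x y]| <= max_degree H)%N.
Proof.
have [xH|xH] := boolP (x \in cover H); last first.
  by rewrite (_ : [set y | _] = set0) ?cards0 //; apply/setP => y; rewrite !inE; apply/negP => /adj_cover[]; rewrite (negPf xH).
apply: leq_trans (leq_bigmax_cond _ xH); rewrite /degree.
rewrite -(card_in_imset (f := fun y => [set x; y])).
  apply: subset_leq_card; apply/subsetP => _ /imsetP[y + ->]; rewrite !inE => xy.
  by rewrite eqxx; move: xy; rewrite /adj => ->.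
move=> y z; rewrite !inE => xy xz eyz.
have : y \in [set x; z] by rewrite -eyz !inE eqxx orbT.
by rewrite !inE eq_sym (negPf (adj_neq HK xy)) => /eqP.
Qed.

(** The vertices are exposed one at a time, each adjacent in [I] to an earlier one, so that its
    image has at most [max_degree H] positions. *)
Lemma card_embs_rooted a x : a \in cover I ->
  (#|[set g in embs I H | g a == x]| <= max_degree H ^ #|cover I|.-1)%N.
Proof.
move=> aI; set G := [set g in _ | _].
have chain m : (m < #|cover I|)%N -> exists X : {set V},
    [/\ a \in X, X \subset cover I, #|X| = m.+1 &
        (#|[set restr X g | g : {ffun V -> V} in G]| <= max_degree H ^ m)%N].
  elim: m => [|m IHm] lt_m.
    exists [set a]; rewrite set11 sub1set aI cards1 expn0; split=> //.
    apply/card_le1_eqP => _ _ /imsetP[g + ->] /imsetP[h + ->]; rewrite !inE.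
    move=> /andP[_ /eqP ga] /andP[_ /eqP ha]; apply/eq_restr => v.
    by rewrite inE => /eqP ->; rewrite ga ha.
  have [X [aX XI cX bX]] := IHm (ltnW lt_m).
  have Xp : X \proper cover I by rewrite properEcard XI cX.
  have [c [d [cIX dI dX cd]]] := connected_cut aX Xp aI.
  exists (d |: X); split.
  - by rewrite !inE aX orbT.
  - by rewrite subUset sub1set dI.
  - by rewrite cardsU1 dX cX.
  pose r (h : {ffun V -> V}) := (restr X h, h d).
  pose B := [set p : {ffun V -> V} * V | (p.1 \in [set restr X g | g : {ffun V -> V} in G]) && (p.2 \in [set y | adj H (p.1 c) y])].
  apply: leq_trans (_ : #|B| <= _)%N.
    rewrite -(card_in_imset (f := r)).
      apply: subset_leq_card; apply/subsetP => _ /imsetP[_ /imsetP[g gG ->] ->].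
      rewrite inE /= restr_restr ?subsetUr // imset_f //= inE.
      rewrite !restrE ?setU11 //; move: gG; rewrite inE => /andP[gE _].
      exact: emb_adj gE cd.
    move=> _ _ /imsetP[g gG ->] /imsetP[h hG ->] [].
    rewrite !restr_restr ?subsetUr // !restrE ?setU11 // => /eq_restr gh ghd.
    by apply/eq_restr => v; rewrite !inE => /orP[/eqP ->|/gh].
  rewrite -sum1dep_card -(pair_big_dep (fun h => h \in [set restr X g | g : {ffun V -> V} in G]) (fun h y => y \in [set y | adj H (h c) y]) (fun _ _ => 1%N)) /=.
  rewrite expnSr; apply: leq_trans (leq_mul bX (leqnn _)); rewrite -sum_nat_const.
  by apply: leq_sum => h _; rewrite sum1_card card_neighbours_le.
have v0 : (0 < #|cover I|)%N by rewrite card_gt0; apply/set0Pn; exists a.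
have [X [_ XI cX bX]] := chain #|cover I|.-1 (ltac:(by rewrite ltn_predL)).
have XE : X = cover I by apply/eqP; rewrite eqEcard XI cX prednK /=.
apply: leq_trans bX; rewrite XE card_in_imset //.
by move=> g h; rewrite !inE => /andP[/embsP[_ _ gE] _] /andP[/embsP[_ _ hE] _] E; rewrite -gE -hE.
Qed.

Lemma card_embs_connected : I != set0 ->
  (#|embs I H| <= #|V| * max_degree H ^ #|cover I|.-1)%N.
Proof.
move=> /set0Pn[e eI]; have [a [b [_ _ ab]]] := edge_set2 IK eI.
have [aI _] := adj_cover ab.
rewrite -sum1_card (partition_big (fun g : {ffun V -> V} => g a) predT) //=.
rewrite -sum_nat_const; apply: leq_sum => x _.
by rewrite sum1dep_card card_embs_rooted.
Qed.

(* A maximal family of edge-disjoint copies of I in H meets every other copy, and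
   a connected copy is recovered from one of its vertices by at most Delta
   choices for each further vertex. *)
Lemma card_embs_disjoint_family : I != set0 ->
  exists FF : {set {set {set V}}}, [/\ FF \subset copies I H, trivIset FF &
   (#|embs I H| <= #|FF| * #|cover I| ^ 2 * max_degree H ^ #|cover I|.-1)%N].
Proof.
move=> I0; pose P (FF : {set {set {set V}}}) := (FF \subset copies I H) && trivIset FF.
have P0 : P set0 by rewrite /P sub0set; apply/trivIsetP => A B; rewrite inE.
have [FF /maxsetP[/andP[FFc tFF] FFmax] _] := maxset_exists P0.
exists FF; split=> //.
pose W := \bigcup_(S in FF) cover S.
have cW : (#|W| <= #|FF| * #|cover I|)%N.
  apply: leq_trans (_ : \sum_(S in FF) #|cover S| <= _)%N.
    rewrite /W; elim/big_rec2: _ => [|S n U _ le]; first by rewrite cards0.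
    by rewrite (leq_trans (leq_card_setU _ _)) // leq_add2l.
  rewrite -sum_nat_const; apply: leq_sum => S /(subsetP FFc) /(copiesP _ IK HK)[f finj [-> _]].
  by rewrite cover_gim leq_imset_card.
have meet g : g \in embs I H -> exists2 a, a \in cover I & g a \in W.
  move=> gE; have gc := emb_copy IK HK gE.
  have [/exists_inP[a aI gaW]|none] := boolP [exists a in cover I, g a \in W].
    by exists a.
  have gS e : e \in gim g I -> e \notin cover FF.
    move=> /imsetP[e' e'I ->]; apply/negP => /bigcupP[S SF eS].
    have [u [v [_ e'E uv]]] := edge_set2 IK e'I; have [uI _] := adj_cover uv.
    move/exists_inP: none; apply; exists u => //; apply/bigcupP; exists S => //.
    by apply: mem_cover eS _; rewrite imset_f // e'E set21.
  have gI0 : gim g I != set0.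
    by have /set0Pn[e eI] := I0; apply/set0Pn; exists (g @: e); exact: imset_f.
  have gnot : gim g I \notin FF.
    apply/negP => gF; have /set0Pn[e eg] := gI0; have := gS e eg.
    by move/negP; apply; apply/bigcupP; exists (gim g I).
  have : P (gim g I |: FF).
    rewrite /P subUset sub1set gc FFc /=; apply: (trivIsetU1 _ tFF _).1.
      move=> S SF; rewrite -setI_eq0; apply/eqP/setP => e; rewrite !inE.
      by apply/negP => /andP[/gS /negP eFF eS]; apply: eFF; apply/bigcupP; exists S.
    apply/negP => /(subsetP FFc) /(copiesP _ IK HK)[f finj [E _]].
    by have := card_gim finj; rewrite -E cards0 => /esym/eqP; rewrite cards_eq0 (negPf I0).
  move=> PF; have := FFmax _ PF (subsetU1 _ _) => FE.
  by rewrite -FE setU11 in gnot.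
apply: leq_trans (_ : #|\bigcup_(p in setX (cover I) W) [set g in embs I H | g p.1 == p.2]| <= _)%N.
  apply: subset_leq_card; apply/subsetP => g gE; have [a aI gW] := meet g gE.
  by apply/bigcupP; exists (a, g a); rewrite !inE /= ?aI // gE eqxx.
apply: leq_trans (_ : \sum_(p in setX (cover I) W) max_degree H ^ #|cover I|.-1 <= _)%N.
  elim/big_rec2: _ => [|[a x] m U + le]; first by rewrite cards0.
  rewrite inE /= => /andP[aI _].
  by rewrite (leq_trans (leq_card_setU _ _)) // leq_add // card_embs_rooted.
rewrite sum_nat_const cardsX leq_mul2r; apply/orP; right.
by rewrite mulnC expnS expn1 mulnA leq_mul2r cW orbT.
Qed.

End ConnectedEmbeddings.
End Embeddings.

(** * Dense graphs *)

Section GraphCounts.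
Variable V : finType.
Implicit Types (G H I J S : {set {set V}}) (X : {set V}).
Local Notation K := (complete_graph V).

Lemma card_embs_le I H : (#|embs I H| <= #|V| ^ #|cover I|)%N.
Proof.
have [I0|[a aI]] := set_0Vmem (cover I).
  rewrite I0 cards0 expn0; apply/card_le1_eqP => g h /embsP[_ _ <-] /embsP[_ _ <-].
  by apply/eq_restr => x; rewrite I0 inE.
pose r (g : {ffun V -> V}) := [ffun x => if x \in cover I then g x else a].
rewrite -(card_in_imset (f := r)).
  rewrite -(card_pffun_on a (mem (cover I)) (mem V)); apply: subset_leq_card.
  apply/subsetP => _ /imsetP[g _ ->]; apply/pffun_onP; split=> [|y]; last by [].
  by apply/supportP => x xI; rewrite ffunE (negPf xI).
move=> g h /embsP[_ _ gE] /embsP[_ _ hE] /ffunP rE; rewrite -gE -hE.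
by apply/eq_restr => x xI; have := rE x; rewrite !ffunE xI.
Qed.

Lemma card_cover_gt1 I : I \subset K -> I != set0 -> (1 < #|cover I|)%N.
Proof.
move=> IK /set0Pn[e eI]; have [x [y [xy eE _]]] := edge_set2 IK eI.
have : (#|e| <= #|cover I|)%N by apply: subset_leq_card; exact: edge_sub_cover.
by rewrite eE cards2 xy.
Qed.

Lemma card_cover_le I : I \subset K -> (#|cover I| <= 2 * #|I|)%N.
Proof.
move=> IK; rewrite mulnC -sum_nat_const; apply: (leq_trans (leq_card_cover I)).
by apply: leq_sum => e /(subsetP IK); rewrite inE => /eqP ->.
Qed.

Lemma max_degree_gt0 H : H \subset K -> H != set0 -> (0 < max_degree H)%N.
Proof.
move=> HK /set0Pn[e eH]; have [x [y [_ eE xy]]] := edge_set2 HK eH.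
have [xH _] := adj_cover xy.
apply: leq_trans (leq_bigmax_cond _ xH); rewrite card_gt0; apply/set0Pn.
by exists e; rewrite inE eH eE set21.
Qed.

End GraphCounts.

Fact dense_rearrange (R : comRingType) (a b c d : R) :
  8 * a * b * (4 * c) * d = 32 * c * d * b * a.
Proof. by ring. Qed.

Fact dense_log_bound (R : realFieldType) (l e m : R) :
  l * m <= 2 * e -> 4 * m * l <= e * 8.
Proof. by lra. Qed.

Fact dense_exponent v : (1 < v)%N -> (v.-1 + 4 <= 3 * v)%N.
Proof. by lia. Qed.

Section DenseGraphs.
Variables (R : realType) (V : finType) (q : R) (H : {set {set V}}).
Local Notation K := (complete_graph V).
Hypothesis HK : H \subset K.
Hypothesis H0 : H != set0.
Hypothesis q0 : 0 <= q.
Hypothesis hq : forall J : {set {set V}}, J \subset H -> J != set0 ->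
  1 / 2 <= (num_copies J K)%:R * q ^+ #|J|.
Hypothesis dense : ln ((max_degree H)%:R : R) <= 2 * #|H|%:R / #|cover H|%:R.

Let n := #|V|.

(** The hypothesis at [J = H] with the trivial count of copies; the constant is absorbed by
    [2 <= 2 ^ e(H)]. *)
Lemma expectation_whole : 1 <= (2 * q) ^+ #|H| * n%:R ^+ #|cover H|.
Proof.
have := hq (subxx H) H0; have := num_copies_le HK; rewrite -(ler_nat R) natrX => N h.
have h2 : 1 / 2 <= n%:R ^+ #|cover H| * q ^+ #|H|.
  by rewrite (le_trans h) // ler_wpM2r ?exprn_ge0.
have E0 : (0 < #|H|)%N by rewrite card_gt0.
have h3 : 1 <= 2 * (n%:R ^+ #|cover H| * q ^+ #|H|).
  by rewrite -ler_pdivrMl // mulrC.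
apply: (le_trans h3); rewrite exprMn -mulrA [q ^+ _ * _]mulrC ler_wpM2r ?mulr_ge0 ?exprn_ge0 //.
by rewrite ler_eXnr ?ler1n.
Qed.

Lemma dense_embs (I : {set {set V}}) : I \subset H -> I != set0 -> connected_graph I ->
  #|embs I H|%:R <= (128 * expR 8 * q) ^+ #|I| * n%:R ^+ #|cover I|.
Proof.
move=> IH I0 Icon; have IK := subset_trans IH HK.
set k := #|I|; set v := #|cover I|; set E := #|H|; set N := #|cover H|.
set D := max_degree H.
have k0 : (0 < k)%N by rewrite card_gt0.
have E0 : (0 < E)%N by rewrite card_gt0.
have v2 : (1 < v)%N := card_cover_gt1 IK I0.
have N0 : (0 < N)%N by rewrite ltnW // card_cover_gt1.
have D0 : (0 < D)%N := max_degree_gt0 HK H0.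
have n0 : (0 < n)%N by rewrite (leq_trans N0) // max_card.
have e8 : 1 <= expR 8 :> R by rewrite (le_trans _ (expR_ge1Dx 8)) // lerDl.
have e80 : 0 <= expR 8 :> R := expR_ge0 _.
have whole : 1 <= (2 * q) ^+ E * n%:R ^+ N := expectation_whole.
(* In the first case the factor [D ^ v.-1] is exponential in [k]. Packing contributes 8 and
   [v ^ 2 <= 4 * 4 ^ k], whence [128 = 8 * 4 * 4]. *)
have [small|large] := lerP ((D%:R : R) ^+ v) (expR 8 ^+ k).
  have [FF [FFc tFF bound]] := card_embs_disjoint_family IK HK Icon I0.
  have := packing HK q0 hq IK I0 FFc tFF; rewrite -/k => pack.
  have NI : (num_copies I K)%:R <= (n%:R : R) ^+ v.
    by rewrite -natrX ler_nat num_copies_le.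
  have v4 : (v ^ 2 <= 4 * 4 ^ k)%N.
    have vk : (v <= 2 * k)%N := card_cover_le IK.
    have kk : (k <= 2 ^ k)%N by rewrite ltnW // ltn_expl.
    have -> : (4 * 4 ^ k = (2 * 2 ^ k) ^ 2)%N by rewrite expnMn -expnM mulnC [(k * _)%N]mulnC expnM mulnC.
    by rewrite leq_exp2r // (leq_trans vk) // leq_mul2l.
  have Dv : (D%:R : R) ^+ v.-1 <= expR 8 ^+ k.
    by apply: le_trans small; rewrite ler_weXn2l ?ler1n // leq_pred.
  have b2 : #|embs I H|%:R <= #|FF|%:R * (4 * 4 ^+ k) * (expR 8 : R) ^+ k.
    apply: (@le_trans _ _ ((#|FF| * v ^ 2 * D ^ v.-1)%N%:R : R)).
      by rewrite ler_nat.
    have v4R : (v ^ 2)%N%:R <= 4 * 4 ^+ k :> R by rewrite -(natrX R 4) -(natrM R 4) ler_nat.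
    rewrite natrM [(#|FF| * _)%N%:R]natrM; apply: ler_pM; rewrite ?mulr_ge0 ?ler0n //.
      exact: ler_wpM2l.
    by rewrite natrX.
  apply: (le_trans b2).
  apply: le_trans (_ : 8 * n%:R ^+ v * q ^+ k * (4 * 4 ^+ k) * expR 8 ^+ k <= _).
    do 2 (rewrite ler_wpM2r ?mulr_ge0 ?exprn_ge0 //).
    by apply: (le_trans pack); rewrite ler_wpM2r ?exprn_ge0 // ler_wpM2l.
  rewrite !exprMn.
  rewrite dense_rearrange.
  rewrite !ler_wpM2r ?exprn_ge0 //.
  rewrite (natrM R 32 4 : 128 = 32 * 4).
  by rewrite exprMn ler_wpM2r ?exprn_ge0 // ler_eXnr ?ler1n.
have e81 : 1 < expR 8 :> R by rewrite (lt_le_trans _ (expR_ge1Dx 8)) // ltrDl.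
have DN : (D%:R : R) ^+ (4 * N) <= expR 8 ^+ E.
  have DE : D%:R = expR (ln (D%:R : R)) by rewrite lnK // posrE ltr0n.
  rewrite DE -!expRM_natl ler_expR natrM; move: dense; rewrite -/D -/N -/E.
  by rewrite ler_pdivlMr ?ltr0n // => dns; exact: dense_log_bound.
(* [D ^ (4 * N * v)] is at least [expR 8 ^ (4 * k * N)] since [I] is in the second case, and at most
   [expR 8 ^ (E * v)] by density. So [k / v] is at most a quarter of [E / N]. *)
have kN : (4 * k * N <= E * v)%N.
  rewrite -(ler_eXn2l e81).
  apply: le_trans (_ : (D%:R : R) ^+ (4 * N * v) <= _).
    have -> : (4 * k * N = k * (4 * N))%N by rewrite mulnCA mulnA.
    rewrite [(4 * N * v)%N]mulnC !(exprM _ _ (4 * N)).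
    by rewrite lerXn2r ?nnegrE ?exprn_ge0 // ltW.
  by rewrite !(exprM _ _ v) lerXn2r ?nnegrE ?exprn_ge0.
(* If [D ^ 4 <= n], the fourth power of the connected bound [n * D ^ v.-1] is at most [n ^ (3 * v)].
   The sparsity of [I] turns [whole] into [1 <= (2 * q) ^ (4 * k) * n ^ v], which supplies the
   missing factor. If [n < D ^ 4], then [whole] and [DN] force [2 * expR 8 * q >= 1], and the
   trivial count [n ^ v] is enough. *)
have [nD|nD] := leqP (D ^ 4) n.
  have key : 1 <= (2 * q) ^+ (4 * k) * n%:R ^+ v.
    rewrite -(@ler_pXn2r _ E) ?nnegrE ?mulr_ge0 ?exprn_ge0 ?mulr_ge0 //.
    rewrite expr1n exprMn -!exprM.
    apply: le_trans (_ : ((2 * q) ^+ E * n%:R ^+ N) ^+ (4 * k) <= _).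
      by rewrite exprn_ege1.
    rewrite exprMn -!exprM [(E * _)%N]mulnC ler_wpM2l ?exprn_ge0 ?mulr_ge0 //.
    by rewrite ler_weXn2l ?ler1n // mulnC [(v * E)%N]mulnC.
  have b1 : (#|embs I H| ^ 4 <= n ^ (3 * v))%N.
    apply: leq_trans (_ : ((n * D ^ v.-1) ^ 4 <= _)%N).
      by rewrite leq_exp2r // card_embs_connected.
    rewrite expnMn -expnM mulnC [(v.-1 * 4)%N]mulnC expnM.
    apply: leq_trans (_ : n ^ v.-1 * n ^ 4 <= _)%N.
      by rewrite leq_mul2r; apply/orP; right; rewrite leq_exp2r // -subn1 subn_gt0.
    by rewrite -expnD leq_pexp2l // dense_exponent.
  apply: le_trans (_ : (2 * q) ^+ k * n%:R ^+ v <= _).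
    rewrite -(@ler_pXn2r _ 4) ?nnegrE ?mulr_ge0 ?exprn_ge0 ?mulr_ge0 //.
    apply: le_trans (_ : n%:R ^+ (3 * v) <= _).
      by rewrite -!natrX ler_nat.
    rewrite exprMn -!exprM.
    have -> : (v * 4 = v + 3 * v)%N by rewrite mulnC mulSn.
    rewrite exprD mulrA [(k * 4)%N]mulnC ler_peMl ?exprn_ge0 //.
  rewrite ler_wpM2r ?exprn_ge0 // lerXn2r ?nnegrE ?mulr_ge0 // ler_wpM2r //.
  apply: le_trans (_ : 128 * 1 <= _); first by rewrite mulr1 ler_nat.
  exact: ler_wpM2l.
have q1 : 1 <= 128 * expR 8 * q.
  apply: le_trans (_ : 2 * expR 8 * q <= _); last first.
    by rewrite !ler_wpM2r // ler_nat.
  rewrite -(@ler_pXn2r _ E) ?nnegrE ?mulr_ge0 //.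
  rewrite expr1n (le_trans whole) // [2 * _ * q]mulrAC (exprMn _ (2 * q)) ler_wpM2l ?exprn_ge0 ?mulr_ge0 //.
  rewrite (le_trans _ DN) // exprM lerXn2r ?nnegrE ?exprn_ge0 // -natrX ler_nat.
  exact: ltnW.
apply: le_trans (_ : n%:R ^+ v <= _).
  by rewrite -natrX ler_nat card_embs_le.
by rewrite ler_peMl ?exprn_ge0 // exprn_ege1.
Qed.

End DenseGraphs.

(** * Rooted trees *)

Section Rooting.
Local Open Scope nat_scope.
Variables (V : finType) (H : {set {set V}}).
Local Notation K := (complete_graph V).
Hypothesis HK : H \subset K.
Hypothesis acyc : acyclic_graph H.
Variable r : V.
Hypothesis reach : {in cover H, forall x, connect (adj H) r x}.

Fixpoint ball i : {set V} :=
  if i is j.+1 then ball j :|: [set y | [exists x in ball j, adj H x y]] else [set r].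

Lemma ball_path p x : path (adj H) r p -> last r p = x -> x \in ball (size p).
Proof.
elim/last_ind: p x => [|p y IH] x /=; first by move=> _ ->; rewrite set11.
rewrite rcons_path last_rcons size_rcons => /andP[pp py] <- /=.
by rewrite !inE; apply/orP; right; apply/exists_inP; exists (last r p); rewrite ?IH.
Qed.

Lemma ex_ball x : exists i, (x \in ball i) || (x \notin cover H).
Proof.
have [xH|xH] := boolP (x \in cover H); last by exists 0; rewrite orbT.
by have /connectP[p pp ->] := reach xH; exists (size p); rewrite (ball_path pp).
Qed.

(** Distance from the root. The second disjunct of [ex_ball] makes the function total, with value 0
    outside [cover H]. *)
Definition depth x := ex_minn (ex_ball x).

Lemma depth_in x : x \in cover H -> x \in ball (depth x).
Proof. by move=> xH; rewrite /depth; case: ex_minnP => m; rewrite xH orbF. Qed.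

Lemma depth_le x i : x \in ball i -> depth x <= i.
Proof. by rewrite /depth; case: ex_minnP => m _ min xi; rewrite min ?xi. Qed.

Lemma depth_adj x y : adj H x y -> depth y <= (depth x).+1.
Proof.
move=> xy; apply: depth_le; rewrite /= !inE; apply/orP; right.
by apply/exists_inP; exists x => //; apply: depth_in; case: (adj_cover xy).
Qed.

Definition parent x := odflt x [pick y | adj H y x && (depth x == (depth y).+1)].

Lemma parentP x i : x \in cover H -> depth x = i.+1 ->
  [/\ adj H (parent x) x, parent x \in cover H & depth (parent x) = i].
Proof.
move=> xH dx; rewrite /parent; case: pickP => [y /andP[yx /eqP]|none] /=.
  by rewrite dx => -[->]; split=> //; case: (adj_cover yx).
have := depth_in xH; rewrite dx /= !inE => /orP[/depth_le|/exists_inP[y yi yx]].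
  by rewrite dx ltnn.
have := none y; rewrite yx /= dx; have := depth_adj yx; have := depth_le yi.
by rewrite dx ltnS => le1 le2; rewrite (_ : depth y = i) ?eqxx //; apply/eqP; rewrite eqn_leq le1.
Qed.

Lemma depth0 x : x \in cover H -> depth x = 0 -> x = r.
Proof. by move=> xH d0; have := depth_in xH; rewrite d0 inE => /eqP. Qed.

Lemma iter_parent x i : x \in cover H -> i <= depth x ->
  iter i parent x \in cover H /\ depth (iter i parent x) = depth x - i.
Proof.
move=> xH; elim: i => [|i IH] le; first by rewrite subn0.
have [yH dy] := IH (ltnW le).
have [_ pH dp] := parentP yH (i := (depth x - i.+1)) ltac:(by rewrite dy subnSK).
by rewrite iterS.
Qed.

Lemma adj_iter_parent x i : x \in cover H -> i < depth x ->
  adj H (iter i parent x) (iter i.+1 parent x).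
Proof.
move=> xH lt; have [yH dy] := iter_parent xH (ltnW lt).
have [pa _ _] := parentP yH (i := (depth x - i.+1)) ltac:(by rewrite dy subnSK).
by rewrite iterS adj_sym.
Qed.

Lemma uniq_traject_parent x i : x \in cover H -> i <= (depth x).+1 ->
  uniq (traject parent x i).
Proof.
move=> xH le; apply/(uniqP x) => a b; rewrite !inE size_traject => ai bi.
rewrite !nth_traject // => /(congr1 depth).
rewrite (iter_parent xH _).2 ?(iter_parent xH _).2; lia.
Qed.

Lemma path_traject_parent x i : x \in cover H -> i <= depth x ->
  path (adj H) x (traject parent (parent x) i).
Proof.
move=> xH le; apply/(pathP x) => j; rewrite size_traject => ji.
rewrite [X in adj H _ X](set_nth_default (parent x)) ?size_traject //.
rewrite nth_traject // -iterSr.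
have -> : nth x (x :: traject parent (parent x) i) j = iter j parent x.
  by rewrite -trajectS nth_traject // ltnS ltnW.
by apply: adj_iter_parent => //; exact: leq_trans le.
Qed.

(* Otherwise the paths from x and y to the root, cut at their first common
   vertex, close up to a cycle with the edge xy. *)
Lemma edge_parent x y : adj H x y ->
  (y = parent x /\ depth x = (depth y).+1) \/ (x = parent y /\ depth y = (depth x).+1).
Proof.
move=> xy; have [xH yH] := adj_cover xy.
pose P i := [exists j : 'I_(depth y).+1, iter i parent x == iter j parent y].
have top z : z \in cover H -> iter (depth z) parent z = r.
  move=> zH; have [tH dt] := iter_parent zH (leqnn _).
  by apply: depth0 tH _; rewrite dt subnn.
have exP : exists i, P i.
  by exists (depth x); apply/existsP; exists ord_max; rewrite !top.
pose i := ex_minn exP.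
have [Pi mini] : P i /\ forall i', P i' -> i <= i'.
  by rewrite /i; case: ex_minnP.
have ix : i <= depth x.
  by apply: mini; apply/existsP; exists ord_max; rewrite !top.
have /existsP[[j /= ltj] /eqP ij] := Pi.
have jy : j <= depth y by rewrite -ltnS.
have dij : depth x - i = depth y - j.
  by rewrite -(iter_parent xH ix).2 -(iter_parent yH jy).2 ij.
pose c := traject parent x i.+1 ++ rev (traject parent y j).
have sc : size c = i.+1 + j by rewrite size_cat size_rev !size_traject.
have uc : uniq c.
  rewrite cat_uniq rev_uniq !uniq_traject_parent ?ltnS ?(leqW jy) // andbT /=.
  apply/hasPn => z; rewrite mem_rev => /trajectP[l lj zl].
  apply/negP => /= zx; have /trajectP[m mi zm] : z \in traject parent x i.+1 by [].
  have ml : iter m parent x = iter l parent y by rewrite -zl -zm.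
  have Pm : P m.
    by apply/existsP; exists (inord l); rewrite inordK ?ml // ltnS (leq_trans (ltnW lj)).
  have mE : m = i by apply/eqP; rewrite eqn_leq -ltnS mi mini.
  move/(congr1 depth): ml; rewrite mE ij (iter_parent yH jy).2.
  rewrite (iter_parent yH _).2; last by rewrite (leq_trans (ltnW lj)).
  by lia.
have cyc : path.cycle (adj H) c.
  rewrite /c trajectS /= rcons_cat cat_path path_traject_parent //= -rev_cons.
  rewrite last_traject ij.
  have := rev_path (adj H) x (traject parent y j.+1).
  rewrite trajectSr last_rcons belast_rcons => ->.
  rewrite -trajectSr trajectS /= (eq_path (e' := adj H)); last by move=> u v; rewrite adj_sym.
  by rewrite adj_sym xy path_traject_parent.
(* The cycle has [i.+1 + j] vertices and must have fewer than 3. This leaves [(i, j)] equal to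
   [(0, 1)], [(1, 0)], or [(0, 0)], and the last would mean [x = y]. *)
have := acyc (c := c); rewrite /ucycle cyc uc sc => /(_ isT).
move: ix jy ij dij; move: (i) (j) => [|[|a]] [|[|b]] //=.
- by move=> _ _ xyE; have := adj_neq HK xy; rewrite xyE eqxx.
- by move=> _ jy xE dE _; right; split=> //; lia.
- by move=> ix _ yE dE _; left; split=> //; lia.
Qed.

End Rooting.

(** Extracts from the tree hypothesis a form that suits recursion: edges join consecutive levels,
    and a vertex has at most one neighbour on the level above it. *)
Lemma tree_rooting (V : finType) (H : {set {set V}}) :
  H \subset complete_graph V -> is_tree H -> exists dep : V -> nat,
   (forall x y, adj H x y -> dep y = (dep x).+1 \/ dep x = (dep y).+1) /\
   (forall x y z, adj H x z -> adj H y z -> dep z = (dep x).+1 -> dep z = (dep y).+1 -> x = y).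
Proof.
move=> HK [con acyc]; have [H0|[r rH]] := set_0Vmem (cover H).
  exists (fun=> 0%N); split=> [x y xy|x y z xy]; first by have := (adj_cover xy).1; rewrite H0 inE.
  by have := (adj_cover xy).1; rewrite H0 inE.
have reach : {in cover H, forall x, connect (adj H) r x} by move=> x; exact: con.
exists (depth reach); split=> [x y xy|x y z xz yz dx dy].
  by have [[_ ->]|[_ ->]] := edge_parent HK acyc reach xy; [right|left].
have up w : adj H w z -> depth reach z = (depth reach w).+1 -> w = parent reach z.
  move=> wz dw; have [[_ dz]|[] //] := edge_parent HK acyc reach wz.
  by lia.
by rewrite (up x) // (up y).
Qed.

(** * Plane forests *)

(* Labelled plane forests, in first-child/next-sibling form: [Br v c s] is a tree
   with root v and forest of children c, followed by the forest s. *)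
Inductive forest (V : Type) := Lf | Br of V & forest V & forest V.
Arguments Lf {V}.

Section Forests.
Local Open Scope nat_scope.
Variable V : eqType.
Implicit Types (l c s : forest V) (v w x y : V).

Fixpoint nodes l := if l is Br _ c s then (nodes c + nodes s).+1 else 0.
Fixpoint labels l := if l is Br v c s then v :: labels c ++ labels s else [::].
Fixpoint roots_of l := if l is Br v _ s then v :: roots_of s else [::].
(** A balanced-parenthesis word: [true] opens a node and [false] closes it. Two letters per node
    leave at most [4 ^ M] shapes with [M] nodes. *)
Fixpoint plane_shape l := if l is Br _ c s then true :: plane_shape c ++ false :: plane_shape s else [::].

(** The product of the factorials of the numbers of children, over all nodes and the implicit parent
    of the roots. The factorial of a sibling list is built one factor per sibling. *)
Fixpoint orderings l :=
  if l is Br _ c s then (size (roots_of s)).+1 * orderings c * orderings s else 1.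

Fixpoint same_shape l l' := match l, l' with
  | Lf, Lf => true
  | Br _ c s, Br _ c' s' => same_shape c c' && same_shape s s'
  | _, _ => false end.

Lemma size_labels l : size (labels l) = nodes l.
Proof. by elim: l => //= v c IHc s IHs; rewrite size_cat IHc IHs. Qed.

Lemma size_shape l : size (plane_shape l) = 2 * nodes l.
Proof. by elim: l => //= v c IHc s IHs; rewrite size_cat /= IHc IHs; lia. Qed.

Lemma shape_cat_inj l l' r r' : plane_shape l ++ false :: r = plane_shape l' ++ false :: r' ->
  same_shape l l' /\ r = r'.
Proof.
elim: l l' r r' => [|v c IHc s IHs] [|v' c' s'] r r' //=; first by case.
by case; rewrite -!catA /= => /IHc[-> /IHs[-> ->]].
Qed.

Lemma shape_inj l l' : plane_shape l = plane_shape l' -> same_shape l l'.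
Proof. by move=> e; have [] := @shape_cat_inj l l' [::] [::] (congr1 (cat^~ _) e). Qed.

Lemma same_shape_shape l l' : same_shape l l' -> plane_shape l = plane_shape l'.
Proof. by elim: l l' => [|v c IHc s IHs] [|v' c' s'] //= /andP[/IHc -> /IHs ->]. Qed.

Lemma same_shape_orderings l l' : same_shape l l' -> orderings l = orderings l'.
Proof.
have rootsE a b : same_shape a b -> size (roots_of a) = size (roots_of b).
  by elim: a b => [|? ? _ s IHs] [|? ? s'] //= /andP[_ /IHs ->].
elim: l l' => [|v c IHc s IHs] [|v' c' s'] //= /andP[cc ss].
by rewrite (IHc _ cc) (IHs _ ss) (rootsE _ _ ss).
Qed.

Lemma forest_code_inj : injective (fun l => (plane_shape l, labels l)).
Proof.
suff key l l' r r' : same_shape l l' -> labels l ++ r = labels l' ++ r' -> l = l' /\ r = r'.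
  move=> l l' [/shape_inj e1 e2].
  by have [] := key l l' [::] [::] e1 (congr1 (cat^~ _) e2).
elim: l l' r r' => [|v c IHc s IHs] [|v' c' s'] r r' //= /andP[cc ss] [<-].
by rewrite -!catA => /(IHc _ _ _ cc)[<- /(IHs _ _ _ ss)[<- <-]].
Qed.

HB.instance Definition _ := Equality.copy (forest V) (inj_type forest_code_inj).

(** All positions of the tree [v] with children [c] among the trees of [s]. That [delete v] undoes
    each insertion shows later that the orderings are listed without repetition. *)
Fixpoint inserts v c s :=
  Br v c s :: (if s is Br w d s' then map (Br w d) (inserts v c s') else [::]).

Fixpoint delete v l := if l is Br w d s then
    if w == v then (d, s) else let p := delete v s in (p.1, Br w d p.2)
  else (Lf, Lf).

Fixpoint plane_orders l := if l is Br v c s then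
    flatten [seq inserts v p.1 p.2 | p <- [seq (c', s') | c' <- plane_orders c, s' <- plane_orders s]]
  else [:: Lf].

Lemma size_inserts v c s : size (inserts v c s) = (size (roots_of s)).+1.
Proof. by elim: s => //= w d _ s IHs; rewrite size_map IHs. Qed.

Lemma delete_inserts v c s l : v \notin roots_of s -> l \in inserts v c s -> delete v l = (c, s).
Proof.
elim: s l => [|w d _ s IHs] l /=; first by rewrite inE => _ /eqP -> /=; rewrite eqxx.
rewrite !inE negb_or => /andP[vw vs] /orP[/eqP ->|/mapP[l' l's ->]] /=; first by rewrite eqxx.
by rewrite eq_sym (negPf vw) (IHs _ vs l's).
Qed.

Lemma uniq_inserts v c s : v \notin roots_of s -> uniq (inserts v c s).
Proof.
elim: s => //= w d _ s IHs; rewrite inE negb_or => /andP[vw vs].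
rewrite map_inj_uniq ?IHs ?andbT // => [|l l' [] //].
by apply/mapP => -[l' _ [vE]]; rewrite vE eqxx in vw.
Qed.

Lemma inserts_roots v c s l : l \in inserts v c s -> perm_eq (roots_of l) (v :: roots_of s).
Proof.
elim: s l => [|w d _ s IHs] l /=; first by rewrite inE => /eqP ->.
rewrite !inE => /orP[/eqP -> //|/mapP[l' /IHs p ->]] /=.
rewrite -(perm_cons w) in p; apply: perm_trans p _.
by rewrite -(cat1s w) -(cat1s v) perm_catCA.
Qed.

Lemma inserts_labels v c s l : l \in inserts v c s -> perm_eq (labels l) (v :: labels c ++ labels s).
Proof.
elim: s l => [|w d _ s IHs] l /=; first by rewrite inE => /eqP ->.
rewrite !inE => /orP[/eqP -> //|/mapP[l' /IHs p ->]] /=.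
apply/seq.permP => a; move/seq.permP/(_ a): p; rewrite /= !count_cat /= !count_cat => ->; lia.
Qed.

Lemma plane_ordersP l l' : l' \in plane_orders l ->
  perm_eq (roots_of l') (roots_of l) /\ perm_eq (labels l') (labels l).
Proof.
elim: l l' => [|v c IHc s IHs] l' /=; first by rewrite inE => /eqP ->.
move=> /flattenP[_ /mapP[_ /allpairsP[[c' s'] [/IHc[rc lc] /IHs[rs ls] ->]] ->] /= l'P].
split; first by rewrite (perm_trans (inserts_roots l'P)) // perm_cons.
by rewrite (perm_trans (inserts_labels l'P)) // perm_cons perm_cat.
Qed.

Lemma size_plane_orders l : size (plane_orders l) = orderings l.
Proof.
elim: l => //= v c IHc s IHs; rewrite size_flatten /seq.shape -map_comp.
set ps := flatten _.
have -> : map (size \o (fun p : forest V * forest V => inserts v p.1 p.2)) ps = nseq (size ps) (size (roots_of s)).+1.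
  apply: (@eq_from_nth _ 0) => [|i]; rewrite size_map ?size_nseq // => ip.
  rewrite (nth_map (Lf, Lf)) // nth_nseq ip /= size_inserts.
  have /allpairsP[p [_ ps2 ->]] := mem_nth (Lf, Lf) ip.
  by have [/perm_size -> _] := plane_ordersP ps2.
by rewrite sumn_nseq size_allpairs IHc IHs mulnA.
Qed.

Lemma uniq_flatten_map (T U : eqType) (F : T -> seq U) (g : U -> T) ps :
  uniq ps -> (forall p, p \in ps -> uniq (F p)) ->
  (forall p u, p \in ps -> u \in F p -> g u = p) -> uniq (flatten (map F ps)).
Proof.
elim: ps => //= p ps IH /andP[pps ups] uF gF.
rewrite cat_uniq uF ?mem_head //= IH // => [|q qps|q u qps uq].
- rewrite andbT; apply/hasPn => u /flattenP[_ /mapP[q qps ->] uq].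
  apply/negP => /= up; have := gF p u (mem_head _ _) up.
  by rewrite (gF q u) ?inE ?qps ?orbT // => qp; rewrite -qp qps in pps.
- by apply: uF; rewrite inE qps orbT.
- by apply: gF uq; rewrite inE qps orbT.
Qed.

Lemma mem_roots_labels l : {subset roots_of l <= labels l}.
Proof.
elim: l => //= v c _ s IHs x; rewrite !inE mem_cat => /orP[->//|/IHs ->].
by rewrite !orbT.
Qed.

Lemma uniq_plane_orders l : uniq (labels l) -> uniq (plane_orders l).
Proof.
elim: l => //= v c IHc s IHs /andP[vcs]; rewrite cat_uniq => /and3P[/IHc uc _ /IHs us].
have vs p : p \in [seq (c', s') | c' <- plane_orders c, s' <- plane_orders s] -> v \notin roots_of p.2.
  move=> /allpairsP[[c' s'] /= [_ /plane_ordersP[/perm_mem e _] ->]] /=; rewrite e.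
  by apply: contra vcs => /mem_roots_labels vs; rewrite mem_cat vs orbT.
apply: (uniq_flatten_map (g := delete v)).
- by apply: allpairs_uniq => // -[? ?] [? ?] _ _ [-> ->].
- by move=> p /vs; exact: uniq_inserts.
- by move=> p l /vs pv /(delete_inserts pv) ->; case: p {pv}.
Qed.

End Forests.

Section ForestMap.
Variables (V : eqType) (f : V -> V).
Fixpoint fmap (l : forest V) := if l is Br v c s then Br (f v) (fmap c) (fmap s) else Lf.

Lemma labels_fmap l : labels (fmap l) = map f (labels l).
Proof. by elim: l => //= v c -> s ->; rewrite map_cat. Qed.

Lemma same_shape_fmap l : same_shape (fmap l) l.
Proof. by elim: l => //= v c -> s ->. Qed.

Lemma nodes_fmap l : nodes (fmap l) = nodes l.
Proof. by elim: l => //= v c -> s ->. Qed.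

Lemma fmap_inj_in (X : {pred V}) l l' : {in X &, injective f} ->
  {subset labels l <= X} -> {subset labels l' <= X} -> fmap l = fmap l' -> l = l'.
Proof.
move=> finj; elim: l l' => [|v c IHc s IHs] [|v' c' s'] //= lX l'X [fv fc fs].
congr Br.
- by apply: finj fv; [apply: lX | apply: l'X]; exact: mem_head.
- by apply: IHc fc => x xP; [apply: lX | apply: l'X]; rewrite inE mem_cat xP orbT.
- by apply: IHs fs => x xP; [apply: lX | apply: l'X]; rewrite inE mem_cat xP !orbT.
Qed.
End ForestMap.

Fact setU_rearrange (T : finType) (A B C D E : {set T}) :
  A :|: (D :|: (B :|: (C :|: E))) = B :|: (C :|: (A :|: (D :|: E))).
Proof.
by apply/setP => x; rewrite !inE; case: (x \in A); case: (x \in B); case: (x \in C); rewrite ?orbT.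
Qed.

Section ForestEdges.
Local Open Scope nat_scope.
Variable V : finType.
Implicit Types (l c s : forest V) (v w x y : V).
Local Notation K := (complete_graph V).

(** The rooted tree [(y, l)]: [y] is the parent of the roots of [l], hence remains the parent in the
    recursive call on the siblings [s]. *)
Fixpoint edges y l : {set {set V}} :=
  if l is Br v c s then [set y; v] |: (edges v c :|: edges y s) else set0.

Lemma edges_sub y l e : e \in edges y l -> {subset e <= y :: labels l}.
Proof.
elim: l y => [|v c IHc s IHs] y /=; first by rewrite inE.
rewrite !inE => /or3P[/eqP -> |/IHc sub|/IHs sub] x xe.
- by move: xe; rewrite !inE => /orP[] ->; rewrite ?orbT.
- by move/sub: xe; rewrite !inE mem_cat => /orP[] ->; rewrite ?orbT.
- by move/sub: xe; rewrite !inE mem_cat => /orP[] ->; rewrite ?orbT.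
Qed.

Lemma edges_meet y l e : e \in edges y l -> exists2 x, x \in e & x \in labels l.
Proof.
elim: l y => [|v c IHc s IHs] y /=; first by rewrite inE.
rewrite !inE => /or3P[/eqP -> |/IHc[x xe xl]|/IHs[x xe xl]].
- by exists v; rewrite !inE eqxx ?orbT.
- by exists x; rewrite // inE mem_cat xl orbT.
- by exists x; rewrite // inE mem_cat xl !orbT.
Qed.

Lemma labels_cover y l x : x \in labels l -> x \in cover (edges y l).
Proof.
elim: l y => //= v c IHc s IHs y; rewrite inE mem_cat !cover_setU !in_setU.
move=> /or3P[/eqP ->|/IHc ->|/IHs ->]; rewrite ?orbT //.
by rewrite /cover big_set1 !inE eqxx orbT.
Qed.

Lemma root_cover y l : 0 < nodes l -> y \in cover (edges y l).
Proof.
by case: l => //= v c s _; rewrite !cover_setU in_setU /cover big_set1 !inE eqxx.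
Qed.

Lemma cover_edges y l : 0 < nodes l -> cover (edges y l) =i y :: labels l.
Proof.
move=> l0 x; apply/idP/idP => [/bigcupP[e /edges_sub sub /sub] //|].
by rewrite inE => /orP[/eqP ->|]; [exact: root_cover|exact: labels_cover].
Qed.

Lemma card_edges_complete y l : uniq (y :: labels l) ->
  #|edges y l| = nodes l /\ edges y l \subset K.
Proof.
elim: l y => [|v c IHc s IHs] y; first by rewrite /= cards0 sub0set.
rewrite /= inE negb_or cat_uniq mem_cat negb_or.
move=> /and4P[/andP[yv /andP[yc ys]] vcs uc /andP[/hasPn dcs us]].
move: vcs; rewrite mem_cat negb_or => /andP[vc vs].
have [cc Kc] := IHc v ltac:(by rewrite /= vc uc).
have [cs Ks] := IHs y ltac:(by rewrite /= ys us).
have e1 : [set y; v] \notin edges v c :|: edges y s.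
  rewrite inE; apply/norP; split; apply/negP => /edges_sub sub.
    by have := sub y (set21 _ _); rewrite inE (negPf yv) (negPf yc).
  by have := sub v (set22 _ _); rewrite inE eq_sym (negPf yv) (negPf vs).
have e2 : edges v c :&: edges y s = set0.
  apply/setP => e; rewrite !inE; apply/negP => /andP[/edges_meet[x xe xc] /edges_sub sub].
  have := sub x xe; rewrite inE => /orP[/eqP xy|/dcs]; last by rewrite xc.
  by rewrite -xy xc in yc.
rewrite cardsU1 e1 cardsU e2 cards0 subn0 cc cs; split=> //.
by rewrite !subUset sub1set Kc Ks !andbT inE cards2 yv.
Qed.

Lemma gim_edges f y l : gim f (edges y l) = edges (f y) (fmap f l).
Proof.
elim: l y => [|v c IHc s IHs] y /=; first by rewrite /gim imset0.
rewrite -IHc -IHs.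
have -> : [set f y; f v] = f @: [set y; v] by rewrite imsetU1 imset_set1.
rewrite /gim; apply: etrans (imsetU _ _ _) _.
by congr (_ :|: _); [exact: imset_set1 | exact: imsetU].
Qed.

Lemma edges_inserts y v c s l : l \in inserts v c s -> edges y l = edges y (Br v c s).
Proof.
elim: s l => [|w d _ s IHs] l /=; first by rewrite inE => /eqP ->.
rewrite !inE => /orP[/eqP -> //|/mapP[l' /IHs /= E ->]] /=.
by rewrite E setU_rearrange.
Qed.

Lemma edges_plane_orders y l l' : l' \in plane_orders l -> edges y l' = edges y l.
Proof.
elim: l y l' => [|v c IHc s IHs] y l' /=; first by rewrite inE => /eqP ->.
move=> /flattenP[_ /mapP[_ /allpairsP[[c' s'] [/IHc ec /IHs es ->]] ->] /= l'P].
by rewrite (edges_inserts _ l'P) /= ec es.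
Qed.

(* Each copy of a tree arises from at least as many labelled plane trees as there
   are plane orderings, and plane shapes with M edges number at most 4^M. *)
Lemma num_copies_edges y l : 0 < nodes l -> uniq (y :: labels l) ->
  num_copies (edges y l) K * orderings l <= #|V| * (4 ^ nodes l * #|V| ^ nodes l).
Proof.
move=> l0 ul; set J := edges y l; set M := nodes l.
have [_ JK] := card_edges_complete ul.
have ulab : uniq (labels l) by have /andP[] := ul.
have coverJ := cover_edges y l0.
pose P S (f : {ffun V -> V}) := [forall x in cover J, forall z in cover J, (f x == f z) ==> (x == z)] && (S == gim f J).
pose F S : {ffun V -> V} := odflt [ffun x => x] [pick f | P S f].
have FP S : S \in copies J K -> {in cover J &, injective (F S)} /\ S = gim (F S) J.
  move=> /(copiesP _ JK (subxx _))[f finj [SE _]].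
  have PSf : P S (finfun f).
    apply/andP; split.
      apply/forall_inP => x xJ; apply/forall_inP => z zJ; apply/implyP; rewrite !ffunE.
      by move=> /eqP /finj ->.
    by rewrite SE; apply/eqP/eq_in_gim => x _; rewrite ffunE.
  rewrite /F; case: pickP => [g /andP[/forall_inP ginj /eqP gE]|/(_ (finfun f))]; last by rewrite PSf.
  split=> // x z xJ zJ /= gxz; have /forall_inP/(_ z zJ) := ginj x xJ.
  by rewrite gxz eqxx => /eqP.
pose D := size (plane_orders l).
pose lab (i : 'I_D) := nth Lf (plane_orders l) i.
have labP i : lab i \in plane_orders l by rewrite mem_nth.
have perm_lab i : perm_eq (labels (lab i)) (labels l) by have [] := plane_ordersP (labP i).
have nodes_lab i : nodes (lab i) = M by rewrite -size_labels (perm_size (perm_lab i)) size_labels.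
have lab_sub i : {subset labels (lab i) <= cover J}.
  by move=> x; rewrite (perm_mem (perm_lab i)) coverJ inE => ->; rewrite orbT.
have size_sh S i : size (plane_shape (fmap (F S) (lab i))) == 2 * M.
  by rewrite size_shape nodes_fmap nodes_lab.
have size_lb S i : size (labels (fmap (F S) (lab i))) == M.
  by rewrite size_labels nodes_fmap nodes_lab.
(* Decoding: root, shape and labels give back the relabelled forest; its edges give [S], hence the
   chosen map [F S]; injectivity of [F S] gives the ordering. *)
pose code (p : {set {set V}} * 'I_D) : V * ((2 * M).-tuple bool * M.-tuple V) :=
  (F p.1 y, (Tuple (size_sh p.1 p.2), Tuple (size_lb p.1 p.2))).
have code_inj : {in setX (copies J K) [set: 'I_D] &, injective code}.
  move=> [S i] [S' i'] /setXP[/= SJ _] /setXP[/= S'J _] [ey esh elb].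
  have [finj SE] := FP S SJ; have [f'inj S'E] := FP S' S'J.
  have fE : fmap (F S) (lab i) = fmap (F S') (lab i').
    by apply: forest_code_inj; rewrite esh elb.
  have SS' : S = S'.
    have JE k : J = edges y (lab k) by rewrite (edges_plane_orders y (labP k)).
    by rewrite SE S'E {1}(JE i) (JE i') !gim_edges ey fE.
  subst S'; congr (_, _); apply/val_inj/eqP.
  rewrite -(nth_uniq Lf (ltn_ord i) (ltn_ord i') (uniq_plane_orders ulab)); apply/eqP.
  exact: (fmap_inj_in finj (@lab_sub i) (@lab_sub i') fE).
have cX : #|setX (copies J K) [set: 'I_D]| = num_copies J K * orderings l.
  by rewrite cardsX cardsT card_ord /D size_plane_orders.
rewrite -cX -(card_in_imset code_inj); apply: leq_trans (max_card _) _.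
by rewrite !card_prod !card_tuple card_bool expnM.
Qed.

End ForestEdges.

(** * Rooted copies in a tree *)

Fact succ_asym a b : a = b.+1 -> b = a.+1 -> False.
Proof. by lia. Qed.

Fact residue_window m a b d u v r : a = (u * m.+1 + r)%N -> b = (v * m.+1 + r)%N ->
  (a < d)%N -> (d < a.+1 + m)%N -> (b < d)%N -> (d < b.+1 + m)%N -> a = b.
Proof.
case: (ltngtP u v) => [uv|uv|-> -> -> //].
  by have := leq_mul uv (leqnn m.+1); rewrite mulSn; lia.
by have := leq_mul uv (leqnn m.+1); rewrite mulSn; lia.
Qed.

Section RootedForest.
Variables (V : finType) (H : {set {set V}}) (dep : V -> nat).
Local Notation K := (complete_graph V).
Hypothesis HK : H \subset K.
Hypothesis dep_adj : forall x y, adj H x y -> dep y = (dep x).+1 \/ dep x = (dep y).+1.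
Hypothesis dep_inj : forall x y z, adj H x z -> adj H y z ->
  dep z = (dep x).+1 -> dep z = (dep y).+1 -> x = y.
Implicit Types (l c s : forest V) (S : {set V}) (x y z v : V).

Definition children y : {set V} := [set z | adj H y z && (dep z == (dep y).+1)].
Definition father z := odflt z [pick y | z \in children y].

Lemma childrenP y z : z \in children y -> [/\ adj H y z, dep z = (dep y).+1 & father z = y].
Proof.
rewrite inE => /andP[yz /eqP dz]; split=> //; rewrite /father; case: pickP => [x|/(_ y)] /=.
  by rewrite inE => /andP[xz /eqP dx]; apply: (dep_inj xz yz).
by rewrite inE yz dz eqxx.
Qed.

(** [l] occurs in [H] going away from the root, with its own roots in [S]; removing [v] from [S]
    keeps siblings distinct. For [S = children y] it is a subtree hanging from [y]. *)
Fixpoint real S l := if l is Br v c s then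
  [&& v \in S, real (children v) c & real (S :\ v) s] else true.

Lemma real_edge S y l e : S \subset children y -> real S l -> e \in edges y l ->
  exists2 x, x \in labels l & e = [set father x; x] /\ x \in children (father x).
Proof.
elim: l S y => [|v c IHc s IHs] S y Sy /=; first by rewrite inE.
move=> /and3P[vS rc rs]; rewrite !inE => /or3P[/eqP ->|ec|es].
- have vy := subsetP Sy _ vS; have [_ _ fv] := childrenP vy.
  by exists v; [exact: mem_head | rewrite fv].
- have [x xc eE] := IHc _ _ (subxx _) rc ec.
  by exists x => //; rewrite inE mem_cat xc orbT.
- have [x xc eE] := IHs _ _ (subset_trans (subD1set _ _) Sy) rs es.
  by exists x => //; rewrite inE mem_cat xc !orbT.
Qed.

Lemma real_sub S y l : S \subset children y -> real S l -> edges y l \subset H.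
Proof.
move=> Sy rl; apply/subsetP => e /(real_edge Sy rl)[x _ [-> xc]].
by have [] := childrenP xc.
Qed.

(** The levels of [l] are levels of [H], so iterating [father] from any label leads back to the root
    above it. Distinctness of labels and recovery of the top vertex both rest on this. *)
Lemma real_labels S d l x : (forall z, z \in S -> dep z = d) -> real S l -> x \in labels l ->
  [/\ (d <= dep x)%N, (dep x < d + nodes l)%N & iter (dep x - d) father x \in S].
Proof.
elim: l S d x => [|v c IHc s IHs] S d x Sd //= /and3P[vS rc rs].
have dv := Sd _ vS; rewrite inE mem_cat => /or3P[/eqP ->|xc|xs].
- by rewrite dv subnn leqnn /=; split=> //; lia.
- have chd z : z \in children v -> dep z = d.+1 by move=> /childrenP[_ -> _]; rewrite dv.
  have [dx dx2 it] := IHc _ _ _ chd rc xc; split; [lia|lia|].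
  have -> : (dep x - d = (dep x - d.+1).+1)%N by lia.
  by rewrite iterS; have [_ _ ->] := childrenP it.
- have Sd' z : z \in S :\ v -> dep z = d by rewrite inE => /andP[_]; exact: Sd.
  have [dx dx2 it] := IHs _ _ _ Sd' rs xs; split=> //; first by lia.
  by apply: subsetP it; exact: subD1set.
Qed.

Lemma real_uniq S d l : (forall z, z \in S -> dep z = d) -> real S l -> uniq (labels l).
Proof.
elim: l S d => [|v c IHc s IHs] S d Sd //= /and3P[vS rc rs].
have dv := Sd _ vS.
have chd z : z \in children v -> dep z = d.+1 by move=> /childrenP[_ -> _]; rewrite dv.
have Sd' z : z \in S :\ v -> dep z = d by rewrite inE => /andP[_]; exact: Sd.
rewrite cat_uniq (IHc _ _ chd rc) (IHs _ _ Sd' rs) /= andbT mem_cat negb_or.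
apply/andP; split; last first.
  apply/hasPn => x xs; apply/negP => /= xc.
  have [dx _ it] := real_labels chd rc xc; have [_ _ it'] := real_labels Sd' rs xs.
  have dE : (dep x - d = (dep x - d.+1).+1)%N by lia.
  by move: it'; rewrite dE iterS; have [_ _ ->] := childrenP it; rewrite !inE eqxx.
apply/andP; split; apply/negP.
  by move=> /(real_labels chd rc)[]; rewrite dv ltnn.
by move=> /(real_labels Sd' rs)[_ _]; rewrite dv subnn /= !inE eqxx.
Qed.

Lemma children_depth y z : z \in children y -> dep z = (dep y).+1.
Proof. by case/childrenP. Qed.

Lemma real_uniq_root y l : real (children y) l -> uniq (y :: labels l).
Proof.
move=> rl; rewrite /= (real_uniq (@children_depth y) rl) andbT; apply/negP.
by move=> /(real_labels (@children_depth y) rl)[]; rewrite ltnn.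
Qed.

Lemma real_root y l x : real (children y) l -> x \in labels l ->
  iter (dep x - dep y) father x = y.
Proof.
move=> rl xl; have [dx _ it] := real_labels (@children_depth y) rl xl.
have -> : (dep x - dep y = (dep x - (dep y).+1).+1)%N by lia.
by rewrite iterS; have [_ _ ->] := childrenP it.
Qed.

Fixpoint reals l S : seq (forest V) := if l is Br _ c s then
    flatten [seq [seq Br z c' s' | c' <- reals c (children z), s' <- reals s (S :\ z)] | z <- enum S]
  else [:: Lf].

Lemma mem_reals l l' S : (l' \in reals l S) = same_shape l' l && real S l'.
Proof.
elim: l l' S => [|v c IHc s IHs] [|v' c' s'] S //=.
  by apply/negP => /flattenP[_ /mapP[z _ ->] /allpairsP[? [_ _]]].
apply/flattenP/idP => [[_ /mapP[z + ->] /allpairsP[[a b] /= [aP bP [-> -> ->]]]]|].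
  by move: aP bP; rewrite mem_enum IHc IHs => /andP[-> ->] /andP[-> ->] ->.
move=> /andP[/andP[sc ss] /and3P[v'S rc rs]].
exists [seq Br v' a b | a <- reals c (children v'), b <- reals s (S :\ v')].
  by apply/mapP; exists v'; rewrite ?mem_enum.
by apply/allpairsP; exists (c', s'); rewrite /= IHc IHs sc ss rc rs.
Qed.

Lemma size_reals v c s S : size (reals (Br v c s) S) =
  (\sum_(z in S) size (reals c (children z)) * size (reals s (S :\ z)))%N.
Proof.
rewrite /= size_flatten /seq.shape -map_comp sumnE big_map big_enum /=.
by apply: eq_bigr => z _ /=; rewrite size_allpairs.
Qed.

Lemma relabel_edges y y' l l' : same_shape l' l -> uniq (y :: labels l) -> uniq (y' :: labels l') ->
  (0 < nodes l)%N -> exists2 f : V -> V, {in cover (edges y l) &, injective f} &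
    edges y' l' = gim f (edges y l).
Proof.
move=> sh ul ul' l0.
pose f x := nth y' (y' :: labels l') (index x (y :: labels l)).
have sz : size (y :: labels l) = size (y' :: labels l').
  rewrite /= !size_labels; congr _.+1.
  by have := size_shape l; rewrite -(same_shape_shape sh) size_shape => /eqP; rewrite eqn_pmul2l // => /eqP.
exists f.
  move=> a b; rewrite !cover_edges // => aP bP /eqP.
  by rewrite nth_uniq // -?sz ?index_mem // => /eqP /index_inj ->.
rewrite gim_edges; have -> : f y = y' by rewrite /f /= eqxx.
congr edges; apply: forest_code_inj; congr (_, _).
  by rewrite (same_shape_shape sh) (same_shape_shape (same_shape_fmap f l)).
rewrite labels_fmap; apply: (@eq_from_nth _ y') => [|i il]; first by rewrite size_map; case: sz.
have il' : (i < size (labels l))%N by case: sz => ->.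
rewrite (nth_map y) // /f /=; case: eqVneq => [ye|_].
  by have := ul; rewrite /= ye mem_nth.
by rewrite index_uniq //; have /andP[] := ul.
Qed.

Section Counting.
Variables (R : realFieldType) (q : R).
Hypothesis q0 : 0 <= q.
Hypothesis hq : forall J : {set {set V}}, J \subset H -> J != set0 ->
  1 / 2 <= (num_copies J K)%:R * q ^+ #|J|.
Let n := #|V|.

Definition rooted_at l : {set V} := [set y | reals l (children y) != [::]].

(* The copies rooted at depths in one residue class modulo the number of vertices
   are edge-disjoint. *)
Lemma card_rooted_at l : (0 < nodes l)%N ->
  #|rooted_at l|%:R * (orderings l)%:R <=
   (nodes l).+1%:R * (8 * n%:R * (4 * n%:R * q) ^+ nodes l).
Proof.
move=> l0; set M := nodes l; set D := orderings l.
pose L y := head Lf (reals l (children y)).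
have LP y : y \in rooted_at l -> same_shape (L y) l /\ real (children y) (L y).
  rewrite inE /L => ne; have : head Lf (reals l (children y)) \in reals l (children y).
    by case: (reals _ _) ne => //= a t _; exact: mem_head.
  by rewrite mem_reals => /andP[].
have LM y : y \in rooted_at l -> nodes (L y) = M.
  move=> /LP[sh _]; have := size_shape (L y); rewrite (same_shape_shape sh) size_shape.
  by move=> /eqP; rewrite eqn_pmul2l // => /eqP.
pose Y rho := [set y in rooted_at l | dep y %% M.+1 == rho]%N.
have bound rho : #|Y rho|%:R * D%:R <= 8 * n%:R * (4 * n%:R * q) ^+ M.
  have [->|[y0 y0Y]] := set_0Vmem (Y rho).
    by rewrite cards0 mul0r !mulr_ge0 ?exprn_ge0 ?mulr_ge0.
  have YR y : y \in Y rho -> y \in rooted_at l by rewrite inE => /andP[].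
  have r0 := YR _ y0Y; have [sh0 re0] := LP _ r0.
  pose J y := edges y (L y).
  have Jcard y : y \in Y rho -> #|J y| = M /\ J y \subset K.
    move=> /YR yR; have [c1 c2] := card_edges_complete (real_uniq_root (LP _ yR).2).
    by rewrite c1 LM.
  have [J0c J0K] := Jcard _ y0Y.
  have J0n : J y0 != set0 by rewrite -card_gt0 J0c.
  (* A common edge has a lower end [x], and both tops are ancestors of [x], between 1 and [M] levels
     above. Depths congruent modulo [M.+1] in that window agree, and [x] has one ancestor per
     depth. *)
  have Jdisj y y' : y \in Y rho -> y' \in Y rho -> ~~ [disjoint J y & J y'] -> y = y'.
    move=> yY y'Y; have [_ ry] := LP _ (YR _ yY); have [_ ry'] := LP _ (YR _ y'Y).
    rewrite -setI_eq0 => /set0Pn[e]; rewrite inE => /andP[ey ey'].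
    have [x xl [eE xc]] := real_edge (subxx _) ry ey.
    have [x' xl' [eE' xc']] := real_edge (subxx _) ry' ey'.
    have xx' : x = x'.
      have [ad dx _] := childrenP xc; have [ad' dx' _] := childrenP xc'.
      have : x \in [set father x'; x'] by rewrite -eE' eE set22.
      rewrite !inE => /orP[/eqP xf|/eqP //].
      have : x' \in [set father x; x] by rewrite -eE eE' set22.
      rewrite !inE => /orP[/eqP xf'|/eqP //].
      by move: dx dx'; rewrite -xf' -xf => dx /(succ_asym dx).
    have [d1 d2 _] := real_labels (@children_depth y) ry xl.
    have [d3 d4 _] := real_labels (@children_depth y') ry' xl'.
    rewrite -(real_root ry xl) -(real_root ry' xl') -xx'.
    rewrite (LM _ (YR _ yY)) in d2; rewrite (LM _ (YR _ y'Y)) -xx' in d4 d3.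
    have dd : dep y = dep y'.
      move: yY y'Y; rewrite !inE => /andP[_ /eqP m1] /andP[_ /eqP m2].
      have e1 := divn_eq (dep y) M.+1; have e2 := divn_eq (dep y') M.+1.
      by rewrite m1 in e1; rewrite m2 in e2; exact: residue_window e1 e2 d1 d2 d3 d4.
    by rewrite dd.
  have Jinj : {in Y rho &, injective J}.
    move=> y y' yY y'Y E; apply: Jdisj => //; rewrite -E -setI_eq0 setIid.
    by rewrite -card_gt0 (Jcard _ yY).1.
  have FFc : [set J y | y in Y rho] \subset copies (J y0) H.
    apply/subsetP => _ /imsetP[y yY ->]; have [sh re] := LP _ (YR _ yY).
    have [||f finj E] := relabel_edges (y := y0) (y' := y) (l := L y0) (l' := L y) _ (real_uniq_root re0) (real_uniq_root re).
    - by apply: shape_inj; rewrite (same_shape_shape sh) (same_shape_shape sh0).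
    - by rewrite LM.
    apply/(copiesP _ J0K HK); exists f => //; split=> //.
    exact: real_sub (subxx _) re.
  have tFF : trivIset [set J y | y in Y rho].
    apply/trivIsetP => _ _ /imsetP[y yY ->] /imsetP[y' y'Y ->].
    by apply: contraNT => nd; rewrite (Jdisj _ _ yY y'Y nd).
  have := packing HK q0 hq J0K J0n FFc tFF; rewrite card_in_imset // J0c => pack.
  have := num_copies_edges (y := y0) (l := L y0).
  rewrite LM // (real_uniq_root re0) -/(J y0) => /(_ l0 isT).
  rewrite (same_shape_orderings sh0) -/D -/n => nc.
  have ncR : (num_copies (J y0) K)%:R * D%:R <= n%:R * (4 ^+ M * n%:R ^+ M) :> R.
    by rewrite -!natrX -!natrM ler_nat.
  apply: le_trans (_ : 8 * (num_copies (J y0) K)%:R * q ^+ M * D%:R <= _).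
    by rewrite ler_wpM2r.
  rewrite mulrAC -[8 * _ * D%:R]mulrA !exprMn.
  apply: le_trans (_ : 8 * (n%:R * (4 ^+ M * n%:R ^+ M)) * q ^+ M <= _).
    by rewrite ler_wpM2r ?exprn_ge0 // ler_wpM2l.
  by rewrite !mulrA.
have -> : #|rooted_at l| = (\sum_(rho < M.+1) #|Y rho|)%N.
  rewrite -sum1_card (partition_big (fun y => inord (dep y %% M.+1) : 'I_M.+1) predT) //=.
  apply: eq_bigr => rho _; rewrite sum1dep_card; apply: eq_card => y; rewrite !inE.
  by congr (_ && _); rewrite -val_eqE /= inordK // ltn_mod.
rewrite natr_sum mulr_suml -[X in X%:R * _]card_ord mulr_natl -sumr_const.
by apply: ler_sum => rho _.
Qed.
End Counting.
End RootedForest.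

(** * The generating function of subtrees *)

Lemma bin_le_expn2 m k : (k <= m)%N -> ('C(m, k) <= 2 ^ m)%N.
Proof.
move=> km; rewrite -[2%N]/(1 + 1)%N expnDn (bigD1 (inord k)) //= inordK ?ltnS //.
by rewrite !exp1n !muln1 leq_addr.
Qed.

Section FallingSum.
Variable R : realFieldType.
Implicit Types (x : R) (d : nat).

Definition falling_sum d x : R := \sum_(r < d.+1) (d ^_ r)%:R * x ^+ r.

Lemma sum_subsets (V : finType) (L : {set V}) x :
  \sum_(T : {set V} | T \subset L) #|T|`!%:R * x ^+ #|T| = falling_sum #|L| x.
Proof.
rewrite (partition_big (fun T : {set V} => inord #|T| : 'I_#|L|.+1) predT) //=.
apply: eq_bigr => r _; rewrite -bin_ffact -cards_draws natrM -mulrA mulr_natl -sumr_const.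
apply: eq_big => [T|T /andP[TL /eqP <-]]; last by rewrite inordK // ltnS subset_leq_card.
rewrite inE; apply: andb_id2l => TL.
by rewrite -val_eqE /= inordK // ltnS subset_leq_card.
Qed.

Lemma falling_sum_le_exp d x : 0 <= x -> falling_sum d x <= (1 + d%:R * x) ^+ d.
Proof.
move=> x0; rewrite exprDn; apply: ler_sum => r _.
rewrite expr1n mul1r exprMn -[_ *+ 'C(_, _)]mulr_natl mulrA ler_wpM2r ?exprn_ge0 //.
rewrite -natrX -natrM ler_nat -bin_ffact leq_mul2l; apply/orP; right.
have : (r <= d)%N by rewrite -ltnS.
move: (nat_of_ord r) => k {r}; elim: k => // k IH kd.
by rewrite factS expnS leq_mul // IH // ltnW.
Qed.

Lemma falling_sum_small d x : 0 <= x -> d%:R * x <= 1 / 5 -> falling_sum d x <= 5 / 4.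
Proof.
move=> x0 dx; apply: le_trans (_ : \sum_(r < d.+1) (1 / 5) ^+ r <= _).
  apply: ler_sum => r _; apply: le_trans (_ : (d%:R * x) ^+ r <= _).
    by rewrite exprMn ler_wpM2r ?exprn_ge0 // -natrX ler_nat ffact_le_expn.
  by rewrite lerXn2r ?nnegrE ?mulr_ge0 ?invr_ge0.
suff -> : \sum_(r < d.+1) (1 / 5 : R) ^+ r = 5 / 4 - (1 / 4) * (1 / 5) ^+ d.
  by rewrite lerBlDr lerDl mulr_ge0 ?exprn_ge0 ?mulr_ge0 ?invr_ge0.
elim: d {dx} => [|d IH]; first by rewrite big_ord_recr big_ord0 /= !expr0; field.
by rewrite big_ord_recr /= IH exprS; field.
Qed.

(** A falling factorial of [a] is at most the factorial of [a], and the geometric series starting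
    with [x] is at most [2 * x]. *)
Lemma falling_sum_fact a x : 0 <= x -> x <= 1 / 2 -> falling_sum a x <= 1 + a`!%:R * (2 * x).
Proof.
move=> x0 x2; rewrite /falling_sum big_ord_recl /= ffactn0 expr0 mulr1 lerD2l.
apply: le_trans (_ : \sum_(r < a) a`!%:R * x ^+ r.+1 <= _).
  apply: ler_sum => r _; rewrite ler_wpM2r ?exprn_ge0 // ler_nat /= /bump add1n.
  rewrite -(ffact_fact (n := a) (m := r.+1)) ?ltn_ord //.
  by rewrite leq_pmulr // fact_gt0.
rewrite -mulr_sumr ler_wpM2l //.
have : \sum_(r < a) x ^+ r.+1 <= 2 * x - x ^+ a * (2 * x).
  elim: a => [|a IH]; first by rewrite big_ord0 expr0; lra.
  rewrite big_ord_recr /=; apply: (le_trans (lerD IH (lexx _))).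
  rewrite !exprS; have : 0 <= x ^+ a by rewrite exprn_ge0.
  move: (x ^+ a) => z z0; have : 0 <= x * z * (1 - 2 * x) by rewrite mulr_ge0 ?mulr_ge0; lra.
  by lra.
by move=> /le_trans; apply; rewrite lerBlDr lerDl mulr_ge0 ?exprn_ge0 ?mulr_ge0.
Qed.

End FallingSum.

Fact mul_rearrange (R : comRingType) (x y p q r s : R) :
  x * (p * r) * (y * (q * s)) = x * y * (p * q) * (r * s).
Proof. by ring. Qed.

Section Generating.
Variables (R : realFieldType) (V : finType).
Implicit Types (S T A L : {set V}) (u : V -> R).

(** A sum over all sequences of distinct elements of [S]: the factorial counts the orders of [T]. *)
Definition ordered_sum u S : R :=
  \sum_(T : {set V} | T \subset S) #|T|`!%:R * \prod_(z in T) u z.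

Lemma ordered_sum_ge1 u S : (forall z, 0 <= u z) -> 1 <= ordered_sum u S.
Proof.
move=> u0; rewrite /ordered_sum (bigD1 set0) ?sub0set //= cards0 big_set0 mulr1.
by rewrite lerDl sumr_ge0 // => T _; rewrite mulr_ge0 ?prodr_ge0.
Qed.

(** The left side collects the nonempty sequences by first element; the empty sequence is the
    slack. *)
Lemma ordered_sum_first u S : (forall z, 0 <= u z) ->
  \sum_(z in S) u z * ordered_sum u (S :\ z) <= ordered_sum u S.
Proof.
move=> u0.
have -> : \sum_(z in S) u z * ordered_sum u (S :\ z) =
    \sum_(z in S) \sum_(T : {set V} | (T \subset S) && (z \in T)) #|T|.-1`!%:R * \prod_(z in T) u z.
  apply: eq_bigr => z zS; rewrite mulr_sumr.
  rewrite [RHS](reindex_onto (fun T => z |: T) (fun T => T :\ z)) /=; last first.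
    by move=> T /andP[_ zT]; rewrite setD1K.
  apply: eq_big => [T|T].
    rewrite subsetD1 setU11 andbT subUset sub1set zS /=; apply: andb_id2l => _.
    apply/idP/eqP => [zT|<-]; first by rewrite setU1K.
    by rewrite !inE eqxx.
  rewrite subsetD1 => /andP[_ zT]; rewrite cardsU1 zT /= big_setU1 //= mulrCA.
  by [].
rewrite (exchange_big_dep (fun T : {set V} => T \subset S)) /=; last by move=> z T _ /andP[].
apply: ler_sum => T TS.
have -> : \sum_(z in S | (T \subset S) && (z \in T)) #|T|.-1`!%:R * \prod_(z in T) u z =
   (#|T| * #|T|.-1`!)%:R * \prod_(z in T) u z.
  transitivity (\sum_(z in T) #|T|.-1`!%:R * \prod_(w in T) u w).
    apply: eq_bigl.
    move=> z; apply/andP/idP => [[_ /andP[]] //|zT].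
    by split; [exact: (subsetP TS) | apply/andP].
  by rewrite sumr_const -[LHS]mulr_natl natrM mulrA.
rewrite ler_wpM2r ?prodr_ge0 // ler_nat.
by case: #|T| => // m; rewrite factS.
Qed.

(** Interleaving two sequences of lengths [a] and [b] costs a binomial coefficient, at most
    [2 ^ (a + b)], which is charged as a factor 2 to each weight. *)
Lemma ordered_sum_setU u A L : (forall z, 0 <= u z) -> [disjoint A & L] ->
  ordered_sum u (A :|: L) <=
  ordered_sum (fun z => 2 * u z) A * ordered_sum (fun z => 2 * u z) L.
Proof.
move=> u0 dAL; rewrite /ordered_sum mulr_suml.
under [leRHS]eq_bigr do rewrite mulr_sumr.
rewrite pair_big /=.
rewrite (reindex_onto (fun p : {set V} * {set V} => p.1 :|: p.2) (fun T => (T :&: A, T :&: L))) /=; last first.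
  by move=> T TS; rewrite -setIUr; apply/setIidPl.
rewrite big_mkcond [leRHS]big_mkcond /=; apply: ler_sum => -[T1 T2] _ /=.
have nn (T : {set V}) : 0 <= #|T|`!%:R * \prod_(z in T) (2 * u z).
  by rewrite mulr_ge0 ?prodr_ge0 // => z _; rewrite mulr_ge0.
case: ifP => [/andP[_ /eqP[E1 E2]]|_]; last by case: ifP => // _; rewrite mulr_ge0.
have T1A : T1 \subset A by rewrite -E1 subsetIr.
have T2L : T2 \subset L by rewrite -E2 subsetIr.
rewrite T1A T2L; have d12 : [disjoint T1 & T2] by exact: disjointW dAL.
rewrite cardsU (disjoint_setI0 d12) cards0 subn0.
rewrite (eq_bigl [predU T1 & T2]) => [|z]; last by rewrite !inE.
rewrite bigU //=.
set a := #|T1|; set b := #|T2|; rewrite !big_split /= !prodr_const.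
rewrite -/a -/b mul_rearrange ler_wpM2r ?mulr_ge0 ?prodr_ge0 //.
rewrite -exprD -natrX -!natrM ler_nat -(bin_fact (leq_addr b a)) addKn [leqRHS]mulnC.
rewrite leq_mul2r (bin_le_expn2 (leq_addr b a)) ?orbT //.
Qed.

End Generating.

(** Put [w = P / r]. If [w / 72 <= 3 / 5] the bound on [U] is at most [(8 / 5) * (5 / 4) = 2];
    otherwise it is at most [w]. *)
Fact light_case (R : realFieldType) (P r U : R) : 1 <= r -> 0 <= P ->
  U <= (1 + P / (72 * r)) * (5 / 4) -> U <= 2 \/ r * U <= P.
Proof.
move=> r1 P0; have r0 : 0 < r by lra.
have -> : P = P / r * r by field; lra.
move: (P / r) (divr_ge0 P0 (ltW r0)) => w w0.
have -> : w * r / (72 * r) = w / 72 by field; lra.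
move=> h; have [w5|w5] := lerP (w / 72) (3 / 5); first by left; nra.
right; rewrite [leRHS]mulrC ler_wpM2l //; first by lra.
by lra.
Qed.

(** With [w = d / b] the hypothesis says [w > 72 / 5], and [3 * (1 + w / 72) = w / 4] holds exactly
    at [w = 72 / 5]. The constants 72 and 1/5 are matched for this. *)
Fact heavy_base (R : realFieldType) (b d : R) : 0 < b -> 1 / 5 < d * (1 / (72 * b)) ->
  3 * (1 + d * (1 / (72 * b))) <= d / (4 * b).
Proof.
move=> b0; have -> : d * (1 / (72 * b)) = d / b / 72 by field; lra.
have -> : d / (4 * b) = d / b / 4 by field; lra.
by lra.
Qed.

Fact heavy_degree (R : realFieldType) (b d : R) : 0 < b -> 1 / 5 < d * (1 / (72 * b)) ->
  2 * b <= d.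
Proof.
move=> b0; have -> : d = d / b * b by field; lra.
have -> : d / b * b * (1 / (72 * b)) = d / b / 72 by field; lra.
by move: (d / b) => w w5; rewrite ler_wpM2r //; lra.
Qed.

Fact pow3_ge (d : nat) : (0 < d)%N -> (maxn 2 d <= 3 ^ d)%N.
Proof.
move=> d0; rewrite geq_max; apply/andP; split; last exact/ltnW/ltn_expl.
by apply: leq_trans (isT : 2 <= 3 ^ 1)%N _; rewrite leq_pexp2l.
Qed.

(** * Replacing the generating function by a single tree *)

Section Dichotomy.
Variables (R : realFieldType) (V : finType) (H : {set {set V}}) (dep : V -> nat) (b : R).
Hypothesis b0 : 0 < b.
Local Notation ch := (children H dep).
Implicit Types (l c s : forest V) (S T A L : {set V}) (u : V -> R).

Let beta := 288 * b.

(** The function [U(y)] truncated at height [i]: it sums over the subtrees of height at most [i]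
    hanging from [y], with ordered siblings and weight [1 / beta] per edge. *)
Fixpoint gen i y : R :=
  if i is j.+1 then ordered_sum (fun z => gen j z / beta) (ch y) else 1.

Let beta0 : 0 < beta. Proof. by rewrite mulr_gt0. Qed.

Lemma gen_ge1 i y : 1 <= gen i y.
Proof.
elim: i y => //= i IH y; apply: ordered_sum_ge1 => z.
by rewrite divr_ge0 ?(ltW beta0) // (le_trans ler01).
Qed.

Lemma gen_beta_ge0 i z : 0 <= gen i z / beta.
Proof. by rewrite divr_ge0 ?(ltW beta0) // (le_trans ler01) ?gen_ge1. Qed.

(** The first root and what hangs from it are chosen, then the remaining siblings, as in
    [ordered_sum_first]. The height of [l] is at most [nodes l], so truncation at [i] loses
    nothing. *)
Lemma size_reals_le l i S : (nodes l <= i)%N ->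
  (size (reals H dep l S))%:R <= beta ^+ nodes l * ordered_sum (fun z => gen i z / beta) S.
Proof.
elim: l i S => [|v c IHc s IHs] i S.
  by move=> _; rewrite expr0 mul1r ordered_sum_ge1 //; exact: gen_beta_ge0.
case: i => // i; rewrite [nodes _]/= ltnS => le_i.
have ci : (nodes c <= i)%N by rewrite (leq_trans _ le_i) ?leq_addr.
have si : (nodes s <= i.+1)%N by rewrite leqW // (leq_trans _ le_i) ?leq_addl.
rewrite size_reals natr_sum.
apply: le_trans (_ : beta ^+ (nodes c + nodes s).+1 *
   \sum_(z in S) gen i.+1 z / beta * ordered_sum (fun z => gen i.+1 z / beta) (S :\ z) <= _).
  rewrite mulr_sumr; apply: ler_sum => z zS; rewrite natrM.
  apply: le_trans (ler_pM _ _ (IHc i (ch z) ci) (IHs i.+1 (S :\ z) si)) _ => //.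
  rewrite -/(gen i.+1 z) mulrACA -exprD exprSr -mulrA ler_wpM2l ?exprn_ge0 ?(ltW beta0) //.
  have E x w : beta * (x / beta * w) = x * w by rewrite mulrA (mulrC beta) divfK ?gt_eqF.
  by rewrite E.
rewrite ler_wpM2l ?exprn_ge0 ?(ltW beta0) //.
by apply: ordered_sum_first; exact: gen_beta_ge0.
Qed.

Lemma real_subset S T l : S \subset T -> real H dep S l -> real H dep T l.
Proof.
elim: l S T => //= v c _ s IHs S T ST /and3P[vS -> rs].
by rewrite (subsetP ST) //= (IHs _ _ (setSD _ ST) rs).
Qed.

(** The weight of a single tree, with [b] in place of [beta]. Its numerator cancels against the
    orderings in [card_rooted_at]. *)
Definition value l : R := (orderings l)%:R / b ^+ nodes l.

(** The trees below the elements of [T] are placed under a common parent, whose [#|T|] children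
    contribute a factorial and [1 / b] for each new edge. *)
Lemma assemble T (g : V -> R) : (forall z, z \in T -> 0 <= g z) ->
  (forall z, z \in T -> exists2 c, real H dep (ch z) c & g z <= value c) ->
  exists2 l, real H dep T l & #|T|`!%:R * \prod_(z in T) (g z / b) <= value l.
Proof.
suff key : (forall z, z \in T -> 0 <= g z) ->
  (forall z, z \in T -> exists2 c, real H dep (ch z) c & g z <= value c) ->
  exists l, [/\ real H dep T l, size (roots_of l) = #|T| &
     #|T|`!%:R * \prod_(z in T) (g z / b) <= value l].
  by move=> g0 gT; have [l [l1 _ l2]] := key g0 gT; exists l.
elim/finset_insert_ind: T => [_ _|x T xT IH g0 gc].
  by exists Lf; rewrite /value cards0 big_set0 expr0 invr1 mulr1 fact0.
have [l [rl sl vl]] : exists l, [/\ real H dep T l, size (roots_of l) = #|T| &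
     #|T|`!%:R * \prod_(z in T) (g z / b) <= value l].
  by apply: IH => z zT; [apply: g0 | apply: gc]; rewrite inE zT orbT.
have [c rc vc] := gc x (setU11 _ _).
exists (Br x c l); split.
- rewrite /= setU11 rc /=; apply: real_subset rl.
  by rewrite setU1K.
- by rewrite /= sl cardsU1 xT.
rewrite cardsU1 xT add1n big_setU1 //= factS natrM /value /= sl.
rewrite !natrM exprS exprD.
have bn0 : b != 0 by rewrite gt_eqF.
have -> : #|T|.+1%:R * (orderings c)%:R * (orderings l)%:R / (b * (b ^+ nodes c * b ^+ nodes l)) =
   #|T|.+1%:R * (value c / b * value l).
  by rewrite /value; field; rewrite !expf_neq0 ?bn0.
rewrite -mulrA ler_wpM2l // mulrCA ler_pM ?divr_ge0 ?mulr_ge0 ?(ltW b0) ?prodr_ge0 //.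
- by apply: g0; rewrite setU11.
- by move=> z zT; rewrite divr_ge0 ?(ltW b0) // g0 // inE zT orbT.
by rewrite ler_wpM2r // invr_ge0 ltW.
Qed.

(** At least [b], so that the factors [rho * u z / b] of heavy children are at least 1; at least 1,
    so that a bound on [rho * gen i y] bounds [gen i y]. *)
Let rho : R := Num.max 1 b.

(** Since [2 / beta = 1 / (144 * b)], the term of [T] is [y ^ #|T|] times a partial product of
    factors [rho * u z / b]. These are at least 1, so the full product over [A] bounds it, and
    [falling_sum_fact] sums the remaining powers of [y]. *)
Lemma heavy_bracket A u : (forall z, z \in A -> 1 <= u z) -> (forall z, 0 <= u z) ->
  ordered_sum (fun z => 2 * (u z / beta)) A <=
  1 + #|A|`!%:R * \prod_(z in A) (rho * u z / b) / (72 * rho).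
Proof.
move=> u1 u0; set P := #|A|`!%:R * _.
have rho1 : 1 <= rho by rewrite le_max lexx.
have rhob : b <= rho by rewrite le_max lexx orbT.
have rho0 : 0 < rho by rewrite (lt_le_trans ltr01).
pose y := 1 / (144 * rho).
have y0 : 0 <= y by rewrite divr_ge0 ?mulr_ge0 // ltW.
have y2 : y <= 1 / 2.
  rewrite ler_pdivrMr ?mulr_gt0 // mulrC mulrA.
  by rewrite (le_trans (_ : 1 <= 72)) ?ler1n //; lra.
have fA0 : 0 < #|A|`!%:R :> R by rewrite ltr0n fact_gt0.
have P0 : 0 <= P / #|A|`!%:R.
  by rewrite divr_ge0 ?(ltW fA0) // mulr_ge0 // prodr_ge0 // => z _; rewrite divr_ge0 ?mulr_ge0 ?(ltW b0) ?(ltW rho0).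
have term (T : {set V}) : T \subset A ->
    #|T|`!%:R * \prod_(z in T) (2 * (u z / beta)) <= P / #|A|`!%:R * (#|T|`!%:R * y ^+ #|T|).
  move=> TA; rewrite mulrCA ler_wpM2l // /P [_ * \prod_(_ in A) _]mulrC mulfK ?gt_eqF //.
  have -> : \prod_(z in T) (2 * (u z / beta)) = \prod_(z in T) (rho * u z / b) * y ^+ #|T|.
    rewrite -prodr_const -big_split /=; apply: eq_bigr => z _.
    by rewrite /beta /y; field; rewrite !gt_eqF.
  rewrite ler_wpM2r ?exprn_ge0 //.
  rewrite [leRHS](big_setID T) /= (setIidPr TA) ler_peMr ?prodr_ge0 //.
    by move=> z _; rewrite divr_ge0 ?mulr_ge0 ?(ltW b0) ?(ltW rho0).
  elim/big_ind: _ => [|x w|z] //; first exact: mulr_ege1.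
  rewrite inE => /andP[_ zA].
  rewrite ler_pdivlMr // mul1r (le_trans rhob) // ler_peMr ?(ltW rho0) //.
  exact: u1.
rewrite /ordered_sum (bigD1 set0) ?sub0set //= cards0 big_set0 mulr1 lerD2l.
apply: le_trans (_ : \sum_(T : {set V} | (T \subset A) && (T != set0)) P / #|A|`!%:R * (#|T|`!%:R * y ^+ #|T|) <= _).
  by apply: ler_sum => T /andP[TA _]; exact: term.
rewrite -mulr_sumr.
have := sum_subsets A y; rewrite (bigD1 set0) ?sub0set //= cards0 expr0 mulr1 => E.
have := falling_sum_fact #|A| y0 y2; rewrite -E lerD2l => le.
apply: (le_trans (ler_wpM2l P0 le)).
have cancelf (p f w : R) : 0 < f -> p / f * (f * w) = p * w by move=> f0; rewrite mulrA divfK ?gt_eqF.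
rewrite cancelf //.
have -> : 2 * y = (72 * rho)^-1 by rewrite /y; field; rewrite gt_eqF.
exact: lexx.
Qed.

Lemma light_bracket L u : (forall z, z \in L -> u z <= 2) -> (forall z, 0 <= u z) ->
  ordered_sum (fun z => 2 * (u z / beta)) L <= falling_sum #|L| (1 / (72 * b)).
Proof.
move=> u2 u0; rewrite -sum_subsets; apply: ler_sum => T TL.
rewrite ler_wpM2l // -prodr_const; apply: ler_prod => z zT.
rewrite mulr_ge0 ?divr_ge0 ?(ltW beta0) //= mulrA ler_pdivrMr // /beta.
have -> : 1 / (72 * b) * (288 * b) = 4 by field; rewrite gt_eqF.
have := u2 z (subsetP TL z zT) => h.
by rewrite (_ : 4 = 2 * 2) ?ler_wpM2l // -natrM.
Qed.

(* Either almost no tree hangs below y, or some single tree realised below y is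
   nearly as heavy as the whole generating function. The gain of the factor rho
   over b makes the induction on the depth close. *)
Lemma gen_dichotomy i y : gen i y <= 2 \/
  exists2 l, real H dep (ch y) l & rho * gen i y <= value l.
Proof.
have rho1 : 1 <= rho by rewrite le_max lexx.
have rhob : b <= rho by rewrite le_max lexx orbT.
have rho0 : 0 < rho by rewrite (lt_le_trans ltr01).
elim: i y => [|i IH] y; first by left; rewrite ler1n.
set u := gen i; set S := ch y.
have u0 z : 0 <= u z by rewrite (le_trans ler01) ?gen_ge1.
pose A := [set z in S | ~~ (u z <= 2)]; pose L := [set z in S | u z <= 2].
have SAL : S = A :|: L by apply/setP => z; rewrite !inE -andb_orr orNb andbT.
have dAL : [disjoint A & L].
  by rewrite -setI_eq0; apply/eqP/setP => z; rewrite !inE; case: (u z <= 2); rewrite ?andbF.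
pose x := 1 / (72 * b); pose P := #|A|`!%:R * \prod_(z in A) (rho * u z / b).
have x0 : 0 <= x by rewrite divr_ge0 ?mulr_ge0 // ltW.
have P0 : 0 <= P.
  by rewrite mulr_ge0 // prodr_ge0 // => z _; rewrite divr_ge0 ?mulr_ge0 ?(ltW b0) ?(ltW rho0).
have r72 : 0 < 72 * rho by rewrite mulr_gt0.
have genE : gen i.+1 y <= (1 + P / (72 * rho)) * falling_sum #|L| x.
  rewrite /= -/S SAL; apply: le_trans (ordered_sum_setU _ dAL) _.
    by move=> z; rewrite divr_ge0 ?(ltW beta0).
  apply: ler_pM.
  - rewrite (le_trans ler01) // ordered_sum_ge1 // => z.
    by rewrite mulr_ge0 ?divr_ge0 ?(ltW beta0).
  - rewrite (le_trans ler01) // ordered_sum_ge1 // => z.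
    by rewrite mulr_ge0 ?divr_ge0 ?(ltW beta0).
  - apply: heavy_bracket => // z; rewrite inE => /andP[_].
    by rewrite -ltNge => /ltW; apply: le_trans; rewrite ler1n.
  - by apply: light_bracket => // z; rewrite inE => /andP[].
(* A heavy child carries the tree supplied by induction; a light child is a bare leaf, of value
   1. *)
pose g z := if z \in A then rho * u z else 1.
have g0 z : 0 <= g z by rewrite /g; case: ifP => // _; rewrite mulr_ge0 ?(ltW rho0).
have gS z : z \in S -> exists2 c, real H dep (ch z) c & g z <= value c.
  move=> zS; rewrite /g; case: ifP => [|_]; last by exists Lf; rewrite // /value expr0 divr1.
  by rewrite inE zS /= => /negP nle; have [/nle|] := IH z.
have pick (T : {set V}) (w : R) : T \subset S -> w <= #|T|`!%:R * \prod_(z in T) (g z / b) ->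
    exists2 l, real H dep S l & w <= value l.
  move=> TS wT; have [||l rl vl] := @assemble T g.
  - by move=> z _.
  - by move=> z /(subsetP TS) /gS.
  - by exists l; [exact: real_subset rl | exact: le_trans vl].
have AS : A \subset S by rewrite SAL subsetUl.
have LS : L \subset S by rewrite SAL subsetUr.
have prodA : \prod_(z in A) (g z / b) = \prod_(z in A) (rho * u z / b).
  by apply: eq_bigr => z zA; rewrite /g zA.
have prodL : \prod_(z in L) (g z / b) = b ^- #|L|.
  rewrite -exprVn -prodr_const; apply: eq_bigr => z zL.
  by rewrite /g (disjointFl dAL zL) mul1r.
have [small|large] := lerP (#|L|%:R * x) (1 / 5).
  have U54 : gen i.+1 y <= (1 + P / (72 * rho)) * (5 / 4).
    apply: (le_trans genE); rewrite ler_wpM2l ?falling_sum_small //.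
    by rewrite addr_ge0 // (divr_ge0 P0 (ltW r72)).
  have [|h] := light_case rho1 P0 U54; first by left.
  by right; apply: (pick A) => //; rewrite prodA.
(* Many light children: hanging all of them as leaves already beats the light bracket. Indeed
   [2 * rho <= 3 ^ d] because [2 * b <= d], and [(3 * (1 + d * x)) ^ d <= (d / (4 * b)) ^ d <= d! /
   b ^ d]. *)
right; set d := #|L| in large genE prodL *.
have d0 : (0 < d)%N.
  by case: posnP large => // ->; rewrite mul0r ltNge divr_ge0.
pose Y : R := d`!%:R / b ^+ d.
have Y0 : 0 <= Y by rewrite divr_ge0 ?exprn_ge0 // ltW.
have rho3 : 2 * rho <= 3 ^+ d.
  apply: le_trans (_ : (maxn 2 d)%:R <= _); last by rewrite -natrX ler_nat pow3_ge.
  have b2 := heavy_degree b0 large; rewrite /rho; have [_|_] := lerP 1 b.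
    by rewrite (le_trans b2) // ler_nat leq_maxr.
  by rewrite mulr1 ler_nat leq_maxl.
have rhoY : 2 * rho * falling_sum d x <= Y.
  apply: le_trans (_ : 3 ^+ d * (1 + d%:R * x) ^+ d <= _).
    rewrite ler_pM ?mulr_ge0 ?(ltW rho0) ?falling_sum_le_exp //.
    by rewrite /falling_sum sumr_ge0 // => r _; rewrite mulr_ge0 ?exprn_ge0.
  rewrite -exprMn; apply: le_trans (_ : (d%:R / (4 * b)) ^+ d <= _).
    rewrite lerXn2r ?nnegrE ?mulr_ge0 ?addr_ge0 ?mulr_ge0 ?invr_ge0 ?mulr_ge0 ?(ltW b0) //.
    exact: heavy_base.
  rewrite expr_div_n exprMn /Y ler_pdivrMr ?mulr_gt0 ?exprn_gt0 //.
  rewrite mulrCA divfK ?gt_eqF ?exprn_gt0 // -!natrX -natrM ler_nat.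
  exact: expnn_le_fact.
have main : rho * gen i.+1 y <= Num.max 1 P * Y.
  have P72 : P / (72 * rho) <= P.
    rewrite ler_pdivrMr ?mulr_gt0 // ler_peMr // (le_trans rho1) //.
    by rewrite ler_peMl ?(ltW rho0) // ler1n.
  have PM : 1 + P / (72 * rho) <= Num.max 1 P * 2.
    rewrite mulr_natr mulr2n; apply: lerD; first by rewrite le_max lexx.
    by rewrite (le_trans P72) // le_max lexx orbT.
  have M0 : 0 <= Num.max 1 P by rewrite le_max ler01.
  apply: le_trans (_ : rho * (Num.max 1 P * 2 * falling_sum d x) <= _).
    rewrite ler_wpM2l ?(ltW rho0) // (le_trans genE) // ler_wpM2r //.
    by rewrite /falling_sum sumr_ge0 // => r _; rewrite mulr_ge0 ?exprn_ge0.
  by rewrite -[_ * 2 * _]mulrA mulrCA [rho * _]mulrA [rho * 2]mulrC ler_wpM2l.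
(* The heavy children are used only if they increase the weight; when both kinds hang from [y], the
   product of the two factorials is at most that of the sum. *)
have [P1|P1] := lerP P 1.
  apply: (pick L) => //; rewrite prodL -/Y; apply: le_trans main _.
  by rewrite (max_idPl P1) mul1r.
apply: (pick S) => //; apply: le_trans main _.
rewrite (max_idPr (ltW P1)) {1}SAL cardsU (disjoint_setI0 dAL) cards0 subn0.
rewrite SAL (eq_bigl [predU A & L]) => [|z]; last by rewrite !inE.
rewrite bigU //= prodA prodL /P /Y mulrACA -/d [X in _ <= _ * X]mulrC.
rewrite [X in _ <= _ * X]mulrC ler_wpM2r ?mulr_ge0 ?invr_ge0 ?exprn_ge0 ?(ltW b0) //.
  by rewrite prodr_ge0 // => z _; rewrite divr_ge0 ?mulr_ge0 ?(ltW b0) ?(ltW rho0).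
rewrite -natrM ler_nat -(bin_fact (leq_addr d #|A|)) addKn leq_pmull //.
by rewrite bin_gt0 leq_addr.
Qed.

End Dichotomy.

(** * Embeddings into a tree *)

Fact depth_bound y z x : (y <= z -> z.+1 < x -> y + (x - z.+2) <= x)%N.
Proof. by lia. Qed.

Fact depth_above y z x d : (y <= z -> z.+1 < x -> d = x - (x - z.+2) -> y < d)%N.
Proof. by lia. Qed.

Fact depth_bound1 y x : (y < x -> y + (x - y.+1) <= x)%N.
Proof. by lia. Qed.

Fact depth_above1 y x d : (y < x -> d = x - (x - y.+1) -> y < d)%N.
Proof. by lia. Qed.

Fact depth_top y x w f g :
  (y < x -> w = x - (x - y.+1) -> w = f.+1 -> f = g.+1 -> y <= g -> False)%N.
Proof. by lia. Qed.

Section ConnectedSubtree.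
Variables (V : finType) (H : {set {set V}}) (dep : V -> nat).
Local Notation K := (complete_graph V).
Hypothesis HK : H \subset K.
Hypothesis dep_adj : forall x y, adj H x y -> dep y = (dep x).+1 \/ dep x = (dep y).+1.
Hypothesis dep_inj : forall x y z, adj H x z -> adj H y z ->
  dep z = (dep x).+1 -> dep z = (dep y).+1 -> x = y.
Implicit Types (l c s : forest V) (S T X : {set V}) (x y z v : V).
Local Notation ch := (children H dep).
Local Notation fa := (father H dep).
Local Notation chP := (childrenP dep_inj).

Lemma connected_gim (f : V -> V) (I : {set {set V}}) :
  connected_graph I -> connected_graph (gim f I).
Proof.
move=> Icon a' b'; rewrite cover_gim => /imsetP[a aI ->] /imsetP[b bI ->].
have /connectP[p + ->] := Icon a b aI bI.
elim: p a {aI b' a'} => //= c p IH a /andP[ac cp].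
apply: connect_trans (connect1 _) (IH _ cp).
by apply/imsetP; exists [set a; c]; rewrite // imsetU1 imset_set1.
Qed.

Section Closure.
Variables (J : {set {set V}}) (y : V).
Hypotheses (JH : J \subset H) (Jcon : connected_graph J) (yJ : y \in cover J).
Hypothesis ymin : forall x, x \in cover J -> (dep y <= dep x)%N.

Lemma adj_child a b : adj H a b -> (b \in ch a) \/ (a \in ch b).
Proof.
move=> ab; have [d|d] := dep_adj ab; [left|right]; rewrite inE d eqxx andbT //.
by rewrite adj_sym.
Qed.

(** If the edge from [x] to its father were missing from [J], the descendants of [x] would be closed
    under adjacency in [J]. As [J] is connected they would contain its top [y], which forces
    [x = y]. *)
Lemma subtree_father x : x \in cover J -> x != y ->
  adj J (fa x) x /\ x \in ch (fa x).
Proof.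
move=> xJ xy; have xfa : adj J (fa x) x.
  apply: contraNT xy => nadj.
  pose D := [set z | (dep x <= dep z)%N && (iter (dep z - dep x) fa z == x)].
  have clD : closed (adj J) (mem D).
    apply: intro_closed => [|a b ab]; first exact: sym_connect_sym (@adj_sym _ J).
    rewrite !inE => /andP[le /eqP it]; have abH : adj H a b := subsetP JH _ ab.
    have [/chP[_ db fb]|/chP[_ da fb]] := adj_child abH.
      rewrite db subSn // iterSr fb it eqxx andbT; lia.
    have [dx|lt] := eqVneq (dep x) (dep a).
      by move: it; rewrite dx subnn /= => ax; rewrite -ax fb adj_sym ab in nadj.
    have le' : (dep x <= dep b)%N by lia.
    rewrite le' /=; move: it; have -> : (dep a - dep x = (dep b - dep x).+1)%N by lia.
    by rewrite iterSr fb => ->.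
  have := closed_connect clD (Jcon xJ yJ); rewrite /= !inE leqnn subnn eqxx /=.
  move=> /esym /andP[le /eqP]; have dE : dep x = dep y.
    by apply/eqP; rewrite eqn_leq le ymin.
  by rewrite dE subnn /= => ->.
split=> //; have xfaH : adj H (fa x) x := subsetP JH _ xfa.
have [//|/chP[_ d _]] := adj_child xfaH.
move: d; rewrite /father; case: pickP => [w /=|_] /=; last by lia.
by rewrite inE => /andP[_ /eqP ->]; lia.
Qed.

Lemma card_subtree : #|cover J| = #|J|.+1.
Proof.
pose e x := [set fa x; x].
have einj : {in cover J :\ y &, injective e}.
  move=> a b; rewrite !inE => /andP[ay aJ] /andP[by' bJ] E.
  have [_ /chP[_ da _]] := subtree_father aJ ay.
  have [_ /chP[_ db _]] := subtree_father bJ by'.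
  have : a \in e b by rewrite -E set22.
  rewrite !inE => /orP[/eqP ab|/eqP //].
  have : b \in e a by rewrite E set22.
  by rewrite !inE => /orP[/eqP ba|/eqP //]; move: da db; rewrite -ba -ab; lia.
have JE : J = e @: (cover J :\ y).
  apply/setP => E; apply/idP/imsetP => [EJ|[x + ->]]; last first.
    by rewrite !inE => /andP[xy xJ]; have [] := subtree_father xJ xy.
  have [a [b [_ EE ab]]] := edge_set2 (subset_trans JH HK) EJ.
  have [aJ bJ] := adj_cover ab.
  have [/chP[_ d f]|/chP[_ d f]] := adj_child (subsetP JH _ ab).
    exists b; last by rewrite /e f.
    by rewrite !inE bJ andbT; apply: contraTneq (ymin aJ) => <-; rewrite d ltnn.
  exists a; last by rewrite /e f setUC.
  by rewrite !inE aJ andbT; apply: contraTneq (ymin bJ) => <-; rewrite d ltnn.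
rewrite [in RHS]JE card_in_imset; first by rewrite (cardsD1 y) yJ.
by move=> a b aP bP; apply: einj.
Qed.

Lemma list_subtree : exists2 l, real H dep (ch y) l & labels l =i cover J :\ y.
Proof.
set X := cover J.
have up x : x \in X -> (dep y < dep x)%N -> x \in ch (fa x) /\ fa x \in X.
  move=> xX dx; have xy : x != y by apply: contraTneq dx => ->; rewrite ltnn.
  have [a b] := subtree_father xX xy; split=> //; by case: (adj_cover a).
have iter_up j x : x \in X -> (dep y + j <= dep x)%N ->
    iter j fa x \in X /\ dep (iter j fa x) = (dep x - j)%N.
  elim: j => [|j IH] xX le; first by rewrite subn0.
  have [w1 w2] := IH xX ltac:(lia).
  have [/chP[_ d _] w4] := up _ w1 ltac:(lia).
  by rewrite iterS; split=> //; lia.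
(* The vertices of [J] below [z] whose ancestor on the level just under [z] lies in [T]. In [build],
   [m] bounds the levels left below [z], and for fixed [m] the set [T] is filled one child at a
   time. *)
pose desc z T x := [&& x \in X, (dep z < dep x)%N & iter (dep x - (dep z).+1) fa x \in T].
have build m z T : (dep y <= dep z)%N -> T \subset ch z :&: X ->
    (forall x, x \in X -> (dep x < dep z + m)%N) ->
    exists2 l, real H dep T l & forall x, (x \in labels l) = desc z T x.
  elim: m z T => [|m IHm] z T yz TX Xm.
    exists Lf => // x; rewrite in_nil /desc; apply/esym/negP => /and3P[xX dx _].
    by have := Xm _ xX; lia.
  move: TX; elim/finset_insert_ind: T => [_|t T tT IH TX].
    by exists Lf => // x; rewrite in_nil /desc in_set0 !andbF.
  have [l rl ll] : exists2 l, real H dep T l & forall x, (x \in labels l) = desc z T x.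
    by apply: IH; apply: subset_trans TX; exact: subsetUr.
  have : t \in ch z :&: X by apply: (subsetP TX); rewrite setU11.
  rewrite inE => /andP[tz tX]; have [_ dt ft] := chP tz.
  have [||c rc cl] := IHm t (ch t :&: X) _ (subxx _); [by lia| |].
    by move=> x /Xm; rewrite dt; lia.
  exists (Br t c l).
    rewrite /= setU11 (real_subset (subsetIl _ _) rc) /=.
    by apply: real_subset rl; rewrite setU1K.
  move=> x; rewrite inE mem_cat cl ll /desc !in_setU1.
  have [xX|] := boolP (x \in X) => /=; last first.
    by move=> xX; rewrite !orbF; apply: contraNF xX => /eqP ->.
  have [xt|xt] := eqVneq x t.
    by rewrite xt dt leqnn subnn /= eqxx.
  have [zx|zx] := ltnP (dep z) (dep x) => /=; last first.
    by rewrite orbF dt; apply/negbTE; rewrite negb_and -leqNgt; apply/orP; left; lia.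
  congr (_ || _); rewrite dt.
  have [E|tx] := eqVneq (dep x) (dep z).+1.
    by rewrite E ltnn subnn /= (negPf xt).
  have lt : ((dep z).+1 < dep x)%N by rewrite ltn_neqAle eq_sym tx.
  rewrite lt /= -(subnSK lt).
  rewrite iterS; set w := iter _ fa x.
  have [wX dw] : w \in X /\ dep w = (dep x - (dep x - (dep z).+2))%N by apply: iter_up => //; exact: depth_bound.
  have [wf _] := up _ wX (depth_above yz lt dw).
  rewrite inE wX andbT; apply/idP/eqP => [/chP[_ _ ->] //|<-].
  exact: wf.
have [|l rl ll] := build (\max_(x in X) dep x).+1 y (ch y :&: X) (leqnn _) (subxx _).
  by move=> x xX; rewrite addnS ltnS (leq_trans (leq_bigmax_cond _ xX)) ?leq_addl.
exists l; first exact: real_subset (subsetIl _ _) rl.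
move=> x; rewrite ll /desc !inE.
have [xX|xX] := boolP (x \in X); last by rewrite andbF.
rewrite andbT /=; have [->|xy] := eqVneq x y; first by rewrite ltnn.
have [yx|yx] := ltnP (dep y) (dep x); last first.
  have [_ /chP[_ d _]] := subtree_father xX xy.
  have [fx _] := adj_cover (subtree_father xX xy).1.
  by have := leq_trans yx (ymin fx); rewrite d ltnn.
set w := iter _ fa x.
have [wX dw] : w \in X /\ dep w = (dep x - (dep x - (dep y).+1))%N.
  by apply: iter_up => //; exact: depth_bound1.
have [wf fwX] := up _ wX (depth_above1 yx dw).
have [_ d _] := chP wf.
have fwy : fa w = y.
  apply/eqP; apply: contraT => fwy; have [a /chP[_ d' _]] := subtree_father fwX fwy.
  by case: (depth_top yx dw d d' (ymin (adj_cover a).1)).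
by rewrite -fwy; move: wf wX; rewrite !inE => -> ->.
Qed.

End Closure.
End ConnectedSubtree.

Section TreeEmbeddings.
Variables (V : finType) (H : {set {set V}}) (dep : V -> nat).
Local Notation K := (complete_graph V).
Hypothesis HK : H \subset K.
Hypothesis dep_adj : forall x y, adj H x y -> dep y = (dep x).+1 \/ dep x = (dep y).+1.
Hypothesis dep_inj : forall x y z, adj H x z -> adj H y z ->
  dep z = (dep x).+1 -> dep z = (dep y).+1 -> x = y.
Implicit Types (l c s : forest V) (S T X : {set V}) (x y z v : V).
Local Notation ch := (children H dep).
Local Notation fa := (father H dep).
Local Notation chP := (childrenP dep_inj).

Lemma real_fmap (f : V -> V) X S S' l : {in X &, injective f} ->
  (forall x z, x \in X -> z \in X -> z \in ch x -> f z \in ch (f x)) ->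
  {subset labels l <= X} -> (forall x, x \in S -> x \in X -> f x \in S') ->
  real H dep S l -> real H dep S' (fmap f l).
Proof.
move=> finj fch; elim: l S S' => //= v c IHc s IHs S S' lX SS' /and3P[vS rc rs].
have vX : v \in X by apply: lX; exact: mem_head.
have cX : {subset labels c <= X} by move=> x xc; apply: lX; rewrite inE mem_cat xc orbT.
have sX : {subset labels s <= X} by move=> x xs; apply: lX; rewrite inE mem_cat xs !orbT.
rewrite SS' //= (IHc _ _ cX _ rc) ?(IHs _ _ sX _ rs) // => x.
- rewrite !inE => /andP[xv xS] xX; rewrite SS' // andbT.
  by apply: contraNneq xv => /finj -> //.
- by move=> xc xX; exact: fch.
Qed.

Variable I : {set {set V}}.
Hypotheses (IK : I \subset K) (Icon : connected_graph I).

(** Embeddings sorted by a vertex [u] sent to least depth and by its image [y]. *)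
Definition embs_top u y : {set {ffun V -> V}} :=
  [set g in embs I H | (g u == y) && [forall w in cover I, dep y <= dep (g w)]%N].

Section TopClass.
Variables (u y : V) (g0 : {ffun V -> V}).
Hypotheses (uI : u \in cover I) (g0E : g0 \in embs_top u y).

Let g0e : g0 \in embs I H. Proof. by move: g0E; rewrite inE => /andP[]. Qed.
Let g0inj : {in cover I &, injective g0}. Proof. by have [] := embsP g0e. Qed.
Let g0u : g0 u = y. Proof. by move: g0E; rewrite inE => /and3P[_ /eqP]. Qed.
Let J := gim g0 I.
Let JH : J \subset H. Proof. by have [] := embsP g0e. Qed.
Let Jcon : connected_graph J. Proof. exact: connected_gim. Qed.
Let yJ : y \in cover J. Proof. by rewrite cover_gim -g0u imset_f. Qed.
Let ymin : forall x, x \in cover J -> (dep y <= dep x)%N.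
Proof.
move=> x; rewrite cover_gim => /imsetP[w wI ->]; move: g0E; rewrite inE.
by move=> /and3P[_ _ /forall_inP]; apply.
Qed.

Let inv x := odflt u [pick w in cover I | g0 w == x].

Let invP x : x \in cover J -> inv x \in cover I /\ g0 (inv x) = x.
Proof.
rewrite cover_gim => /imsetP[w wI xE]; rewrite /inv; case: pickP => [w' /andP[w'I /eqP] //|/(_ w)].
by rewrite wI xE eqxx.
Qed.

Let invK w : w \in cover I -> inv (g0 w) = w.
Proof.
move=> wI; have [|i1 i2] := @invP (g0 w); first by rewrite cover_gim imset_f.
exact: g0inj.
Qed.

(* Two embeddings with the same top orient the edges of I alike. *)
Lemma embs_top_children g x z : g \in embs_top u y -> x \in cover J -> z \in cover J ->
  z \in ch x -> g (inv z) \in ch (g (inv x)).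
Proof.
move=> gE; have : g \in embs I H by move: gE; rewrite inE => /andP[].
move=> ge; have [ginj _ _] := embsP ge.
have gu : g u = y by move: gE; rewrite inE => /and3P[_ /eqP].
have gmin w : w \in cover I -> (dep y <= dep (g w))%N.
  by move: gE; rewrite inE => /and3P[_ _ /forall_inP]; apply.
have [m] := ubnP (dep x); elim: m x z => // m IH x z; rewrite ltnS => xm xJ zJ zx.
have [_ dz fz] := chP zx.
have zy : z != y by apply: contraTneq (ymin xJ) => <-; rewrite dz ltnn.
have [xz _] := subtree_father HK dep_adj dep_inj JH Jcon yJ ymin zJ zy.
have [xI gx] := invP xJ; have [zI gz] := invP zJ.
have adjI : adj I (inv x) (inv z).
  move: xz; rewrite fz => /imsetP[e eI E].
  have eE : e = [set inv x; inv z].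
    apply: (gim_inj_on g0inj); first exact: edge_sub_cover.
      by apply/subsetP => w; rewrite !inE => /orP[] /eqP ->.
    by rewrite -E imsetU1 imset_set1 gx gz.
  by rewrite /adj -eE.
have [//|bad] := adj_child dep_adj (emb_adj ge adjI).
have [_ dbad _] := chP bad.
have [xy|xy] := eqVneq x y.
  have ix : inv x = u by rewrite xy -g0u invK.
  by have := gmin _ zI; rewrite -gu -ix dbad ltnn.
have [px xp] := subtree_father HK dep_adj dep_inj JH Jcon yJ ymin xJ xy.
have [pJ _] := adj_cover px; have [_ dp _] := chP xp.
have good : g (inv x) \in ch (g (inv (fa x))) by apply: IH => //; rewrite -dp.
have [a1 _ f1] := chP good; have [a2 _ f2] := chP bad.
have [pI gp] := invP pJ.
have /ginj E : g (inv (fa x)) = g (inv z) by rewrite -f1 -f2.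
have pz : fa x = z by rewrite -gp -gz E.
by move: dz; rewrite dp pz => /eqP; rewrite ltn_eqF // ltnW.
Qed.

(** The image of one embedding [g0], listed as a forest [l], is the template. Any other [g] of the
    class relabels [l] to a realisation of the same shape below [y], and [g] is read off the new
    labels. *)
Lemma card_embs_top : exists2 l, nodes l = #|I| &
  (#|embs_top u y| <= size (reals H dep l (ch y)))%N.
Proof.
have [l rl ll] := list_subtree HK dep_adj dep_inj JH Jcon yJ ymin.
have nl : nodes l = #|I|.
  have cJ : #|cover J| = #|J|.+1 := card_subtree HK dep_adj dep_inj JH Jcon yJ ymin.
  rewrite -(card_gim g0inj) -/J; apply: succn_inj; rewrite -cJ (cardsD1 y) yJ add1n.
  congr _.+1; rewrite -size_labels -(card_uniqP (real_uniq HK dep_inj (@children_depth _ _ _ dep_inj y) rl)).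
  exact: eq_card.
exists l => //.
pose F (g : {ffun V -> V}) := fmap (g \o inv) l.
have lX : {subset labels l <= cover J} by move=> x; rewrite ll inE => /andP[].
have Finj : {in embs_top u y &, injective F}.
  move=> g h gE hE FE.
  have ge : g \in embs I H by move: gE; rewrite inE => /andP[].
  have he : h \in embs I H by move: hE; rewrite inE => /andP[].
  have [_ _ <-] := embsP ge; have [_ _ <-] := embsP he; apply/eq_restr => w wI.
  have [gy hy] : g u = y /\ h u = y.
    by move: gE hE; rewrite !inE => /and3P[_ /eqP -> _] /and3P[_ /eqP -> _].
  have [->|wu] := eqVneq w u; first by rewrite gy hy.
  have wl : g0 w \in labels l.
    rewrite ll !inE cover_gim imset_f // andbT -g0u.
    by apply: contraNneq wu => /g0inj ->.
  have : labels (F g) = labels (F h) by rewrite FE.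
  rewrite !labels_fmap => /eq_in_map /(_ _ wl) /=.
  by rewrite invK.
rewrite cardE -(size_map F); apply: uniq_leq_size.
  by rewrite map_inj_in_uniq ?enum_uniq // => g h; rewrite !mem_enum; exact: Finj.
move=> _ /mapP[g + ->]; rewrite mem_enum => gE.
have ge : g \in embs I H by move: gE; rewrite inE => /andP[].
have [ginj _ _] := embsP ge.
rewrite mem_reals same_shape_fmap /=.
have gy : y = g (inv y).
  rewrite -{2}g0u invK //.
  by move: gE; rewrite inE => /and3P[_ /eqP].
apply: (real_fmap (X := cover J)) rl => //.
- move=> a b aJ bJ /= /ginj E; have [aI <-] := invP aJ; have [bI <-] := invP bJ.
  by rewrite E.
- by move=> x z xJ zJ; exact: embs_top_children.
- by move=> x xc xJ; rewrite [X in ch X]gy; exact: embs_top_children.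
Qed.

End TopClass.

Lemma card_embs_le_sum (R : realFieldType) (b : R) : 0 < b -> I != set0 ->
  #|embs I H|%:R <= #|cover I|%:R * ((288 * b) ^+ #|I| * \sum_y gen H dep b #|I|.+1 y).
Proof.
move=> b0 I0; set k := #|I|.
have bb0 : 0 <= 288 * b by rewrite mulr_ge0 // ltW.
have cls u y : u \in cover I -> #|embs_top u y|%:R <= (288 * b) ^+ k * gen H dep b k.+1 y.
  move=> uI; have [->|[g0 g0E]] := set_0Vmem (embs_top u y).
    by rewrite cards0 mulr_ge0 ?exprn_ge0 // (le_trans ler01) // gen_ge1.
  have [l nl le] := card_embs_top uI g0E.
  have := size_reals_le H dep b0 (ch y) (eq_leq nl); rewrite nl -/k => le2.
  by apply: le_trans le2; rewrite ler_nat.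
have cov : embs I H \subset \bigcup_(p in setX (cover I) [set: V]) embs_top p.1 p.2.
  have /set0Pn[e eI] := I0; have [a [_ [_ _ /adj_cover[aI _]]]] := edge_set2 IK eI.
  apply/subsetP => g gE.
  case: (arg_minnP (fun w => dep (g w)) aI) => u uI umin.
  apply/bigcupP; exists (u, g u); first by rewrite in_setX in_setT andbT; exact: uI.
  rewrite inE gE eqxx /=.
  by apply/forall_inP => w /umin.
have : (#|embs I H| <= \sum_(p in setX (cover I) [set: V]) #|embs_top p.1 p.2|)%N.
  apply: leq_trans (subset_leq_card cov) _.
  elim/big_rec2: _ => [|p m U _ le]; first by rewrite cards0.
  by rewrite (leq_trans (leq_card_setU _ _)) // leq_add2l.
rewrite -(ler_nat R) natr_sum => /le_trans; apply.
apply: le_trans (_ : \sum_(p in setX (cover I) [set: V]) (288 * b) ^+ k * gen H dep b k.+1 p.2 <= _).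
  by apply: ler_sum => p; rewrite inE => /andP[pI _]; exact: cls.
rewrite (eq_bigl (fun p => (p.1 \in cover I) && (p.2 \in [set: V]))); last by move=> p; rewrite inE.
rewrite -(pair_big (fun u => u \in cover I) (fun y => y \in [set: V]) (fun _ y => (288 * b) ^+ k * gen H dep b k.+1 y)).
rewrite sumr_const -[leLHS]mulr_natl ler_wpM2l // mulr_sumr.
by rewrite (eq_bigl predT) ?lexx // => y; rewrite inE.
Qed.

End TreeEmbeddings.

(** * Summing the generating function over all vertices *)

Lemma sum_halves (R : realFieldType) m : \sum_(1 <= k < m.+1) (1 / 2 : R) ^+ k <= 1.
Proof.
suff -> : \sum_(1 <= k < m.+1) (1 / 2 : R) ^+ k = 1 - (1 / 2) ^+ m.
  by rewrite lerBlDr lerDl exprn_ge0 ?divr_ge0.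
elim: m => [|m IH]; first by rewrite big_geq // expr0 subrr.
by rewrite big_nat_recr //= IH exprS; field.
Qed.

Fact weight_rearrange (R : comRingType) (m a x y : R) : m * (a * (x * y)) = a * (m * x) * y.
Proof. by ring. Qed.

Section TreeSums.
Variables (V : finType) (H : {set {set V}}) (dep : V -> nat).
Local Notation K := (complete_graph V).
Hypothesis HK : H \subset K.
Hypothesis dep_inj : forall x y z, adj H x z -> adj H y z ->
  dep z = (dep x).+1 -> dep z = (dep y).+1 -> x = y.
Variables (R : realFieldType) (q : R).
Hypothesis q0 : 0 < q.
Hypothesis hq : forall J : {set {set V}}, J \subset H -> J != set0 ->
  1 / 2 <= (num_copies J K)%:R * q ^+ #|J|.
Let n := #|V|.
Hypothesis n0 : (0 < n)%N.
Let b := 64 * (n%:R * q).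

Let b0 : 0 < b. Proof. by rewrite !mulr_gt0 ?ltr0n. Qed.

(** Since [4 * n * q = b / 16], the powers of [b] and the orderings cancel in [card_rooted_at]. *)
Lemma shape_class_weight (Y : {set V}) (l : V -> forest V) M : (0 < M)%N ->
  (forall y, y \in Y -> real H dep (children H dep y) (l y) /\ nodes (l y) = M) ->
  (forall y y', y \in Y -> y' \in Y -> same_shape (l y) (l y')) ->
  \sum_(y in Y) value b (l y) <= 8 * n%:R * (M.+1%:R * (1 / 16) ^+ M).
Proof.
move=> M0 lY same; have [->|[y0 y0Y]] := set_0Vmem Y.
  by rewrite big_set0 !mulr_ge0 ?exprn_ge0 ?mulr_ge0 ?invr_ge0.
have [_ nM] := lY _ y0Y.
have -> : \sum_(y in Y) value b (l y) = \sum_(y in Y) (orderings (l y0))%:R / b ^+ M.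
  apply: eq_bigr => y yY; rewrite /value (same_shape_orderings (same y y0 yY y0Y)).
  by have [_ ->] := lY _ yY.
rewrite sumr_const -[leLHS]mulr_natl mulrA ler_pdivrMr ?exprn_gt0 //.
have := card_rooted_at HK dep_inj (ltW q0) hq (l := l y0); rewrite nM => /(_ M0) bound.
apply: le_trans (_ : #|rooted_at H dep (l y0)|%:R * (orderings (l y0))%:R <= _).
  rewrite ler_wpM2r // ler_nat; apply: subset_leq_card; apply/subsetP => y yY.
  rewrite inE; apply/eqP => E; have : l y \in reals H dep (l y0) (children H dep y).
    by rewrite mem_reals same //; have [->] := lY _ yY.
  by rewrite E in_nil.
apply: (le_trans bound); rewrite -/n.
have -> : (4 * n%:R * q) ^+ M = (1 / 16) ^+ M * b ^+ M.
  by rewrite -exprMn /b; congr (_ ^+ _); field.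
by rewrite weight_rearrange lexx.
Qed.

(** Vertices where [gen] is at most 2 contribute [2 * n]. The others are grouped by the size [M] and
    the shape of their heavy tree: [4 ^ M] shapes of weight [8 * n * (M + 1) / 16 ^ M] leave
    [8 * n / 2 ^ M], as [M + 1 <= 2 ^ M]. This is why [b] is [64 = 4 * 16] times [n * q]. *)
Lemma sum_gen_le i : \sum_y gen H dep b i y <= 10 * n%:R.
Proof.
have /fin_all_exists[l lP] : forall y, exists l, 2 < gen H dep b i y ->
    real H dep (children H dep y) l /\ gen H dep b i y <= value b l.
  move=> y; have [le2|[l rl vl]] := gen_dichotomy H dep b0 i y.
    by exists Lf; rewrite ltNge le2.
  exists l => _; split=> //; apply: le_trans vl.
  by rewrite ler_peMl ?le_max ?lexx // (le_trans ler01) ?gen_ge1.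
pose Y := [set y | 2 < gen H dep b i y].
have lY y : y \in Y -> real H dep (children H dep y) (l y) /\ gen H dep b i y <= value b (l y).
  by rewrite inE; exact: lP.
have nodes_le y : y \in Y -> (0 < nodes (l y) < n.+1)%N.
  move=> yY; have [rl vl] := lY _ yY; apply/andP; split.
    case: (l y) vl => // vl; move: yY; rewrite inE => /lt_le_trans/(_ vl).
    by rewrite /value expr0 divr1 ltrn1.
  have ul := real_uniq HK dep_inj (@children_depth _ _ _ dep_inj y) rl.
  by rewrite ltnS -size_labels -(card_uniqP ul) max_card.
apply: le_trans (_ : (\sum_(y : V) 2) + \sum_(y in Y) value b (l y) <= _).
  rewrite [X in _ + X]big_mkcond -big_split /=; apply: ler_sum => y _.
  case: ifP => [/[dup] yY /lY[_ vl]|]; first by rewrite (le_trans vl) // lerDr ler0n.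
  by rewrite inE addr0 => /negbT; rewrite -leNgt.
have -> : 10 * n%:R = 2 * n%:R + 8 * n%:R :> R by ring.
apply: lerD; first by rewrite sumr_const -[leLHS]mulr_natr.
apply: le_trans (_ : \sum_(1 <= M < n.+1) 8 * n%:R * (1 / 2) ^+ M <= _); last first.
  by rewrite -mulr_sumr ler_piMr ?mulr_ge0 // sum_halves.
rewrite (partition_big (fun y => inord (nodes (l y)) : 'I_n.+1) predT) //=.
rewrite big_ord_recl big1 ?add0r => [|y /andP[yY /eqP E]]; last first.
  have /andP[p1 p2] := nodes_le _ yY; move/(congr1 val): E.
  by rewrite /= inordK // => E; rewrite E in p1.
rewrite big_add1 /= big_mkord; apply: ler_sum => M _.
set m := M.+1.
apply: le_trans (_ : \sum_(t : (2 * m).-tuple bool) 8 * n%:R * (m.+1%:R * (1 / 16) ^+ m) <= _).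
  pose F y : (2 * m).-tuple bool := insubd [tuple of nseq (2 * m) true] (plane_shape (l y)).
  rewrite (partition_big F predT) //=; apply: ler_sum => t _.
  pose Z := [set y in Y | (nodes (l y) == m) && (plane_shape (l y) == t :> seq bool)].
  rewrite (eq_bigl (fun y => y \in Z)) => [|y]; last first.
    rewrite [RHS]inE -andbA; apply: andb_id2l => yY; have /andP[p1 p2] := nodes_le _ yY.
    rewrite -val_eqE /= inordK // /bump add1n -/m; apply: andb_id2l => /eqP nE.
    by rewrite -val_eqE /F val_insubd size_shape nE eqxx.
  apply: shape_class_weight => //.
    by move=> y; rewrite inE => /and3P[/lY[rl _] /eqP -> _].
  by move=> y y'; rewrite !inE => /and3P[_ _ /eqP E] /and3P[_ _ /eqP E']; apply: shape_inj; rewrite E E'.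
rewrite sumr_const card_tuple card_bool -[leLHS]mulr_natr -mulrA ler_wpM2l ?mulr_ge0 //.
rewrite expnM natrX -mulrA -exprMn.
have -> : 1 / 16 * (2 ^ 2)%:R = (1 / 2) * (1 / 2) :> R by field.
rewrite exprMn mulrA ler_piMl ?exprn_ge0 ?divr_ge0 // expr_div_n expr1n.
by rewrite mul1r ler_pdivrMr ?exprn_gt0 // mul1r -natrX ler_nat ltn_expl.
Qed.

End TreeSums.

Fact tree_constant (R : comRingType) (n q : R) : 288 * (64 * (n * q)) = 288 * 64 * q * n.
Proof. by ring. Qed.

Fact tree_rearrange (R : comRingType) (k x y n : R) :
  k * (x * y * (10 * n)) = 10 * k * x * (y * n).
Proof. by ring. Qed.

Fact tree_factor (R : comRingType) (q : R) : 20 * (288 * 64) * q = 20 * (288 * 64 * q).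
Proof. by ring. Qed.

Lemma tree_embs (V : finType) (R : realFieldType) (q : R) (H I : {set {set V}}) :
  H \subset complete_graph V -> is_tree H -> 0 < q ->
  (forall J : {set {set V}}, J \subset H -> J != set0 ->
     1 / 2 <= (num_copies J (complete_graph V))%:R * q ^+ #|J|) ->
  I \subset H -> I != set0 -> connected_graph I ->
  #|embs I H|%:R <= (20 * (288 * 64) * q) ^+ #|I| * #|V|%:R ^+ #|cover I|.
Proof.
move=> HK Htree q0 hq IH I0 Icon; have IK := subset_trans IH HK.
have [dep [dep_adj dep_inj]] := tree_rooting HK Htree.
set n := #|V|; set k := #|I|.
have n0 : (0 < n)%N.
  by rewrite (leq_trans _ (max_card (mem (cover I)))) // ltnW // card_cover_gt1.
have cI : #|cover I| = k.+1.
  have /set0Pn[e eI] := I0; have [a [_ [_ _ /adj_cover[aI _]]]] := edge_set2 IK eI.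
  have [u uI umin] : exists2 u, u \in cover I & forall w, w \in cover I -> (dep u <= dep w)%N.
    by case: (arg_minnP dep aI) => u uI umin; exists u.
  by rewrite (card_subtree HK dep_adj dep_inj IH Icon uI umin).
have b0 : 0 < 64 * (n%:R * q) by rewrite !mulr_gt0 ?ltr0n.
have := card_embs_le_sum HK dep_adj dep_inj IK Icon b0 I0; rewrite -/k cI => le1.
have := sum_gen_le HK dep_inj q0 hq n0 k.+1; rewrite -/n => le2.
apply: (le_trans le1).
apply: le_trans (_ : k.+1%:R * ((288 * (64 * (n%:R * q))) ^+ k * (10 * n%:R)) <= _).
  by rewrite !ler_wpM2l ?exprn_ge0 ?mulr_ge0 ?(ltW q0).
rewrite tree_constant (exprMn _ (288 * 64 * q)) tree_rearrange.
rewrite exprSr ler_wpM2r ?mulr_ge0 ?exprn_ge0 // tree_factor (exprMn _ 20).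
rewrite ler_wpM2r ?exprn_ge0 ?mulr_ge0 ?(ltW q0) //.
rewrite -natrM -natrX ler_nat; apply: leq_trans (_ : 10 ^ k * 2 ^ k <= _)%N; last by rewrite -expnMn.
apply: leq_mul; last exact: ltn_expl.
by rewrite -[X in (X <= _)%N]expn1 leq_pexp2l // card_gt0.
Qed.

(** * Spread and thresholds *)

Lemma sum_quarters (R : realFieldType) k : \sum_(i < k) (1 / 4 : R) ^+ i.+1 <= 1 / 3.
Proof.
suff -> : \sum_(i < k) (1 / 4 : R) ^+ i.+1 = 1 / 3 - 1 / 3 * (1 / 4) ^+ k.
  by rewrite lerBlDr lerDl mulr_ge0 ?exprn_ge0 ?divr_ge0.
elim: k => [|k IH]; first by rewrite big_ord0 expr0; ring.
by rewrite big_ord_recr /= IH exprS; field.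
Qed.

Lemma one_sub_exp_le (R : realFieldType) (a : R) k : 0 <= a <= 1 -> 1 - (1 - a) ^+ k <= k%:R * a.
Proof.
move=> /andP[a0 a1]; elim: k => [|k IH]; first by rewrite expr0 subrr mul0r.
rewrite exprS -natr1; have x1 : (1 - a) ^+ k <= 1 by rewrite exprn_ile1 ?subr_ge0 // lerBlDr lerDl.
have x0 : 0 <= (1 - a) ^+ k by rewrite exprn_ge0 ?subr_ge0.
move: ((1 - a) ^+ k) IH x0 x1 => x IH x0 x1; nra.
Qed.

Section Spread.
Variables (R : realType) (V : finType) (c q : R) (H : {set {set V}}).
Local Notation K := (complete_graph V).
Hypotheses (HK : H \subset K) (c0 : 0 <= c) (q0 : 0 <= q).
Hypothesis connected_embs : forall I : {set {set V}}, I \subset H -> I != set0 ->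
  connected_graph I -> #|embs I H|%:R <= (c * q) ^+ #|I| * #|V|%:R ^+ #|cover I|.
Implicit Types (I A : {set {set V}}).

Lemma embs_bound I : I \subset H ->
  #|embs I H|%:R <= (c * q) ^+ #|I| * #|V|%:R ^+ #|cover I|.
Proof.
have [m] := ubnP #|I|; elim: m I => // m IHm I; rewrite ltnS => Im IH.
have [->|I0] := eqVneq I set0.
  rewrite /cover big_set0 !cards0 !expr0 mulr1.
  have := embs_set0 H; rewrite -(ler_nat R); exact: le_trans.
have [I1 [I2 [IE d12 I10 I1con dc]]] := component_split (subset_trans IH HK) I0.
have I1H : I1 \subset H by apply: subset_trans IH; rewrite IE subsetUl.
have I2H : I2 \subset H by apply: subset_trans IH; rewrite IE subsetUr.
have cI : #|I| = (#|I1| + #|I2|)%N by rewrite IE cardsU (disjoint_setI0 d12) cards0 subn0.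
have cc : #|cover I| = (#|cover I1| + #|cover I2|)%N.
  by rewrite IE cover_setU cardsU (disjoint_setI0 dc) cards0 subn0.
have b1 := connected_embs I1H I10 I1con.
have b2 : #|embs I2 H|%:R <= (c * q) ^+ #|I2| * #|V|%:R ^+ #|cover I2|.
  apply: IHm => //; rewrite cI in Im; apply: leq_trans Im.
  by rewrite -[X in (X < _)%N]add0n ltn_add2r card_gt0.
apply: le_trans (_ : #|embs I1 H|%:R * #|embs I2 H|%:R <= _).
  by rewrite -natrM ler_nat IE embs_setU.
by rewrite cI cc !exprD mulrACA ler_pM.
Qed.

(** Replacing [n ^ v] by a falling factorial costs [4 ^ v], and [v <= 2 * e(I)] turns this into
    [16 ^ e(I)]. *)
Lemma card_perm_bound I : I \subset H ->
  #|[set s : {perm V} | gim s I \subset H]|%:R <= (16 * c * q) ^+ #|I| * #|V|`!%:R.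
Proof.
move=> IH; set n := #|V|; set v := #|cover I|.
have IK := subset_trans IH HK; have vn : (v <= n)%N := max_card _.
have := card_perm_embs I H; rewrite -(ler_nat R) natrM => /le_trans; apply.
apply: le_trans (ler_wpM2r _ (embs_bound IH)) _; first exact: ler0n.
rewrite -/n -/v -[16 * c * q]mulrA (exprMn _ 16) [16 ^+ _ * _]mulrC -!mulrA.
rewrite ler_wpM2l ?exprn_ge0 ?mulr_ge0 //.
rewrite -!natrX -!natrM ler_nat -(ffact_fact vn) mulnA leq_mul2r; apply/orP; right.
apply: (leq_trans (expn_le_ffact vn)); rewrite leq_mul2r; apply/orP; right.
rewrite -[16%N]/(4 ^ 2)%N -expnM leq_pexp2l //; exact: card_cover_le.
Qed.

(** If some copy [gim s0 H] contains [A], pull [A] back to [I] inside [H]. Then [s] is sent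
    injectively to the permutation applying [s0] and then the inverse of [s], which maps [I] into
    [H]. *)
Lemma spread A :
  #|[set s : {perm V} | A \subset gim s H]|%:R <= (16 * c * q) ^+ #|A| * #|V|`!%:R.
Proof.
set P := [set s | _]; have [->|[s0 s0P]] := set_0Vmem P.
  by rewrite cards0 mulr_ge0 ?exprn_ge0 ?mulr_ge0.
have pull (s : {perm V}) (B : {set {set V}}) : B \subset gim s H -> gim s^-1%g B \subset H.
  move=> /(gim_sub s^-1%g); rewrite (_ : gim _ (gim s H) = H) //.
  by rewrite gim_comp (eq_in_gim (g := id)) ?gim_id // => x _; exact: permK.
pose I := gim s0^-1%g A.
have IH : I \subset H by apply: pull; rewrite inE in s0P.
have cA : #|I| = #|A| by rewrite card_gim // => x y _ _ /perm_inj.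
have AE : A = gim s0 I.
  rewrite /I gim_comp -[LHS]gim_id; apply: eq_in_gim => x _.
  by rewrite /= permKV.
rewrite -cA; apply: le_trans (card_perm_bound IH); rewrite ler_nat.
rewrite -(card_in_imset (f := fun s : {perm V} => (s0 * s^-1)%g)); last first.
  by move=> s t _ _ /mulgI /invg_inj.
apply: subset_leq_card; apply/subsetP => _ /imsetP[s + ->]; rewrite !inE => As.
rewrite (eq_in_gim (g := s^-1%g \o s0)) => [|x _]; last by rewrite /= permM.
by rewrite -gim_comp -AE; exact: pull.
Qed.

(** [P] marks the sets carrying weight: all edge sets of [K_n] for a fractional cover, the members
    of the cover for an integral one. *)
Lemma cover_average (w : {set {set V}} -> R) (P : pred {set {set V}}) :
  (forall A, P A -> 0 <= w A) ->
  (forall s : {perm V}, 1 <= \sum_(A : {set {set V}} | P A && (A \subset gim s H)) w A) ->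
  1 <= \sum_(A : {set {set V}} | P A) w A * (16 * c * q) ^+ #|A|.
Proof.
move=> w0 cov; have f0 : 0 < #|V|`!%:R :> R by rewrite ltr0n fact_gt0.
rewrite -(ler_pM2r f0) mul1r.
have cardS : #|V|`!%:R = \sum_(s : {perm V}) 1 :> R.
  rewrite sumr_const -cardsT -card_perm; congr _%:R; apply: eq_card => s.
  by apply/subsetP => x _; rewrite in_setT.
rewrite {1}cardS; apply: le_trans (ler_sum _ (fun s _ => cov s)) _.
rewrite (exchange_big_dep P) /=; last by move=> s A _ /andP[].
rewrite mulr_suml; apply: ler_sum => A PA; rewrite PA /= sumr_const -[leRHS]mulrA.
rewrite -[leLHS]mulr_natr ler_wpM2l ?w0 //.
by apply: le_trans (spread A); rewrite ler_nat; apply: eq_leq; apply: eq_card => s; rewrite !inE.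
Qed.

End Spread.

(** * From spread to the two thresholds *)

Section ThresholdBounds.
Variables (R : realType) (n : nat).
Implicit Types (H I J S A W : {set {set 'I_n}}).

Lemma self_copy H : H \subset Kn n -> H \in copies H (Kn n).
Proof. by move=> HK; apply/(copiesP _ HK (subxx _)); exists id => //; rewrite gim_id. Qed.

Lemma perm_copy H (s : {perm 'I_n}) : H \subset Kn n -> gim s H \in copies H (Kn n).
Proof.
move=> HK; have sinj : {in cover H &, injective s} by move=> x y _ _ /perm_inj.
by apply/(copiesP _ HK (subxx _)); exists s => //; rewrite gim_complete.
Qed.

Lemma num_copies_gt0 H I : H \subset Kn n -> I \subset H -> (0 < num_copies I (Kn n))%N.
Proof.
by move=> HK IH; rewrite card_gt0; apply/set0Pn; exists I; apply/self_copy/(subset_trans IH HK).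
Qed.

Lemma le_p_E H x : H \subset Kn n ->
  (forall p, 0 <= p -> (forall I : {set {set 'I_n}}, I \subset H -> I != set0 ->
     1 / 2 <= (num_copies I (Kn n))%:R * p ^+ #|I|) -> x <= p) ->
  x <= p_E R H.
Proof.
move=> HK hx; apply: lb_le_inf => [|p [/andP[p0 _]]]; last exact: hx.
exists 1; split; first by rewrite ler01 lexx.
move=> I IH _; rewrite expr1n mulr1 (le_trans (_ : 1 / 2 <= 1)) //.
  by rewrite ler_pdivrMr // mul1r ler1n.
by rewrite ler1n (num_copies_gt0 HK).
Qed.

Lemma p_E_ge0 H : H \subset Kn n -> 0 <= p_E R H.
Proof. by move=> /le_p_E; apply. Qed.

(** Each [J] by itself forces [p] to be at least the [e(J)]-th root of [1 / (2 * N)], and this lower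
    bound passes to the infimum. *)
Lemma p_E_attained H J : H \subset Kn n -> J \subset H -> J != set0 ->
  1 / 2 <= (num_copies J (Kn n))%:R * p_E R H ^+ #|J|.
Proof.
move=> HK JH J0; set N := num_copies J (Kn n).
have N0 : 0 < N%:R :> R by rewrite ltr0n (num_copies_gt0 HK).
have e0 : (0 < #|J|)%N by rewrite card_gt0.
pose a : R := 1 / 2 / N%:R; have a0 : 0 <= a by rewrite !divr_ge0.
pose x := a `^ (#|J|%:R)^-1.
have xE : x ^+ #|J| = a.
  by rewrite -powR_mulrn ?powR_ge0 // -powRrM mulVf ?powRr1 // pnatr_eq0 -lt0n.
rewrite [leRHS]mulrC -ler_pdivrMr // -/a -xE lerXn2r ?nnegrE ?powR_ge0 ?(p_E_ge0 HK) //.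
apply: le_p_E => // p p0 /(_ J JH J0) hJ.
rewrite -(@ler_pXn2r _ #|J|) ?nnegrE ?powR_ge0 // xE ler_pdivrMr // [leRHS]mulrC.
exact: hJ.
Qed.

Lemma prob_contains_copy (p : R) H :
  prob_gnp p (fun G => contains_copy G H) =
  expect p (Kn n) (fun W => [exists S in copies H (Kn n), S \subset W]%:R).
Proof.
rewrite /prob_gnp /expect big_mkcondr /=; apply: eq_bigr => W WK.
have -> : [exists S in copies H (Kn n), S \subset W] = contains_copy W H.
  apply/exists_inP/existsP => [[S]|[S]]; rewrite !inE.
    by move=> /andP[_ iso] SW; exists S; rewrite inE SW.
  move=> /andP[SW iso]; exists S => //.
  by rewrite inE iso (subset_trans SW WK).
by case: contains_copy; rewrite ?mulr1 ?mulr0.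
Qed.

Variables (c : R) (H : {set {set 'I_n}}).
Let q := p_E R H.
Hypotheses (HK : H \subset Kn n) (H0 : H != set0) (c0 : 0 <= c).
Hypothesis connected_embs : forall I, I \subset H -> I != set0 -> connected_graph I ->
  #|embs I H|%:R <= (c * q) ^+ #|I| * n%:R ^+ #|cover I|.

Let q0 : 0 <= q. Proof. exact: p_E_ge0. Qed.

Let average w (P : pred {set {set 'I_n}}) :
  (forall A, P A -> 0 <= w A) ->
  (forall s : {perm 'I_n}, 1 <= \sum_(A : {set {set 'I_n}} | P A && (A \subset gim s H)) w A) ->
  1 <= \sum_(A : {set {set 'I_n}} | P A) w A * (16 * c * q) ^+ #|A|.
Proof.
apply: cover_average => // I IH I0 Icon; rewrite card_ord; exact: connected_embs.
Qed.

Lemma p_E_star_bound : p_E_star R H <= 16 * c * q.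
Proof.
have Kq0 : 0 <= 16 * c * q by rewrite !mulr_ge0.
rewrite /p_E_star; set E := (X in sup X).
(* Where no supremum exists [sup] is 0, and the claim is nonnegativity. *)
have [[ne _]|/sup_out -> //] := boolp.pselect (classical_sets.has_sup E).
apply: ge_sup => // p [/andP[p0 p1] [w [[w0 wcov] cost]]].
rewrite leNgt; apply/negP => ltp.
have : 1 <= cover_cost w p; last by apply/negP; rewrite -ltNge (le_lt_trans cost) // ltr_pdivrMr // mul1r ltr1n.
apply: le_trans (average (w := w) (P := fun A => A \subset Kn n) w0 _) _; last first.
  rewrite /cover_cost; apply: ler_sum => A AK; rewrite ler_wpM2l ?w0 //.
  by rewrite lerXn2r ?nnegrE // ltW.
move=> s; apply: le_trans (wcov _ (perm_copy s HK)) _.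
rewrite le_eqVlt; apply/orP; left; apply/eqP; apply: eq_bigl => A.
apply/idP/andP => [As|[]//]; split=> //.
by apply: subset_trans As _; have := perm_copy s HK; rewrite inE => /andP[].
Qed.

Lemma p_c_le p : 0 <= p <= 1 -> 1 / 2 <= prob_gnp p (fun G => contains_copy G H) ->
  p_c R H <= p.
Proof.
move=> p01 hp; apply: ge_inf; last by split.
by exists 0 => x [/andP[]].
Qed.

Lemma p_c_le1 : p_c R H <= 1.
Proof.
apply: p_c_le; first by rewrite ler01 lexx.
rewrite /prob_gnp (bigD1 (Kn n)) /=; last first.
  by rewrite subxx /=; apply/existsP; exists H; exact: self_copy.
rewrite big1 => [|e ->] //; rewrite ler_wpDr //.
  apply: sumr_ge0 => G _; apply: prodr_ge0 => e _.
  by case: ifP; rewrite ?subrr.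
by rewrite ler_pdivrMr // mul1r ler1n.
Qed.

Lemma p_c_bound : p_c R H <= 256 * c / ln 2 * q * ln (2 * #|H|%:R).
Proof.
set p := 16 * c * q; have p0 : 0 <= p by rewrite !mulr_ge0.
(* [#|H| < 2 ^ t.+1], so [t.+1] rounds suffice, and [t.+1] is at most [ln (2 * #|H|) / ln 2]. *)
pose t := trunc_log 2 #|H|.
have H1 : (0 < #|H|)%N by rewrite card_gt0.
have /andP[tH Ht] := trunc_log_bounds (isT : 1 < 2)%N H1; rewrite -/t in tH Ht.
have ln2 : 0 < ln 2 :> R by rewrite ln_gt0 // ltr1n.
have tln : t.+1%:R * ln 2 <= ln (2 * #|H|%:R) :> R.
  rewrite mulr_natl -lnXn // ler_ln ?posrE ?exprn_gt0 ?mulr_gt0 ?ltr0n //.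
  by rewrite exprS ler_wpM2l // -natrX ler_nat.
have goalE : 16 * p * t.+1%:R <= 256 * c / ln 2 * q * ln (2 * #|H|%:R).
  have -> : 256 * c / ln 2 * q * ln (2 * #|H|%:R) = 16 * p * (ln (2 * #|H|%:R) / ln 2).
    by rewrite /p; field; rewrite gt_eqF.
  by rewrite ler_wpM2l ?mulr_ge0 // ler_pdivlMr.
apply: le_trans goalE.
have [p1|p1] := lerP (16 * p) 1; last first.
  apply: (le_trans p_c_le1); apply: le_trans (ltW p1) _.
  by rewrite ler_peMr ?ler1n // mulr_ge0.
have a01 : 0 <= 16 * p <= 1 by rewrite p1 mulr_ge0.
apply: le_trans (_ : 1 - (1 - 16 * p) ^+ t.+1 <= _); last first.
  by rewrite [leRHS]mulrC one_sub_exp_le.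
apply: p_c_le.
  rewrite subr_ge0 lerBlDr lerDl exprn_ge0 ?exprn_ile1 ?subr_ge0 //.
  by rewrite lerBlDr lerDl mulr_ge0.
rewrite prob_contains_copy.
have copyP S : S \in copies H (Kn n) -> exists f : 'I_n -> 'I_n,
    [/\ {in cover H &, injective f}, S = gim f H & S \subset Kn n].
  by move=> /(copiesP _ HK (subxx _))[f finj [SE SK]]; exists f.
(* Every cover costs at least 1 at [p], so [park_pham] applies with bound 1; its error series is at
   most 1/3. *)
apply: le_trans (_ : 1 - \sum_(i < t.+1) (1 / 4) ^+ i.+1 <= _).
  have := sum_quarters R t.+1; move: (\sum_(i < _) _) => x; lra.
rewrite lerBlDr; apply: park_pham => // [S /copyP[f [finj -> SK]]|U /forall_inP covU].
  by rewrite card_gim.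
have := average (w := fun=> 1) (P := fun A => A \in U) _ _; rewrite -/p.
under eq_bigr do rewrite mul1r.
apply=> [A _|s]; first exact: ler01.
have /exists_inP[A AU As] := covU _ (perm_copy s HK).
by rewrite (bigD1 A) ?AU //= lerDl sumr_ge0.
Qed.

End ThresholdBounds.

Theorem mainTheorem5 (R : realType) :
  exists C : R, 0 < C /\
    forall (n : nat) (H : {set {set 'I_n}}),
      H \subset Kn n ->
      (0 < #|H|)%N ->
      is_tree H \/
        2 * #|H|%:R / #|cover H|%:R >= ln ((max_degree H)%:R : R) ->
      p_E_star R H <= C * p_E R H /\
      p_c R H <= C * p_E R H * ln (2 * #|H|%:R).
Proof.
(* The sum of the constants of the dense case and the tree case, so it exceeds both. The factor
   [256 / ln 2] comes from [p_c_bound] and exceeds the 16 of [p_E_star_bound], as [ln 2 <= 16]. *)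
pose c : R := 128 * expR 8 + 20 * (288 * 64).
have e0 : 0 < expR 8 :> R := expR_gt0 _.
have c0 : 0 < c by rewrite addr_gt0 ?mulr_gt0.
have ln2 : 0 < ln 2 :> R by rewrite ln_gt0 // ltr1n.
have ln2_le : ln 2 <= 16 :> R.
  by rewrite (le_trans (ltW (ln_sublinear _))) ?ler_nat.
exists (256 * c / ln 2); split; first by rewrite divr_gt0 ?mulr_gt0.
move=> n H HK Hgt0 hyp; have H0 : H != set0 by rewrite -card_gt0.
set q := p_E R H; have q0 : 0 <= q := p_E_ge0 R HK.
have hq (J : {set {set 'I_n}}) : J \subset H -> J != set0 -> 1 / 2 <= (num_copies J (Kn n))%:R * q ^+ #|J|.
  exact: p_E_attained.
have q_gt0 : 0 < q.
  rewrite lt_neqAle q0 andbT; apply: contraTneq (hq H (subxx _) H0) => <-.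
  by rewrite expr0n gtn_eqF //= mulr0 -ltNge divr_gt0.
have con (I : {set {set 'I_n}}) : I \subset H -> I != set0 -> connected_graph I ->
    #|embs I H|%:R <= (c * q) ^+ #|I| * n%:R ^+ #|cover I|.
  move=> IH I0 Icon.
  have mono (d : R) : 0 <= d <= c ->
      (d * q) ^+ #|I| * n%:R ^+ #|cover I| <= (c * q) ^+ #|I| * n%:R ^+ #|cover I|.
    move=> /andP[d0 dc]; rewrite ler_wpM2r ?exprn_ge0 // lerXn2r ?nnegrE ?mulr_ge0 ?(ltW c0) //.
    by rewrite ler_wpM2r.
  case: hyp => [Htree|dense].
    have := tree_embs HK Htree q_gt0 hq IH I0 Icon; rewrite card_ord => /le_trans; apply.
    by apply: mono; rewrite lerDr !mulr_ge0 ?(ltW e0).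
  have := dense_embs HK H0 q0 hq dense IH I0 Icon; rewrite card_ord => /le_trans; apply.
  by apply: mono; rewrite lerDl !mulr_ge0 ?(ltW e0).
split; last by apply: p_c_bound (ltW c0) con.
apply: le_trans (p_E_star_bound HK (ltW c0) con) _; rewrite ler_wpM2r //.
rewrite ler_pdivlMr // [leRHS](_ : _ = 16 * c * 16); last by ring.
by rewrite ler_wpM2l ?mulr_ge0 ?(ltW c0).
Qed.
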